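(* Let $1\le q<\infty$, let $(\Omega,\mu)$ be a measure space, $n\ge1$, and let $X_1,\dots,X_n,Y_1,\dots,Y_n$ be independent symmetric random variables with logarithmically concave tails satisfying the normalization $\inf\{t\ge 0: N^X_i(t)\ge 1\}=\inf\{t\ge0: M^Y_j(t)\ge 1\}=1$ for all $i,j$. Let $(a_{ij})_{i,j\le n}$ be an $L_q(\Omega,\mu)$-valued matrix. Then for every $p\ge1$, \begin{align*} \Big\|\sum_{i,j}a_{ij}X_iY_j\Big\|_p\le C(q)\Bigg(&\mathbb{E}\Big\|\sum_{i,j}a_{ij}X_iY_j\Big\|_{L_q}+\sup_{x\in B^X_p}\mathbb{E}\Big\|\sum_{i,j}a_{ij}x_iY_j\Big\|_{L_q}+\sup_{y\in B^Y_p}\mathbb{E}\Big\|\sum_{i,j}a_{ij}X_iy_j\Big\|_{L_q}\\ &+\sup_{f\in B^*(L_q)}\Big\|\Big(\sqrt{\textstyle\sum_jf(a_{ij})^2}\Big)_i\Big\|_{X,p}+\sup_{f\in B^*(L_q)}\big\|(f(a_{ij}))_{ij}\big\|_{X,Y,p}\\ &+p\max_i\sup_{f\in B^*(L_q)}\sqrt{\textstyle\sum_jf(a_{ij})^2}\Bigg), \end{align*} where $C(q)$ depends only on $q$ and $\|Z\|_p=(\mathbb{E}\|Z\|_{L_q}^p)^{1/p}$.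
   Context: A random variable $Z$ has logarithmically concave tails if $t\mapsto -\ln\mathbb{P}(|Z|\ge t)\in[0,\infty]$ is convex on $[0,\infty)$. Set $N^X_i(t)=-\ln\mathbb{P}(|X_i|\ge t)$, $M^Y_j(t)=-\ln\mathbb{P}(|Y_j|\ge t)$, $\hat N^X_i(t)=t^2$ for $|t|\le1$ and $\hat N^X_i(t)=N^X_i(|t|)$ for $|t|>1$, and $\hat M^Y_j$ analogously. $B^X_p=\{x\in\mathbb{R}^n:\sum_i\hat N^X_i(x_i)\le p\}$, $B^Y_p=\{y\in\mathbb{R}^n:\sum_j\hat M^Y_j(y_j)\le p\}$. For real $(b_i)$, $\|(b_i)\|_{X,p}=\sup_{x\in B^X_p}\sum_ib_ix_i$; for a real matrix, $\|(b_{ij})\|_{X,Y,p}=\sup\{\sum_{ij}b_{ij}x_iy_j:x\in B^X_p,y\in B^Y_p\}$. $B^*(L_q)$ is the unit ball of the dual of $L_q(\Omega,\mu)$. *)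

(* Defs.v *)
From HB Require Import structures.
From mathcomp Require Import all_boot all_order all_algebra.
From mathcomp Require Import all_classical all_reals all_analysis.
Set Implicit Arguments. Unset Strict Implicit. Unset Printing Implicit Defensive.
Import Order.TTheory GRing.Theory Num.Theory.
Local Open Scope classical_set_scope.
Local Open Scope ring_scope.

Section Defs.
Context {R : realType}.

Section Prob.
Context {d : measure_display} {Om : measurableType d} (P : probability Om R).

Definition mutually_independent {I : finType} (Z : I -> Om -> R) : Prop :=
  forall B : I -> set R, (forall i, measurable (B i)) ->
    P [set w | forall i, B i (Z i w)] =
    (\prod_(i : I) fine (P (Z i @^-1` B i)))%:E.

Definition symmetric_rv (Z : Om -> R) : Prop :=
  forall B : set R, measurable B ->
    P (Z @^-1` B) = P ((fun w => - Z w) @^-1` B).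

Definition Ntail (Z : Om -> R) (t : R) : \bar R :=
  let pr := P [set w | t <= `|Z w|] in
  if pr == 0%E then +oo%E else (- ln (fine pr))%:E.

Definition logconcave_tails (Z : Om -> R) : Prop :=
  forall s t l : R, 0 <= s -> 0 <= t -> 0 < l < 1 ->
    (Ntail Z (l * s + (1 - l) * t) <=
       l%:E * Ntail Z s + (1 - l)%:E * Ntail Z t)%E.

Definition normalized_tail (Z : Om -> R) : Prop :=
  ereal_inf [set t%:E | t in [set t : R | 0 <= t /\ (1 <= Ntail Z t)%E]] = 1%E.

Definition Nhat (Z : Om -> R) (t : R) : \bar R :=
  if `|t| <= 1 then (t ^+ 2)%:E else Ntail Z `|t|.

Definition Bp {n : nat} (X : 'I_n -> Om -> R) (p : R) : set ('I_n -> R) :=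
  [set x | (\sum_(i < n) Nhat (X i) (x i) <= p%:E)%E].

Definition normXp {n : nat} (X : 'I_n -> Om -> R) (p : R) (b : 'I_n -> R) : \bar R :=
  ereal_sup [set (\sum_(i < n) b i * x i)%:E | x in Bp X p].

Definition normXYp {n : nat} (X Y : 'I_n -> Om -> R) (p : R)
    (b : 'I_n -> 'I_n -> R) : \bar R :=
  ereal_sup [set r | exists x y, Bp X p x /\ Bp Y p y /\
     r = (\sum_(i < n) \sum_(j < n) b i j * x i * y j)%:E].

End Prob.

Section Lq.
Context {d : measure_display} {T : measurableType d} (mu : {measure set T -> \bar R}).

Definition Lqnorm (q : R) (g : T -> R) : \bar R := Lnorm mu q%:E (EFin \o g).

Definition inLq (q : R) (g : T -> R) : Prop :=
  measurable_fun setT g /\ (Lqnorm q g < +oo)%E.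

Definition dual_ball (q : R) (f : (T -> R) -> R) : Prop :=
  (forall g h, inLq q g -> inLq q h -> f (g \+ h) = f g + f h) /\
  (forall (c : R) g, inLq q g -> f (fun w => c * g w) = c * f g) /\
  (forall g, inLq q g -> ((`|f g|)%:E <= Lqnorm q g)%E).

End Lq.
End Defs.

(* Main.v *)
Require Import Defs.
From HB Require Import structures.
From mathcomp Require Import all_boot all_order all_algebra.
From mathcomp Require Import all_classical all_reals all_analysis.
From mathcomp Require Import measurable_realfun ring lra zify.
Set Implicit Arguments. Unset Strict Implicit. Unset Printing Implicit Defensive.
Import Order.TTheory GRing.Theory Num.Theory numFieldNormedType.Exports.
Local Open Scope classical_set_scope.
Local Open Scope ring_scope.

(** The norm of [sum_ij a_ij x_i y_j] in [L_q] is a supremum over matrices [b = f(a_ij)] of the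
bilinear forms [<b, x (x) y>], and nothing else about [L_q] matters, so the constant does not even
depend on [q].  After rounding [X] and [Y] to a finite grid everything is a finite sum.

For linear forms, a Wills-type inequality
  [E exp (max_v (<v, X>/300 - sum_i Nhat_i^*(v_i))) <= exp (E max_v 1000 <v, X>)]
tensorizes from dimension one and shows that [max_v <v, X>] has its [p]-th moment bounded by
[E max_v <v, X>] plus the supremum of [<v, x>] over [B_p^X] and [v].  Applied conditionally on [Y] it
reduces the theorem to bounding the process [max_b <b, x (x) Y>] uniformly in [x] in [B_p^X].
For such an [x], a tilted law with mean [x/6] and density of second moment at most [e^{2p}] expresses
the process at [x] as a tilted mean of its values at [X]; the one-variable bound for [Y], with weights
normalized by [t + E_Y max_b <b, X (x) Y> + ||(sum_i b_ij X_i)_j||_{Y,p}], then controls all [x] by one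
random factor with bounded [p]-th moment.  The second moment of [||(sum_i b_ij X_i)_j||_{Y,p}] is
bounded for each fixed [b] by splitting [y]: coordinates at most 1 by Cauchy-Schwarz, coordinates
whose cost is small relative to their column norm by a direct moment computation, and the others by
a union bound over at most [e^{Cp}] boxes.  Passing to the limit in the
mesh uses Fatou's lemma and dominated convergence. *)

(** * Finite symmetric laws and the one-dimensional Laplace bound *)

(** The obstacle is a supremum over [x] in the ball taken jointly with the maximum over [b], too
    large a family for a union bound. The tilted mean separates the two: for one fixed [b], the form
    at [x] is six times a tilted mean of a size [Rad] of [b] at [X] times a normalized form, and the
    maximum over [b] is taken in the normalized form alone. Hence the dual norm inside [Rad] needs a
    second moment only for each single [b], not uniformly in [b]. The price is the second moment
    [e^{2q}] of the density; above the level [e^4], [r >= q / 2] additional powers of the normalized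
    form pay for it, which is why the argument runs with an integer exponent [P = 4 + r] comparable
    to [p]. The fourth and sixth terms act together through one number: they bound the
    Hilbert-Schmidt norm by [q * sum b_ij^2 <= 4 T^2], and this norm sets the threshold that splits
    the coordinates of [y] in the second-moment bound. Log-concavity is used in the form
    [N (k t) <= k N t] for [k <= 1], which survives rounding toward zero on a grid. *)

Section Maxf.
Variables (R : realType) (V : finType) (v0 : V).
Implicit Types F : V -> R.

(** The default [F v0] is itself one of the values, so the maximum is exact even when all values are
    negative. *)
Definition maxf F : R := \big[Num.max/F v0]_v F v.

Lemma le_maxf F v : F v <= maxf F.
Proof. exact: le_bigmax. Qed.

Lemma maxf_le F M : (forall v, F v <= M) -> maxf F <= M.
Proof. by move=> h; apply: bigmax_le. Qed.

Lemma maxf_ex F : exists v, maxf F = F v.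
Proof.
rewrite /maxf; elim/big_ind: _ => [|x y [v ->] [w ->]|v _]; [by exists v0| |by exists v].
by case: (leP (F v) (F w)) => _; [exists w|exists v].
Qed.

Lemma maxf_mono F F' : (forall v, F v <= F' v) -> maxf F <= maxf F'.
Proof. by move=> h; apply: maxf_le => v; apply: le_trans (h v) (le_maxf _ _). Qed.
End Maxf.

Section Law.
Variable R : realType.

Definition E1 (G : finType) (p : G -> R) (F : G -> R) : R := \sum_g p g * F g.

(* A finite symmetric law with weights [p], values [x] and costs [c], where [c g] stands for
   [Nhat (x g)].  The last three clauses are all that is kept of log-concavity and normalization:
   [Nhat t >= |t| - 1], a change of density [exp (c / 2)] costs a dilation by 3, and the law is not
   concentrated below 1/2. *)
Definition law (G : finType) (p x c : G -> R) : Prop :=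
  (forall g, 0 <= p g) /\ \sum_g p g = 1 /\
  (forall F : R -> R, E1 p (F \o x) = E1 p (fun g => F (- x g))) /\
  (forall g, 0 < p g -> 0 <= c g /\ `|x g| - 1 <= c g) /\
  (forall phi : R -> R, (forall u v, 0 <= u -> u <= v -> phi u <= phi v) -> (forall u, 0 <= u -> 0 <= phi u) ->
     E1 p (fun g => expR (c g / 2) * phi `|x g|) <= 4 * (phi 1 + E1 p (fun g => phi (3 * `|x g|)))) /\
  (forall phi : R -> R, (forall u v, 0 <= u -> u <= v -> phi u <= phi v) -> (forall u, 0 <= u -> 0 <= phi u) ->
     phi (1/2) <= 3 * E1 p (fun g => phi `|x g|)).

Section E1.
Variables (G : finType) (p : G -> R).
Hypothesis p0 : forall g, 0 <= p g.
Hypothesis p1 : \sum_g p g = 1.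

Lemma E1_le F F' : (forall g, 0 < p g -> F g <= F' g) -> E1 p F <= E1 p F'.
Proof.
move=> h; apply: ler_sum => g _.
have := p0 g; rewrite le_eqVlt => /orP[/eqP<-|pg]; first by rewrite !mul0r.
by rewrite ler_pM2l // h.
Qed.

Lemma E1_cst k : E1 p (fun=> k) = k.
Proof. by rewrite /E1 -mulr_suml p1 mul1r. Qed.

Lemma E1D F F' : E1 p (fun g => F g + F' g) = E1 p F + E1 p F'.
Proof. by rewrite /E1 -big_split; apply: eq_bigr => g _ /=; rewrite mulrDr. Qed.

Lemma E1Z k F : E1 p (fun g => k * F g) = k * E1 p F.
Proof. by rewrite /E1 mulr_sumr; apply: eq_bigr => g _; rewrite mulrCA. Qed.

Lemma E1_ge0 F : (forall g, 0 < p g -> 0 <= F g) -> 0 <= E1 p F.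
Proof. by move=> h; rewrite -[0](E1_cst 0); apply: E1_le. Qed.
Lemma eq_E1 F F' : F =1 F' -> E1 p F = E1 p F'.
Proof. by move=> h; apply: eq_bigr => g _; rewrite h. Qed.
End E1.

(* sup of [v x - x^2] over [|x| <= 1/2] *)
Definition qlow (v : R) : R := if `|v| <= 1 then v ^+ 2 / 4 else `|v| / 2 - 1 / 4.

Lemma qlow_lip v w : qlow v - qlow w <= `|v - w| / 2.
Proof.
have H (a b : R) : 0 <= a -> 0 <= b ->
  (if a <= 1 then a ^+ 2 / 4 else a / 2 - 1 / 4) - (if b <= 1 then b ^+ 2 / 4 else b / 2 - 1 / 4)
   <= `|a - b| / 2.
  move=> a0 b0; have := ler_norm (a - b); have := ler_norm (b - a); rewrite (distrC b a).
  move: (`|a - b|) => n nb na.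
  case: (leP a 1) => a1; case: (leP b 1) => b1; last lra.
  - case: (leP b a) => ab; last by nra.
    have : 0 <= (a - b) * (2 - a - b) by rewrite mulr_ge0 //; lra.
    nra.
  - have : 0 <= (1 - a) * (1 + a) by rewrite mulr_ge0 //; lra.
    nra.
  - have : 0 <= (1 - b) ^+ 2 by exact: sqr_ge0.
    nra.
have E u : qlow u = if `|u| <= 1 then `|u| ^+ 2 / 4 else `|u| / 2 - 1 / 4.
  by rewrite /qlow (real_normK (num_real u)).
rewrite !E; apply: le_trans (H _ _ (normr_ge0 _) (normr_ge0 _)) _.
by apply: ler_wpM2r; [rewrite invr_ge0 ler0n|exact: ler_dist_dist].
Qed.

Lemma qlow_ge (v : R) : `|v| / 2 - 1 / 4 <= qlow v.
Proof.
rewrite /qlow; case: ifP => // _; rewrite -(real_normK (num_real v)).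
set a := `|v|; have : 0 <= (1 - a) ^+ 2 by exact: sqr_ge0.
nra.
Qed.

(** Beyond 1, [v^2 / 136 <= |v| / 4 <= |v| / 2 - 1 / 4]. The range 34 is the one in which the
    Laplace bound [law_laplace] is needed. *)
Lemma qlow_sqr (v : R) : `|v| <= 34 -> v ^+ 2 / 136 <= qlow v.
Proof.
rewrite /qlow -(real_normK (num_real v)); set a := `|v|.
have a0 : 0 <= a by exact: normr_ge0.
by move=> a34; case: (leP a 1) => a1; nra.
Qed.

Lemma qlow_ge0 v : 0 <= qlow v.
Proof.
rewrite /qlow; case: ifPn => [_|]; first by rewrite divr_ge0 ?sqr_ge0.
rewrite -ltNge; lra.
Qed.

(* [e^u - 1 = (1 - e^-u) e^u <= u e^u] and [e^u - 1 <= u] read at [-u]. *)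
Lemma expR_le_quad (u : R) : expR u <= 1 + u + u ^+ 2 * expR `|u|.
Proof.
have h1 := expR_ge1Dx (- u).
have hp := expR_gt0 u.
have e1 : expR u * expR (- u) = 1 by rewrite expRxMexpNx_1.
have h2 : expR u - 1 <= u * expR u by nra.
have h3 := expR_ge1Dx u.
case: (leP 0 u) => u0; [rewrite ger0_norm //|rewrite ltr0_norm //].
  have : u * (expR u - 1) <= u * (u * expR u) by rewrite ler_wpM2l.
  nra.
set F := expR (- u) in h1 e1 *; set E := expR u in hp h2 h3 e1 *.
have F1 : 1 <= F by rewrite /F -expR0 ler_expR; lra.
have h5 : F - 1 <= - u * F by nra.
have h6 : (- u) * (E * (F - 1)) <= (- u) * (E * (- u * F)).
  by apply: ler_wpM2l; [lra|apply: ler_wpM2l => //; exact: ltW].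
have h7 : E * (- u * F) = - u by rewrite mulrCA e1 mulr1.
have h8 : u ^+ 2 * 1 <= u ^+ 2 * F by rewrite ler_wpM2l // sqr_ge0.
nra.
Qed.

End Law.

(** * The Wills-type inequality in dimension one *)

Section Wills1.
Variables (R : realType) (G V : finType) (v0 : V).
Variables (p x c : G -> R) (a l : V -> R).
Hypothesis Hlaw : law p x c.
Hypothesis Hl : forall v h, 0 < p h -> a v * x h <= l v + c h.
Hypothesis Hq : forall v, qlow (a v) <= l v.

Let p0 : forall h, 0 <= p h. Proof. by case: Hlaw. Qed.
Let p1 : \sum_h p h = 1. Proof. by case: Hlaw => _ []. Qed.
Let sym (F : R -> R) : E1 p (F \o x) = E1 p (fun g => F (- x g)).
Proof. by case: Hlaw => _ [_ []]. Qed.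
Let cge h : 0 < p h -> 0 <= c h /\ `|x h| - 1 <= c h.
Proof. by case: Hlaw => _ [_ [_ [H _]]]; exact: H. Qed.

Lemma law_expc : E1 p (fun h => expR (c h / 2)) <= 8.
Proof.
case: Hlaw => _ [_ [_ [_ [H _]]]].
have := H (fun=> 1) (fun _ _ _ _ => lexx _) (fun _ _ => ler01).
rewrite (eq_E1 p (F' := fun h => expR (c h / 2))) => [|h]; last by rewrite mulr1.
rewrite E1_cst //; lra.
Qed.

Lemma expR_half_le : expR (1 / 2) <= 2 :> R.
Proof.
have h1 := expR_ge1Dx (- (1 / 2) : R); have h2 := expRxMexpNx_1 (1 / 2 : R).
have h3 := expR_gt0 (1 / 2 : R); nra.
Qed.

Lemma law_sqr_exp h : 0 < p h -> x h ^+ 2 * expR (`|x h| / 8) <= 30 * expR (c h / 2).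
Proof.
move=> ph; have [c0 cx] := cge ph.
rewrite -(real_normK (num_real (x h))); move: (`|x h|) (normr_ge0 (x h)) cx => t t0 cx.
have H : 1 + (3 * t / 8) ^+ 2 / 2 <= expR (3 * t / 8).
  by apply: (@expR_ge1Dxn R (3 * t / 8) 1); lra.
have h1 : expR (3 * t / 8) * expR (t / 8) = expR (t / 2) by rewrite -expRD; congr expR; lra.
have h2 : expR (t / 2) <= 2 * expR (c h / 2).
  have -> : t / 2 = (t - 1) / 2 + 1 / 2 by lra.
  rewrite expRD mulrC; apply: ler_pM; rewrite ?expR_ge0 ?expR_half_le// ler_expR; lra.
have h3 : t ^+ 2 <= 15 * expR (3 * t / 8) by nra.
have h4 : t ^+ 2 * expR (t / 8) <= 15 * expR (3 * t / 8) * expR (t / 8).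
  by rewrite ler_wpM2r// expR_ge0.
by nra.
Qed.

(** The linear term vanishes by symmetry. Since [|w| / 300 <= 1 / 8], the remainder is at most
    [(w / 300)^2 * 30 * 8 = w^2 / 375], and [qlow w >= w^2 / 136] absorbs it. The factor 300 is
    spent here. *)
Lemma law_laplace w : `|w| <= 34 -> E1 p (fun h => expR (w * x h / 300 - qlow w)) <= 1.
Proof.
move=> w34; have E0 : E1 p x = 0.
  have := sym id; rewrite /= => e.
  have e2 : E1 p (fun g => - x g) = - E1 p x.
    by rewrite /E1 -sumrN; apply: eq_bigr => h _; rewrite mulrN.
  have : E1 p x = - E1 p x by rewrite -e2 -e; apply: eq_E1.
  lra.
have E2 : E1 p (fun h => expR (w * x h / 300)) <= 1 + w ^+ 2 / 375.
  apply: (@le_trans _ _ (E1 p (fun h => 1 + (w / 300 * x h + (w / 300) ^+ 2 * 30 * expR (c h / 2))))).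
    apply: E1_le => // h ph; apply: le_trans (expR_le_quad _) _.
    have -> : w * x h / 300 = w / 300 * x h by rewrite mulrAC.
    rewrite -addrA lerD2l lerD2l.
    have h1 := law_sqr_exp ph.
    have h2 : expR `|w / 300 * x h| <= expR (`|x h| / 8).
      rewrite ler_expR normrM [`|x h| / 8]mulrC ler_wpM2r // normrM.
      have e300 : `|300^-1| = 300^-1 :> R by rewrite normfV normr_nat.
      rewrite e300; lra.
    have h3 : (w / 300 * x h) ^+ 2 * expR `|w / 300 * x h| <= (w / 300 * x h) ^+ 2 * expR (`|x h| / 8).
      by apply: ler_wpM2l; [exact: sqr_ge0|].
    have h4 : (w / 300) ^+ 2 * (x h ^+ 2 * expR (`|x h| / 8)) <= (w / 300) ^+ 2 * (30 * expR (c h / 2)).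
      by apply: ler_wpM2l; [exact: sqr_ge0|].
    by apply: le_trans h3 _; rewrite (exprMn 2 (w / 300)) -[leLHS]mulrA -[leRHS]mulrA.
  rewrite E1D E1D E1_cst // !E1Z E0; have := law_expc; have := sqr_ge0 w; nra.
rewrite (eq_E1 p (F' := fun h => expR (- qlow w) * expR (w * x h / 300))); last first.
  by move=> h; rewrite -expRD addrC.
rewrite E1Z expRN mulrC ler_pdivrMr ?expR_gt0 // mul1r.
apply: le_trans E2 _; apply: le_trans (expR_ge1Dx _); rewrite lerD2l.
by have := qlow_sqr w34; have := sqr_ge0 w; nra.
Qed.

Section Centered.
Variables (g : V -> R) (v1 : V).
Hypothesis g1 : g v1 = 0.
Hypothesis g_le0 : forall v, g v <= 0.

Let m v := `|a v - a v1|.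
(** Gain obtained by leaving the maximizer [v1] of [g], with slopes measured relative to [a v1].
    Since [g <= 0 = g v1], it is nonnegative and satisfies [J (k y) <= k J y] for [k <= 1]. *)
Let J y := maxf v0 (fun v => m v * y + g v).
Let m0 v : 0 <= m v. Proof. exact: normr_ge0. Qed.

Let J_ge0 y : 0 <= J y.
Proof. by apply: le_trans (le_maxf v0 _ v1); rewrite g1 /m subrr normr0 mul0r addr0. Qed.
Let J_mono u v : 0 <= u -> u <= v -> J u <= J v.
Proof. by move=> _ uv; apply: maxf_mono => w; rewrite lerD2r ler_wpM2l. Qed.
Let J_scale k y : 0 <= k -> k <= 1 -> J (k * y) <= k * J y.
Proof.
move=> k0 k1; apply: maxf_le => v.
have : k * (m v * y + g v) <= k * J y by rewrite ler_wpM2l// le_maxf.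
have := g_le0 v; nra.
Qed.

Let W h := maxf v0 (fun v => a v * x h / 300 - l v + g v).
Let EJ := E1 p (fun h => J (1000 * `|x h|)).

Let EJ0 : 0 <= EJ. Proof. by apply: E1_ge0. Qed.

Let J500 : J 500 <= 3 * EJ.
Proof.
case: Hlaw => _ [_ [_ [_ [_ H]]]].
have := H (fun y => J (1000 * y)) _ _.
have -> : 1000 * (1 / 2) = 500 :> R by lra.
by apply=> *; [apply: J_mono; lra|].
Qed.

Let Wle h : 0 < p h -> W h <= c h / 300.
Proof.
move=> ph; apply: maxf_le => v; have := Hl v ph; have := g_le0 v.
have := qlow_ge0 (a v); have := Hq v; lra.
Qed.

(** Symmetrization: of the maxima at [x] and [-x], one is tested at [v] and the other at [v1], so
    that the slope [a v1] cancels and [|a v - a v1|] remains. *)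
Lemma wills1_rhs :
  EJ / 2 <= E1 p (fun h => maxf v0 (fun v => 1000 * a v * x h + g v)).
Proof.
pose H y := maxf v0 (fun v => 1000 * a v * y + g v).
have e : E1 p (fun h => H (x h)) = E1 p (fun h => H (- x h)) by exact: sym.
have : EJ <= E1 p (fun h => H (x h) + H (- x h)).
  apply: E1_le => // h _; apply: maxf_le => v.
  have q1 := le_maxf v0 (fun v => 1000 * a v * x h + g v) v.
  have q2 := le_maxf v0 (fun v => 1000 * a v * x h + g v) v1.
  have q3 := le_maxf v0 (fun v => 1000 * a v * - x h + g v) v.
  have q4 := le_maxf v0 (fun v => 1000 * a v * - x h + g v) v1.
  rewrite -/(H (x h)) -/(H (- x h)) in q1 q2 q3 q4; rewrite /= g1 in q1 q2 q3 q4.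
  have -> : m v * (1000 * `|x h|) = 1000 * `|(a v - a v1) * x h| by rewrite normrM /m; lra.
  case: (leP 0 ((a v - a v1) * x h)) => s; [rewrite ger0_norm //|rewrite ltr0_norm //]; nra.
rewrite E1D -e -/H; lra.
Qed.

(** Three regimes. If [J 9 >= 1], the right side exceeds the crude bound 8. Otherwise
    [g v <= 1 - 9 m v] penalizes slopes far from [a v1]. If moreover [|a v1| > 34], then [l v] or
    [- g v] is at least 8 for every [v]; if [|a v1| <= 34], [W] is compared with the single affine
    function attached to [v1]. *)
Lemma wills1_centered : E1 p (fun h => expR (W h)) <= expR (EJ / 2).
Proof.
have X8 := law_expc.
have R1 : 1 + EJ / 2 <= expR (EJ / 2) by exact: expR_ge1Dx.
have X2 : E1 p (fun h => expR (W h)) <= 8.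
  apply: le_trans X8; apply: E1_le => // h ph; rewrite ler_expR.
  have := Wle ph; have [] := cge ph; lra.
case: (leP 1 (J 9)) => J9.
  have : J 9 <= 9 / 500 * J 500.
    have := @J_scale (9 / 500) 500; have -> : 9 / 500 * 500 = 9 :> R by lra.
    by apply; lra.
  move=> q; have := J500; lra.
have gm v : g v <= 1 - 9 * m v.
  have := le_maxf v0 (fun v => m v * 9 + g v) v; rewrite -/(J 9) /=; lra.
case: (leP `|a v1| 34) => a34; last first.
  have W8 h : 0 < p h -> W h <= c h / 2 - 8.
    move=> ph; have [c0 _] := cge ph; apply: maxf_le => v.
    have := Hl v ph; have := g_le0 v; have := gm v; have := Hq v.
    have := qlow_ge0 (a v); have := qlow_ge (a v).
    case: (leP (m v) 1) => m1; last lra.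
    have : `|a v1| <= `|a v| + m v.
      by rewrite /m distrC; apply: le_trans (ler_normD _ _); rewrite addrC subrK.
    lra.
  apply: (@le_trans _ _ 1); last by apply: le_trans R1; rewrite lerDl divr_ge0.
  apply: (@le_trans _ _ (E1 p (fun h => expR (- 8) * expR (c h / 2)))).
    by apply: E1_le => // h ph; rewrite -expRD ler_expR addrC; exact: W8.
  have e8 := expR_ge1Dx (8 : R); have n8 := expR_gt0 (- 8 : R).
  have : expR (- 8) * 8 <= expR (8 : R) * expR (- 8) by rewrite mulrC ler_wpM2r ?ltW //; lra.
  rewrite E1Z expRxMexpNx_1; apply: le_trans; by rewrite ler_wpM2l // ltW.
pose b h := a v1 * x h / 300 - qlow (a v1).
(* [l v >= qlow (a v) >= qlow (a v1) - m v / 2]: the Lipschitz constant 1/2 of [qlow] is the summand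
   1/2 in the argument of [J]. *)
have Wb h : W h <= b h + J (`|x h| / 300 + 1 / 2).
  apply: maxf_le => v; have := Hq v; have := qlow_lip (a v1) (a v).
  have := le_maxf v0 (fun v => m v * (`|x h| / 300 + 1 / 2) + g v) v; rewrite -/(J _) /=.
  rewrite /b distrC -/(m v); have : (a v - a v1) * x h <= m v * `|x h|.
    by rewrite /m -normrM ler_norm.
  lra.
(* By convexity [e^b >= e^W (1 + b - W)], so [e^W] exceeds [e^b] by at most [e^W (W - b)], which is
   linear in [J]. *)
have W2 h : 0 < p h -> expR (W h) <= expR (b h) + (J 1 * expR (c h / 2) + expR (c h / 2) * J (`|x h| / 150)).
  move=> ph; have [c0 _] := cge ph.
  have e1 : expR (W h) * (1 + (b h - W h)) <= expR (b h).
    have -> : b h = W h + (b h - W h) by lra.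
    rewrite [X in _ <= X]expRD ler_wpM2l ?expR_ge0 //.
    have -> : W h + (b h - W h) - W h = b h - W h by lra.
    exact: expR_ge1Dx.
  have e2 : expR (W h) <= expR (c h / 2) by rewrite ler_expR; have := Wle ph; lra.
  have e3 : J (`|x h| / 300 + 1 / 2) <= J 1 + J (`|x h| / 150).
    have n0 := normr_ge0 (x h).
    case: (leP (`|x h|) 150) => t.
      have : J (`|x h| / 300 + 1 / 2) <= J 1 by apply: J_mono; lra.
      by have := J_ge0 (`|x h| / 150); lra.
    have : J (`|x h| / 300 + 1 / 2) <= J (`|x h| / 150) by apply: J_mono; lra.
    by have := J_ge0 1; lra.
  have e4 := Wb h; have e5 := J_ge0 (`|x h| / 300 + 1 / 2).
  have e6 : expR (W h) * (W h - b h) <= expR (W h) * J (`|x h| / 300 + 1 / 2).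
    by rewrite ler_wpM2l ?expR_ge0 //; lra.
  have e7 : expR (W h) * J (`|x h| / 300 + 1 / 2) <= expR (c h / 2) * (J 1 + J (`|x h| / 150)).
    by apply: ler_pM; rewrite ?expR_ge0.
  nra.
apply: le_trans (E1_le p0 W2) _; rewrite E1D E1D E1Z.
have q1 := law_laplace a34; rewrite -/b in q1.
have q2 : E1 p (fun h => expR (c h / 2) * J (`|x h| / 150)) <= 4 * (J 1 + EJ / 500).
  case: Hlaw => _ [_ [_ [_ [H _]]]].
  have := H (fun y => J (y / 150)) _ _; move=> /(_ _ _) q.
  apply: le_trans (q _ _) _; [by move=> u v u0 uv; apply: J_mono; lra|by []|].
  have s1 : J (1 / 150) <= J 1 by apply: J_mono; lra.
  have s2 : E1 p (fun h => J (3 * `|x h| / 150)) <= EJ / 500.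
    rewrite mulrC -E1Z; apply: E1_le => // h _.
    have -> : 3 * `|x h| / 150 = 500^-1 * (10 * `|x h|) by lra.
    apply: le_trans (J_scale _ _ _) _; [lra|lra|].
    apply: ler_wpM2l; first by rewrite invr_ge0 ler0n.
    by apply: J_mono; have := normr_ge0 (x h); lra.
  lra.
have q3 : J 1 <= 1 / 500 * J 500.
  have := @J_scale (1 / 500) 500; have -> : 1 / 500 * 500 = 1 :> R by lra.
  by apply; lra.
(* The total is at most [1 + 12 J 1 + 4 EJ / 500 <= 1 + 40 EJ / 500], below [1 + EJ / 2]. *)
have := J500; have := J_ge0 1; nra.
Qed.
End Centered.

(** Adding a constant to [g] multiplies both sides by the same exponential, so the maximum of [g]
    may be taken to be 0. *)
Lemma wills1 (g : V -> R) :
  E1 p (fun h => expR (maxf v0 (fun v => a v * x h / 300 - l v + g v))) <=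
  expR (E1 p (fun h => maxf v0 (fun v => 1000 * a v * x h + g v))).
Proof.
have [v1 gv1] := maxf_ex v0 g.
pose g' v := g v - g v1.
have H1 : g' v1 = 0 by rewrite /g' subrr.
have H2 v : g' v <= 0 by rewrite /g' subr_le0 -gv1 le_maxf.
have A := wills1_centered H1 H2; have B := wills1_rhs H1.
apply: (@le_trans _ _ (E1 p (fun h => expR (g v1) * expR (maxf v0 (fun v => a v * x h / 300 - l v + g' v))))).
  apply: E1_le => // h _; rewrite -expRD ler_expR; apply: maxf_le => v.
  have := le_maxf v0 (fun v => a v * x h / 300 - l v + g' v) v; rewrite /g' /=; lra.
rewrite E1Z; apply: (@le_trans _ _ (expR (g v1 + E1 p (fun h => maxf v0 (fun v => 1000 * a v * x h + g' v))))).
  rewrite expRD ler_wpM2l ?expR_ge0 //; apply: le_trans A _; rewrite ler_expR; exact: B.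
rewrite ler_expR -[X in X + _](E1_cst p1) -E1D; apply: E1_le => // h _.
have [w ->] := maxf_ex v0 (fun v => 1000 * a v * x h + g' v).
have := le_maxf v0 (fun v => 1000 * a v * x h + g v) w; rewrite /g' /=; lra.
Qed.
End Wills1.

(** * Product laws *)

Section Product.
Variable R : realType.

Definition pw n (G : finType) (p : 'I_n -> G -> R) (w : {ffun 'I_n -> G}) : R :=
  \prod_i p i (w i).

Definition consw n (G : finType) (g : G) (w : {ffun 'I_n -> G}) : {ffun 'I_n.+1 -> G} :=
  [ffun i => oapp w g (unlift ord0 i)].

Definition consv n (T : Type) (a : T) (v : 'I_n -> T) : 'I_n.+1 -> T :=
  fun i => oapp v a (unlift ord0 i).

Lemma consw0 n (G : finType) g (w : {ffun 'I_n -> G}) : consw g w ord0 = g.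
Proof. by rewrite ffunE unlift_none. Qed.
Lemma conswS n (G : finType) g (w : {ffun 'I_n -> G}) i : consw g w (lift ord0 i) = w i.
Proof. by rewrite ffunE liftK. Qed.
Lemma consv0 n (T : Type) (a : T) (v : 'I_n -> T) : consv a v ord0 = a.
Proof. by rewrite /consv unlift_none. Qed.
Lemma consvS n (T : Type) (a : T) (v : 'I_n -> T) i : consv a v (lift ord0 i) = v i.
Proof. by rewrite /consv liftK. Qed.

Lemma pw_ge0 n (G : finType) (p : 'I_n -> G -> R) :
  (forall i g, 0 <= p i g) -> forall w, 0 <= pw p w.
Proof. by move=> h w; apply: prodr_ge0. Qed.

Lemma sum_pw n (G : finType) (p : 'I_n -> G -> R) :
  (forall i, \sum_g p i g = 1) -> \sum_w pw p w = 1.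
Proof.
move=> h; rewrite /pw -(bigA_distr_bigA p) /=; exact: big1.
Qed.

Lemma E1_prod n (G : finType) (p : 'I_n -> G -> R) (F : 'I_n -> G -> R) :
  E1 (pw p) (fun w => \prod_i F i (w i)) = \prod_i E1 (p i) (F i).
Proof.
rewrite /E1 bigA_distr_bigA /=; apply: eq_bigr => w _; by rewrite /pw -big_split.
Qed.

Lemma E1_pwS n (G : finType) (p : 'I_n.+1 -> G -> R) F :
  E1 (pw p) F = E1 (p ord0) (fun g => E1 (pw (fun i => p (lift ord0 i))) (fun w => F (consw g w))).
Proof.
rewrite /E1; under [RHS]eq_bigr do rewrite mulr_sumr.
rewrite pair_big /= (reindex (fun u : G * {ffun 'I_n -> G} => consw u.1 u.2)) /=; last first.
  exists (fun w => (w ord0, [ffun i => w (lift ord0 i)])).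
    move=> [g w] _ /=; rewrite consw0; congr pair; apply/ffunP => i.
    by rewrite ffunE conswS.
  move=> w _ /=; apply/ffunP => i; rewrite ffunE.
  by case: unliftP => [j|] -> //=; rewrite ffunE.
apply: eq_bigr => -[g w] _ /=; rewrite mulrA; congr (_ * _).
rewrite /pw big_ord_recl consw0; congr (_ * _).
by apply: eq_bigr => i _; rewrite conswS.
Qed.

Lemma E1_pw0 (G : finType) (p : 'I_0 -> G -> R) F :
  E1 (pw p) F = F [ffun i : 'I_0 => False_rect _ (Bool.diff_false_true (ltn_ord i))].
Proof.
set w0 := finfun _; rewrite /E1 (bigD1 w0) //= big1 ?addr0 => [|w].
  by rewrite /pw big_ord0 mul1r.
by rewrite (_ : w = w0) ?eqxx //; apply/ffunP => -[].
Qed.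

Lemma E1_swap (G H : finType) (p : G -> R) (q : H -> R) F :
  E1 p (fun g => E1 q (F g)) = E1 q (fun h => E1 p (F ^~ h)).
Proof.
rewrite /E1; under eq_bigr do rewrite mulr_sumr.
under [RHS]eq_bigr do rewrite mulr_sumr.
by rewrite exchange_big; apply: eq_bigr => h _; apply: eq_bigr => g _; rewrite mulrCA.
Qed.

Lemma E1_expR_ge (G : finType) (p : G -> R) F :
  (forall g, 0 <= p g) -> \sum_g p g = 1 -> expR (E1 p F) <= E1 p (fun g => expR (F g)).
Proof.
move=> p0 p1; pose m := E1 p F.
apply: (@le_trans _ _ (E1 p (fun g => expR m * (1 - m) + expR m * F g))).
  by rewrite E1D E1_cst // E1Z -/m; nra.
apply: E1_le => // g _; have -> : F g = m + (F g - m) by lra.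
rewrite expRD -mulrDr ler_wpM2l ?expR_ge0 //.
by have := expR_ge1Dx (F g - m); lra.
Qed.

(** * Tensorization of the Wills-type inequality *)

Section Wills.
Variables (G V : finType) (v0 : V).

(** Induction on the coordinates; the free term [g] carries whatever is held fixed. Let [K w] be the
    exponent that [wills1] gives for the first coordinate when the others are [w]. After division by
    the exponential of the mean of [K], Jensen moves the mean over [w] outside the exponential, and
    for each [w] the mean over the first coordinate is at most 1. *)
Lemma wills n (p x c : 'I_n -> G -> R) (a l : 'I_n -> V -> R) (g : V -> R) :
  (forall i, law (p i) (x i) (c i)) ->
  (forall i v h, 0 < p i h -> a i v * x i h <= l i v + c i h) ->
  (forall i v, qlow (a i v) <= l i v) ->
  E1 (pw p) (fun w => expR (maxf v0 (fun v => \sum_i (a i v * x i (w i) / 300 - l i v) + g v))) <=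
  expR (E1 (pw p) (fun w => maxf v0 (fun v => \sum_i (1000 * a i v * x i (w i)) + g v))).
Proof.
elim: n p x c a l g => [|n IH] p x c a l g Hlaw Hl Hq.
  rewrite !E1_pw0 ler_expR; apply: maxf_mono => v; by rewrite !big_ord0.
pose p' i := p (lift ord0 i).
pose S h (w : {ffun 'I_n -> G}) v := \sum_i (1000 * a (lift ord0 i) v * x (lift ord0 i) (w i)) +
   (a ord0 v * x ord0 h / 300 - l ord0 v + g v).
pose K (w : {ffun 'I_n -> G}) := E1 (p ord0) (fun h => maxf v0 (fun v => 1000 * a ord0 v * x ord0 h +
    (\sum_i (1000 * a (lift ord0 i) v * x (lift ord0 i) (w i)) + g v))).
have pp0 i h : 0 <= p i h by case: (Hlaw i).
have pp1 i : \sum_h p i h = 1 by case: (Hlaw i) => _ [].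
have P0 : forall w, 0 <= pw p' w by apply: pw_ge0 => i g'; exact: pp0.
have P1 : \sum_w pw p' w = 1 by apply: sum_pw => i; exact: pp1.
rewrite [leLHS]E1_pwS.
apply: (@le_trans _ _ (E1 (p ord0) (fun h => expR (E1 (pw p') (fun w => maxf v0 (S h w)))))).
  apply: E1_le => // h _.
  have := IH p' (fun i => x (lift ord0 i)) (fun i => c (lift ord0 i)) (fun i => a (lift ord0 i))
    (fun i => l (lift ord0 i)) (fun v => a ord0 v * x ord0 h / 300 - l ord0 v + g v).
  move=> /(_ (fun i => Hlaw _) (fun i => Hl _) (fun i => Hq _)); apply: le_trans.
  apply: E1_le => // w _; rewrite ler_expR; apply: maxf_mono => v.
  rewrite big_ord_recl !consw0 addrA [X in X + g v]addrC.
  by under eq_bigr do rewrite conswS.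
have -> : E1 (pw p) (fun w => maxf v0 (fun v => \sum_i 1000 * a i v * x i (w i) + g v)) = E1 (pw p') K.
  rewrite E1_pwS E1_swap; apply: eq_E1 => w; apply: eq_E1 => h; congr maxf; apply/funext => v.
  by rewrite big_ord_recl consw0 addrA; under eq_bigr do rewrite conswS.
have Kw w : E1 (p ord0) (fun h => expR (maxf v0 (S h w))) <= expR (K w).
  have := wills1 v0 (Hlaw ord0) (Hl ord0) (Hq ord0)
    (fun v => \sum_i (1000 * a (lift ord0 i) v * x (lift ord0 i) (w i)) + g v).
  apply: le_trans; apply: E1_le => // h _; rewrite ler_expR; apply: maxf_mono => v.
  rewrite /S; lra.
rewrite -[leRHS]mul1r -ler_pdivrMr ?expR_gt0 // mulrC -E1Z.
apply: (@le_trans _ _ (E1 (p ord0) (fun h => E1 (pw p') (fun w => expR (maxf v0 (S h w)) / expR (K w))))).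
  apply: E1_le => // h _; rewrite -expRN -expRD addrC -[- E1 _ K]mulN1r -E1Z -E1D.
  apply: le_trans (E1_expR_ge _ P0 P1) _; apply: E1_le => // w _.
  by rewrite mulN1r expRB.
rewrite E1_swap -[leRHS](E1_cst P1); apply: E1_le => // w _.
under eq_E1 do rewrite mulrC.
rewrite E1Z mulrC ler_pdivrMr ?expR_gt0 // mul1r; exact: Kw.
Qed.
End Wills.

(** * Convex order for product laws *)

Definition cvx n (f : ('I_n -> R) -> R) : Prop :=
  forall x y t, 0 <= t -> t <= 1 ->
    f (fun i => t * x i + (1 - t) * y i) <= t * f x + (1 - t) * f y.

Definition cvx1 (f : R -> R) : Prop :=
  forall x y t, 0 <= t -> t <= 1 -> f (t * x + (1 - t) * y) <= t * f x + (1 - t) * f y.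

(** Coordinates are exchanged one at a time: averaging a convex function over the other coordinates
    leaves a convex function of the remaining one. *)
Lemma cvx_le_pw n (G G' : finType) (p x : 'I_n -> G -> R) (p' x' : 'I_n -> G' -> R) f :
  (forall i g, 0 <= p i g) -> (forall i g, 0 <= p' i g) ->
  (forall i F, cvx1 F -> E1 (p i) (fun g => F (x i g)) <= E1 (p' i) (fun g => F (x' i g))) ->
  cvx f ->
  E1 (pw p) (fun w => f (fun i => x i (w i))) <= E1 (pw p') (fun w => f (fun i => x' i (w i))).
Proof.
elim: n p x p' x' f => [|n IH] p x p' x' f p0 p'0 H cf.
  by rewrite !E1_pw0 le_eqVlt; apply/orP; left; apply/eqP; congr f; apply/funext => -[].
rewrite !E1_pwS.
have ec (T : finType) (y : 'I_n.+1 -> T -> R) g w :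
    (fun i => y i (consw g w i)) = consv (y ord0 g) (fun i => y (lift ord0 i) (w i)).
  apply/funext => i; case: (unliftP ord0 i) => [j|] ->; by rewrite ?conswS ?consvS ?consw0 ?consv0.
have ecc t (a b : R) u v : (fun i => t * consv a u i + (1 - t) * consv b v i) =
    consv (t * a + (1 - t) * b) (fun i : 'I_n => t * u i + (1 - t) * v i).
  apply/funext => i; case: (unliftP ord0 i) => [j|] ->; by rewrite ?consvS ?consv0.
apply: (@le_trans _ _ (E1 (p ord0) (fun g => E1 (pw (fun i => p' (lift ord0 i)))
    (fun w => f (consv (x ord0 g) (fun i => x' (lift ord0 i) (w i))))))).
  apply: E1_le => // g _; under eq_E1 do rewrite ec.
  have cg : cvx (fun v : 'I_n -> R => f (consv (x ord0 g) v)).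
    move=> u v t t0 t1; have := cf (consv (x ord0 g) u) (consv (x ord0 g) v) t t0 t1.
    rewrite ecc; by have -> : t * x ord0 g + (1 - t) * x ord0 g = x ord0 g by ring.
  have := IH (fun i => p (lift ord0 i)) (fun i => x (lift ord0 i)) (fun i => p' (lift ord0 i))
    (fun i => x' (lift ord0 i)) _ _ _ (fun i => H _) cg.
  by apply.
pose F y := E1 (pw (fun i => p' (lift ord0 i))) (fun w => f (consv y (fun i => x' (lift ord0 i) (w i)))).
apply: (@le_trans _ _ (E1 (p' ord0) (fun g => F (x' ord0 g)))); last first.
  by apply: E1_le => // g _; rewrite /F; under eq_E1 do rewrite -ec.
apply: H => a b t t0 t1; rewrite /F -!E1Z -E1D; apply: E1_le => [w|w _].
  by apply: pw_ge0 => i g; exact: p'0.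
set u := (fun i => x' _ _).
have := cf (consv a u) (consv b u) t t0 t1; rewrite ecc.
by have -> : (fun i => t * u i + (1 - t) * u i) = u by apply/funext => i; ring.
Qed.
End Product.

(** * Moments of suprema of linear forms *)

Section Cost.
Variable R : realType.

(* The properties of [Nhat] on the set [dom] of grid-reachable points where it is finite. *)
Definition cost_spec (dom : R -> Prop) (cost : R -> R) : Prop :=
  (forall t, dom t -> 0 <= cost t) /\
  (forall t, `|t| <= 1 -> dom t /\ cost t = t ^+ 2) /\
  (forall t, dom t -> 1 < `|t| -> `|t| <= cost t) /\
  (forall t k, dom t -> 0 <= k -> k <= 1 -> dom (k * t) /\ cost (k * t) <= k * cost t) /\
  (forall t, dom t -> dom (- t) /\ cost (- t) = cost t) /\
  (exists M, forall t, dom t -> `|t| <= M).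

Definition ball n (dom : 'I_n -> R -> Prop) (cost : 'I_n -> R -> R) (q : R) (t : 'I_n -> R) : Prop :=
  (forall i, dom i (t i)) /\ \sum_i cost i (t i) <= q.

Definition adapted (G : finType) (p x c : G -> R) (dom : R -> Prop) (cost : R -> R) :=
  forall h, 0 < p h -> dom (x h) /\ cost (x h) = c h.

Definition dot n (a t : 'I_n -> R) : R := \sum_i a i * t i.

Lemma cost_shrink dom cost s t : cost_spec dom cost -> dom t -> `|s| <= `|t| ->
  dom s /\ cost s <= cost t.
Proof.
move=> [c0 [_ [_ [sc [ev _]]]]] dt st.
have [t0|tn0] := eqVneq t 0.
  by move: st; rewrite t0 normr0 normr_le0 => /eqP ->; rewrite -t0.
pose k := `|s| / `|t|.
have tp : 0 < `|t| by rewrite normr_gt0.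
have k0 : 0 <= k by rewrite divr_ge0.
have k1 : k <= 1 by rewrite ler_pdivrMr // mul1r.
have [d1 d2] := sc _ _ dt k0 k1.
have {}d2 : cost (k * t) <= cost t.
  by apply: le_trans d2 _; rewrite ler_piMl // c0.
have : s = k * t \/ s = - (k * t).
  have e : `|k * t| = `|s| by rewrite normrM (ger0_norm k0) /k divfK // normr_eq0.
  case: (leP 0 s) => s0; case: (leP 0 (k * t)) => kt0; move: e;
  rewrite ?(ger0_norm s0) ?(ltr0_norm s0) ?(ger0_norm kt0) ?(ltr0_norm kt0) => e; lra.
by move=> [->|->] //; have [? ->] := ev _ d1.
Qed.

Lemma ball_shrink n dom cost q (s t : 'I_n -> R) : (forall i, cost_spec (dom i) (cost i)) ->
  ball dom cost q t -> (forall i, `|s i| <= `|t i|) -> ball dom cost q s.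
Proof.
move=> H [d c] st; split=> [i|]; first by have [] := cost_shrink (H i) (d i) (st i).
by apply: le_trans c; apply: ler_sum => i _; have [] := cost_shrink (H i) (d i) (st i).
Qed.

Lemma ballS n dom cost q q' (t : 'I_n -> R) : ball dom cost q t -> q <= q' -> ball dom cost q' t.
Proof. by move=> [d c] qq; split=> //; apply: le_trans c qq. Qed.

Lemma ball0 n dom cost q : (forall i : 'I_n, cost_spec (dom i) (cost i)) -> 0 <= q ->
  ball dom cost q (fun=> 0).
Proof.
move=> H q0; have h i : dom i 0 /\ cost i 0 = 0 ^+ 2.
  by case: (H i) => _ [h _]; apply: h; rewrite normr0.
split=> [i|]; first by have [] := h i.
by rewrite big1 // => i _; have [_ ->] := h i; rewrite expr0n.
Qed.

Lemma ballZ n dom cost q k (t : 'I_n -> R) : (forall i, cost_spec (dom i) (cost i)) ->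
  0 <= k -> k <= 1 -> ball dom cost q t -> ball dom cost (k * q) (fun i => k * t i).
Proof.
move=> H k0 k1 [d c]; have h i : dom i (k * t i) /\ cost i (k * t i) <= k * cost i (t i).
  by case: (H i) => _ [_ [_ [h _]]]; apply: h.
split=> [i|]; first by have [] := h i.
apply: (@le_trans _ _ (k * \sum_i cost i (t i))); last by rewrite ler_wpM2l.
by rewrite mulr_sumr; apply: ler_sum => i _; have [] := h i.
Qed.

(** Legendre transform of the cost restricted to [dom]. Boundedness of [dom], the last clause of
    [cost_spec], makes the supremum finite. *)
Definition conj_cost (dom : R -> Prop) (cost : R -> R) (a : R) : R :=
  sup [set a * t - cost t | t in [set t | dom t]]%classic.

Section Conj.
Variables (dom : R -> Prop) (cost : R -> R).
Hypothesis H : cost_spec dom cost.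

Let dom0 : dom 0. Proof. by case: H => _ [h _]; have [] := h 0 _; rewrite ?normr0. Qed.

Let has_sup_conj a : has_sup [set a * t - cost t | t in [set t | dom t]]%classic.
Proof.
case: H => c0 [_ [_ [_ [_ [M hM]]]]]; split; first by exists (a * 0 - cost 0), 0.
exists (`|a| * M) => _ [t dt <-]; have := c0 _ dt.
have : a * t <= `|a| * M.
  by apply: le_trans (ler_norm _) _; rewrite normrM ler_wpM2l // hM.
lra.
Qed.

Lemma conj_cost_ge a t : dom t -> a * t <= conj_cost dom cost a + cost t.
Proof.
move=> dt; rewrite -lerBlDr; apply: ub_le_sup; last by exists t.
by have [] := has_sup_conj a.
Qed.

Lemma conj_cost_adh a e : 0 < e -> exists2 t, dom t & conj_cost dom cost a <= a * t - cost t + e.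
Proof.
move=> e0; have [_ [t dt <-] h] := sup_adherent e0 (has_sup_conj a).
by exists t => //; rewrite /conj_cost; lra.
Qed.

Lemma conj_cost_qlow a : qlow a <= conj_cost dom cost a.
Proof.
have sq t : `|t| <= 1 -> a * t - t ^+ 2 <= conj_cost dom cost a.
  move=> t1; case: H => _ [h _]; have [dt <-] := h _ t1.
  by have := conj_cost_ge a dt; lra.
rewrite /qlow; case: (leP `|a| 1) => a1.
  have := sq (a / 2); rewrite normrM (ger0_norm (x := 2^-1)) ?invr_ge0 // => h.
  by have {h} : a * (a / 2) - (a / 2) ^+ 2 <= conj_cost dom cost a; [apply: h; lra|lra].
case: (leP 0 a) a1 => a0 a1.
  have := sq (1 / 2); rewrite ger0_norm ?divr_ge0 // => h.
  have {h} : a * (1 / 2) - (1 / 2) ^+ 2 <= conj_cost dom cost a by apply: h; lra.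
  rewrite ger0_norm //; lra.
have := sq (- (1 / 2)); rewrite normrN ger0_norm ?divr_ge0 // => h.
have {h} : a * - (1 / 2) - (- (1 / 2)) ^+ 2 <= conj_cost dom cost a by apply: h; lra.
rewrite ltr0_norm //; lra.
Qed.
End Conj.

(** Near-maximizers of the conjugates form one vector [t] of total cost [S]. If [S > q], scaling by
    [q / S] brings [t] into the ball, since costs are star-shaped; then [dot u t <= S], and the gain
    minus the cost is at most 0. *)
Lemma sum_conj_cost n dom cost q (u : 'I_n -> R) : (forall i, cost_spec (dom i) (cost i)) ->
  0 < q -> (forall t, ball dom cost q t -> dot u t <= q) ->
  \sum_i conj_cost (dom i) (cost i) (u i) <= q.
Proof.
move=> H q0 hu; apply/ler_addgt0Pr => e e0.
have e1 : 0 < e / n.+1%:R by rewrite divr_gt0.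
have [t ht] : {t : 'I_n -> R & forall i, dom i (t i) /\
    conj_cost (dom i) (cost i) (u i) <= u i * t i - cost i (t i) + e / n.+1%:R}.
  apply: (@choice _ _ (fun i t => dom i t /\ conj_cost (dom i) (cost i) (u i) <= u i * t - cost i t + e / n.+1%:R)).
  by move=> i; have [t dt h] := conj_cost_adh (H i) (u i) e1; exists t.
have s1 : \sum_i conj_cost (dom i) (cost i) (u i) <= dot u t - \sum_i cost i (t i) + e.
  apply: (@le_trans _ _ (\sum_(i < n) (u i * t i - cost i (t i) + e / n.+1%:R))).
    by apply: ler_sum => i _; have [] := ht i.
  rewrite big_split /= sumrB lerD2l sumr_const card_ord.
  rewrite -[_ *+ n]mulr_natr -mulrA ler_piMr ?(ltW e0) //.
  by rewrite ler_pdivrMl // mulr1 ler_nat.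
have c0 : 0 <= \sum_i cost i (t i).
  by apply: sumr_ge0 => i _; case: (H i) => h _; apply: h; have [] := ht i.
apply: le_trans s1 _; rewrite lerD2r; move: c0; set S := \sum_i _ => S0.
case: (leP S q) => Sq.
  have : dot u t <= q by apply: hu; split => // i; have [] := ht i.
  lra.
have Sp : 0 < S by lra.
have : dot u (fun i => q / S * t i) <= q.
  have bt : ball dom cost S t by split=> // i; have [] := ht i.
  apply: hu; have := ballZ (k := q / S) H _ _ bt; rewrite divfK ?gt_eqF //; apply.
  - by rewrite divr_ge0 // ltW.
  - by rewrite ler_pdivrMr // mul1r ltW.
have -> : dot u (fun i => q / S * t i) = q / S * dot u t.
  by rewrite /dot mulr_sumr; apply: eq_bigr => i _; rewrite mulrCA.
rewrite mulrAC ler_pdivrMr // ler_pM2l //; lra.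
Qed.

(** A supremum of linear forms attained at every point: on finitely many points, finitely many forms
    represent it. *)
Definition supported n (psi : ('I_n -> R) -> R) : Prop :=
  forall t, exists2 a, dot a t = psi t & forall t', dot a t' <= psi t'.

Section Moments.
Variables (n : nat) (G : finType) (p x c : 'I_n -> G -> R).
Variables (dom : 'I_n -> R -> Prop) (cost : 'I_n -> R -> R).
Hypothesis Hlaw : forall i, law (p i) (x i) (c i).
Hypothesis Hcost : forall i, cost_spec (dom i) (cost i).
Hypothesis Hadapt : forall i, adapted (p i) (x i) (c i) (dom i) (cost i).

Definition EX (F : ('I_n -> R) -> R) : R := E1 (pw p) (fun w => F (fun i => x i (w i))).

Let P0 : forall w, 0 <= pw p w.
Proof. by apply: pw_ge0 => i g; case: (Hlaw i). Qed.
Let P1 : \sum_w pw p w = 1.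
Proof. by apply: sum_pw => i; case: (Hlaw i) => _ []. Qed.

Lemma EX_le F F' : (forall v, F v <= F' v) -> EX F <= EX F'.
Proof. by move=> h; apply: E1_le. Qed.
Lemma EX_cst k : EX (fun=> k) = k. Proof. exact: E1_cst. Qed.
Lemma EXZ k F : EX (fun v => k * F v) = k * EX F. Proof. exact: E1Z. Qed.
Lemma EXD F F' : EX (fun v => F v + F' v) = EX F + EX F'. Proof. exact: E1D. Qed.
Lemma EX_ge0 F : (forall v, 0 <= F v) -> 0 <= EX F.
Proof. by move=> h; rewrite -(EX_cst 0); exact: EX_le. Qed.

(* The Wills-type bound for the multiples [u] of the functionals supporting [psi], with the conjugate
   costs [sup_t (u_i t - cost t)], whose sum is at most [q] since [psi <= s] on the ball. *)
Lemma exp_moment psi q s : supported psi -> 0 < q -> 0 < s ->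
  (forall t, ball dom cost q t -> psi t <= s) -> EX psi <= s ->
  EX (fun v => expR (q / s / 300 * psi v)) <= expR (1001 * q).
Proof.
move=> sp q0 s0 hb he; pose X (w : {ffun 'I_n -> G}) i := x i (w i).
have [a ha] : {a : {ffun 'I_n -> G} -> 'I_n -> R & forall w, dot (a w) (X w) = psi (X w) /\
    forall t', dot (a w) t' <= psi t'}.
  apply: (@choice _ _ (fun w a => dot a (X w) = psi (X w) /\ forall t', dot a t' <= psi t')).
  by move=> w; have [a h1 h2] := sp (X w); exists a.
have [w0 _|none] := pickP (fun _ : {ffun 'I_n -> G} => true); last first.
  by rewrite /EX /E1 big_pred0 ?expR_ge0.
pose u i w := q / s * a w i.
pose l i w := conj_cost (dom i) (cost i) (u i w).
have mx w : maxf w0 (fun v => dot (a v) (X w)) = psi (X w).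
  apply/eqP; rewrite eq_le; apply/andP; split.
    by apply: maxf_le => v; have [] := ha v.
  by have [<- _] := ha w; exact: (le_maxf w0 (fun v => dot (a v) (X w))).
have qs : 0 <= q / s by rewrite divr_ge0 ?ltW.
have dotu w t : dot (u ^~ w) t = q / s * dot (a w) t.
  by rewrite /dot mulr_sumr; apply: eq_bigr => i _; rewrite mulrA.
have suml w : \sum_i l i w <= q.
  apply: sum_conj_cost => // t bt; rewrite dotu.
  apply: (@le_trans _ _ (q / s * s)); last by rewrite divfK ?gt_eqF.
  by rewrite ler_wpM2l //; apply: le_trans (hb _ bt); have [] := ha w.
have := wills w0 (a := u) (l := l) (fun=> 0) Hlaw => W.
have {}W : E1 (pw p) (fun w => expR (maxf w0 (fun v => \sum_i (u i v * x i (w i) / 300 - l i v) + 0)))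
   <= expR (E1 (pw p) (fun w => maxf w0 (fun v => \sum_i 1000 * u i v * x i (w i) + 0))).
  apply: W => [i v h ph|i v]; last exact: conj_cost_qlow.
  by have [dx <-] := Hadapt ph; exact: conj_cost_ge.
have e1 : E1 (pw p) (fun w => expR (q / s / 300 * psi (X w))) <=
   E1 (pw p) (fun w => expR q * expR (maxf w0 (fun v => \sum_i (u i v * x i (w i) / 300 - l i v) + 0))).
  apply: E1_le => // w _; rewrite -expRD ler_expR -mx.
  have [v ->] := maxf_ex w0 (fun v => dot (a v) (X w)).
  have := le_maxf w0 (fun v => \sum_i (u i v * x i (w i) / 300 - l i v) + 0) v.
  rewrite /= addr0 sumrB -mulr_suml -/(dot (u^~ v) (X w)) dotu; have := suml v; lra.
apply: le_trans e1 _; rewrite E1Z.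
have -> : 1001 * q = q + 1000 * q by lra.
rewrite expRD ler_wpM2l ?expR_ge0 //; apply: le_trans W _; rewrite ler_expR.
apply: (@le_trans _ _ (1000 * (q / s) * EX psi)); last first.
  apply: (@le_trans _ _ (1000 * (q / s) * s)); first by apply: ler_wpM2l he; apply: mulr_ge0 qs; exact: ler0n.
  by rewrite -mulrA divfK ?gt_eqF.
rewrite -E1Z; apply: E1_le => // w _; apply: maxf_le => v; rewrite addr0.
under eq_bigr do rewrite -mulrA.
rewrite -mulr_sumr -/(dot (u^~ v) (X w)) dotu -[leRHS]mulrA; apply: ler_wpM2l; first exact: ler0n.
by apply: ler_wpM2l => //; have [] := ha v.
Qed.

Definition CA : R := 2400 * expR 1001.

(** From [e^z >= (z / P)^P] at [z = q psi / (300 s)]. The constant 2400 is [300 * 8], the 8 coming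
    from [P <= 8 q]; and [e^{1001 q} <= e^{1001 P}] since [q <= P]. *)
Lemma moment psi q s P : supported psi -> 1 <= q -> 0 < s -> q <= P%:R -> P%:R <= 8 * q ->
  (forall v, 0 <= psi v) ->
  (forall t, ball dom cost q t -> psi t <= s) -> EX psi <= s ->
  EX (fun v => psi v ^+ P) <= (CA * s) ^+ P.
Proof.
move=> sp q1 s0 qP Pq psi0 hb he.
have q0 : 0 < q by lra.
have Pp : 0 < P%:R :> R by lra.
have M := exp_moment sp q0 s0 hb he.
apply: (@le_trans _ _ (EX (fun v => (2400 * s) ^+ P * expR (q / s / 300 * psi v)))).
  apply: EX_le => v; have y0 := psi0 v.
  pose z := q / s / 300 * psi v.
  have z0 : 0 <= z.
    by apply: mulr_ge0 y0; apply: divr_ge0; [apply: divr_ge0; exact: ltW|exact: ler0n].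
  have -> : expR z = expR (z / P%:R) ^+ P by rewrite -expRM_natr divfK // gt_eqF.
  have k0 : 0 <= 2400 * s by apply: mulr_ge0 (ltW s0); exact: ler0n.
  rewrite -exprMn; apply: lerXn2r; [exact: y0|exact: mulr_ge0 k0 (expR_ge0 _)|].
  have e : z / P%:R <= expR (z / P%:R) by have := expR_ge1Dx (z / P%:R); lra.
  apply: (@le_trans _ _ (2400 * s * (z / P%:R))); last exact: ler_wpM2l k0 _ _ e.
  have -> : 2400 * s * (z / P%:R) = (8 * q / P%:R) * psi v.
    by rewrite /z; field; rewrite (gt_eqF s0) (gt_eqF Pp).
  by rewrite ler_peMl // ler_pdivlMr // mul1r.
rewrite EXZ /CA (mulrAC _ (expR _) s) [leRHS]exprMn; apply: ler_wpM2l.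
  by apply: exprn_ge0; apply: mulr_ge0 (ltW s0); exact: ler0n.
apply: le_trans M _; rewrite -expRM_natr ler_expR; lra.
Qed.
End Moments.
End Cost.

(** * Tilted laws *)

Section Tilt.
Variable R : realType.

(* [d] is the density of a law with mean [t / 6] whose square has mean at most [e^{2 cost t}], and
   which is dominated in the convex order by a shift of [4 x] by a random sign times [4 u]. *)
Definition tiltable (G : finType) (p x : G -> R) (dom : R -> Prop) (cost : R -> R) : Prop :=
  forall t, dom t -> exists (d : G -> R) (u : R),
    (forall g, 0 <= d g) /\ E1 p d = 1 /\ E1 p (fun g => d g * x g) = t / 6 /\
    E1 p (fun g => d g ^+ 2) <= expR (2 * cost t) /\ `|u| <= `|t| /\
    forall F, cvx1 F -> E1 p (fun g => d g * F (x g)) <=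
      E1 p (fun g => (F (t / 6 + 4 * u + 4 * x g) + F (t / 6 - 4 * u + 4 * x g)) / 2).

Definition good (G : finType) (p x c : G -> R) dom cost : Prop :=
  law p x c /\ cost_spec dom cost /\ adapted p x c dom cost /\ tiltable p x dom cost.

Lemma E1_pw_map n (G G' : finType) (p : 'I_n -> G -> R) (p' : 'I_n -> G' -> R) (f : G' -> G) F :
  (forall i F, E1 (p' i) (fun g => F (f g)) = E1 (p i) F) ->
  E1 (pw p') (fun w => F [ffun i => f (w i)]) = E1 (pw p) F.
Proof.
elim: n p p' F => [|n IH] p p' F H.
  by rewrite !E1_pw0; congr F; apply/ffunP => -[].
rewrite !E1_pwS -H; apply: eq_E1 => g.
rewrite -(IH _ _ _ (fun i => H (lift ord0 i))); apply: eq_E1 => w; congr F.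
apply/ffunP => i; rewrite !ffunE; case: unliftP => [j|] _ //=; by rewrite ffunE.
Qed.

Lemma E1_coord n (G : finType) (p : 'I_n -> G -> R) i F : (forall j, \sum_g p j g = 1) ->
  E1 (pw p) (fun w => F (w i)) = E1 (p i) F.
Proof.
move=> p1; pose f j g := if j == i then F g else 1.
transitivity (E1 (pw p) (fun w => \prod_j f j (w j))).
  apply: eq_E1 => w; rewrite (bigD1 i) //= big1 => [|j /negPf ji]; last by rewrite /f ji.
  by rewrite /f eqxx mulr1.
rewrite E1_prod (bigD1 i) //= big1 => [|j /negPf ji]; last first.
  by rewrite /f ji E1_cst.
by rewrite mulr1; apply: eq_E1 => g; rewrite /f eqxx.
Qed.

Section SupBall.
Variables (n : nat) (dom : 'I_n -> R -> Prop) (cost : 'I_n -> R -> R) (q : R).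
Hypothesis Hcost : forall i, cost_spec (dom i) (cost i).
Hypothesis q0 : 0 <= q.

Definition sball (v : 'I_n -> R) : R := sup [set dot v t | t in [set t | ball dom cost q t]]%classic.

Let hs v : has_sup [set dot v t | t in [set t | ball dom cost q t]]%classic.
Proof.
split; first by exists (dot v (fun=> 0)), (fun=> 0) => //; exact: ball0.
have [M HM] : {M : 'I_n -> R & forall i t, dom i t -> `|t| <= M i}.
  apply: (@choice _ _ (fun i M => forall t, dom i t -> `|t| <= M)) => i.
  by case: (Hcost i) => _ [_ [_ [_ [_ [M h]]]]]; exists M.
exists (\sum_i `|v i| * M i) => _ [t [dt _] <-]; apply: ler_sum => i _.
by apply: le_trans (ler_norm _) _; rewrite normrM ler_wpM2l // HM.
Qed.

Lemma sball_ge v t : ball dom cost q t -> dot v t <= sball v.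
Proof. by move=> bt; apply: ub_le_sup; [have [] := hs v|exists t]. Qed.

Lemma sball_le v s : (forall t, ball dom cost q t -> dot v t <= s) -> sball v <= s.
Proof.
move=> h; apply: ge_sup; first by have [] := hs v.
by move=> _ [t bt <-]; exact: h.
Qed.

Lemma sball_ge0 v : 0 <= sball v.
Proof.
apply: le_trans (sball_ge v (ball0 Hcost q0)); rewrite /dot big1 // => i _; exact: mulr0.
Qed.
End SupBall.

Lemma dotZl n k (a t : 'I_n -> R) : dot (fun i => k * a i) t = k * dot a t.
Proof. by rewrite /dot mulr_sumr; apply: eq_bigr => i _; rewrite mulrA. Qed.
Lemma dotDr n (a b t : 'I_n -> R) : dot t (fun i => a i + b i) = dot t a + dot t b.
Proof. by rewrite /dot -big_split; apply: eq_bigr => i _; rewrite mulrDr. Qed.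
Lemma dotZr n k (a t : 'I_n -> R) : dot t (fun i => k * a i) = k * dot t a.
Proof. by rewrite /dot mulr_sumr; apply: eq_bigr => i _; rewrite mulrCA. Qed.

Definition sublin n (f : ('I_n -> R) -> R) : Prop :=
  (forall k x, 0 <= k -> f (fun i => k * x i) <= k * f x) /\
  (forall x y, f (fun i => x i + y i) <= f x + f y).

Lemma sublin_cvx n (f : ('I_n -> R) -> R) : sublin f -> cvx f.
Proof.
move=> [h1 h2] x y t t0 t1; apply: le_trans (h2 _ _) _; apply: lerD; apply: h1; lra.
Qed.

Lemma supported_sublin n (f : ('I_n -> R) -> R) : supported f -> sublin f.
Proof.
move=> sf; split=> [k x k0|x y].
  have [a <- h] := sf (fun i => k * x i); by rewrite dotZr ler_wpM2l.
have [a <- h] := sf (fun i => x i + y i); by rewrite dotDr lerD.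
Qed.

Lemma cvx_sqr n (f : ('I_n -> R) -> R) : cvx f -> (forall x, 0 <= f x) -> cvx (fun x => f x ^+ 2).
Proof.
move=> cf f0 x y t t0 t1; have := cf x y t t0 t1.
set z := f (fun i => _); have z0 : 0 <= z by exact: f0.
move=> h; have h2 : z ^+ 2 <= (t * f x + (1 - t) * f y) ^+ 2.
  by rewrite lerXn2r // nnegrE (le_trans z0).
apply: le_trans h2 _; have := sqr_ge0 (f x - f y).
have : 0 <= t * (1 - t) by rewrite mulr_ge0 // subr_ge0.
move: (f x) (f y) => a b; nra.
Qed.

Section TiltProduct.
Variables (n : nat) (G : finType) (p x c : 'I_n -> G -> R).
Variables (dom : 'I_n -> R -> Prop) (cost : 'I_n -> R -> R).
Hypothesis Hgood : forall i, good (p i) (x i) (c i) (dom i) (cost i).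
Variable q : R.
Hypothesis q1 : 1 <= q.

Let p0 i g : 0 <= p i g. Proof. by case: (Hgood i) => -[]. Qed.
Let p1 i : \sum_g p i g = 1. Proof. by case: (Hgood i) => -[_ []]. Qed.

(** The density is the product of the coordinate densities, so second moments multiply to at most
    [e^{2q}]. For sublinear [f], the convex order replaces [X] by [t / 6] plus 4 times a signed [u]
    plus [4 X]. As [|u i| <= |t i|], the signed [u] stays in the ball, and
    [(5 T + 4 f)^2 <= 50 T^2 + 32 f^2]. *)
Lemma tilt_product t : ball dom cost q t -> exists D : {ffun 'I_n -> G} -> R,
  (forall w, 0 <= D w) /\ E1 (pw p) D = 1 /\ E1 (pw p) (fun w => D w ^+ 2) <= expR (2 * q) /\
  (forall a, E1 (pw p) (fun w => D w * dot a (fun i => x i (w i))) = dot a t / 6) /\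
  forall f T, sublin f -> (forall v, 0 <= f v) -> (forall v, ball dom cost q v -> f v <= T) ->
     E1 (pw p) (fun w => D w * f (fun i => x i (w i)) ^+ 2) <= 50 * T ^+ 2 + 32 * EX p x (fun v => f v ^+ 2).
Proof.
move=> bt; have [dt ct] := bt.
have [d hd] : {d : 'I_n -> (G -> R) * R & forall i, let u := (d i).2 in let d := (d i).1 in
    (forall g, 0 <= d g) /\ E1 (p i) d = 1 /\ E1 (p i) (fun g => d g * x i g) = t i / 6 /\
    E1 (p i) (fun g => d g ^+ 2) <= expR (2 * cost i (t i)) /\ `|u| <= `|t i| /\
    forall F, cvx1 F -> E1 (p i) (fun g => d g * F (x i g)) <=
      E1 (p i) (fun g => (F (t i / 6 + 4 * u + 4 * x i g) + F (t i / 6 - 4 * u + 4 * x i g)) / 2)}.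
  apply: (@choice _ _ (fun i d => let u := d.2 in let d := d.1 in
    (forall g, 0 <= d g) /\ E1 (p i) d = 1 /\ E1 (p i) (fun g => d g * x i g) = t i / 6 /\
    E1 (p i) (fun g => d g ^+ 2) <= expR (2 * cost i (t i)) /\ `|u| <= `|t i| /\
    forall F, cvx1 F -> E1 (p i) (fun g => d g * F (x i g)) <=
      E1 (p i) (fun g => (F (t i / 6 + 4 * u + 4 * x i g) + F (t i / 6 - 4 * u + 4 * x i g)) / 2))).
  move=> i; case: (Hgood i) => _ [_ [_ tl]]; have [d [u h]] := tl _ (dt i).
  by exists (d, u).
pose p' i g := p i g * (d i).1 g.
pose D (w : {ffun 'I_n -> G}) := \prod_i (d i).1 (w i).
have pD w : pw p' w = pw p w * D w by rewrite /pw -big_split.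
have ED F : E1 (pw p) (fun w => D w * F w) = E1 (pw p') F.
  by rewrite /E1; apply: eq_bigr => w _; rewrite pD mulrA.
have p'0 i g : 0 <= p' i g by rewrite mulr_ge0 //; case: (hd i).
have p'1 i : \sum_g p' i g = 1 by have [_ [<- _]] := hd i.
exists D; split; [|split; [|split; [|split]]].
- by move=> w; apply: prodr_ge0 => i _; case: (hd i).
- transitivity (\prod_i E1 (p i) (d i).1); first exact: (E1_prod p (fun i => (d i).1)).
  by rewrite big1 // => i _; have [_ []] := hd i.
- apply: (@le_trans _ _ (\prod_i expR (2 * cost i (t i)))).
    rewrite (eq_E1 _ (F' := fun w : {ffun 'I_n -> G} => \prod_i (d i).1 (w i) ^+ 2)); last first.
      by move=> w; rewrite /D prodrXl.
    rewrite (E1_prod p (fun i g => (d i).1 g ^+ 2)); apply: ler_prod => i _.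
    apply/andP; split; last by have [_ [_ [_ []]]] := hd i.
    by apply: E1_ge0 => // g _; exact: sqr_ge0.
  rewrite -expR_sum ler_expR -mulr_sumr ler_wpM2l //.
- move=> a; rewrite ED /dot.
  have -> : E1 (pw p') (fun w : {ffun 'I_n -> G} => \sum_i a i * x i (w i)) = \sum_i a i * E1 (pw p') (fun w : {ffun 'I_n -> G} => x i (w i)).
    rewrite /E1; under eq_bigr do rewrite mulr_sumr.
    rewrite exchange_big; apply: eq_bigr => i _; rewrite mulr_sumr.
    by apply: eq_bigr => w _; rewrite mulrCA.
  rewrite mulr_suml; apply: eq_bigr => i _; rewrite E1_coord // -mulrA; congr (_ * _).
  have [_ [_ [<- _]]] := hd i; by apply: eq_bigr => g _; rewrite mulrA.
move=> f T [f1 f2] f0 fT; rewrite ED.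
pose u i := (d i).2.
pose x' i (h : G * bool) := (if h.2 then t i / 6 + 4 * u i else t i / 6 - 4 * u i) + 4 * x i h.1.
pose pp i (h : G * bool) := p i h.1 / 2.
have pp0 i h : 0 <= pp i h by rewrite mulr_ge0 // invr_ge0.
have ppE i F : E1 (pp i) F = E1 (p i) (fun g => (F (g, true) + F (g, false)) / 2).
  transitivity (\sum_g \sum_(s : bool) p i g / 2 * F (g, s)).
    by rewrite pair_bigA; apply: eq_bigr => -[].
  by apply: eq_bigr => g _; rewrite big_bool /=; lra.
have cf2 : cvx (fun v => f v ^+ 2) by apply: cvx_sqr => //; exact: sublin_cvx.
have H := @cvx_le_pw R n G _ p' x pp x' (fun v => f v ^+ 2) p'0 pp0 _ cf2.
apply: le_trans (H _) _.
  move=> i F cF; rewrite ppE; have [_ [_ [_ [_ [_ h]]]]] := hd i.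
  apply: le_trans (h F cF); by rewrite /E1 le_eqVlt; apply/orP; left; apply/eqP; apply: eq_bigr => g _; rewrite mulrA.
have T0 : 0 <= T.
  have q0 : 0 <= q := le_trans ler01 q1.
  exact: le_trans (f0 _) (fT _ (ball0 (fun i => (Hgood i).2.1) q0)).
pose Q (w : {ffun 'I_n -> G}) := 50 * T ^+ 2 + 32 * f (fun i => x i (w i)) ^+ 2.
have -> : 50 * T ^+ 2 + 32 * EX p x (fun v => f v ^+ 2) =
   E1 (pw pp) (fun w : {ffun 'I_n -> G * bool} => Q [ffun i => (w i).1]).
  transitivity (E1 (pw p) Q); first by rewrite /Q E1D E1Z E1_cst //; exact: sum_pw.
  symmetry; apply: (@E1_pw_map n _ _ p pp fst Q) => i F.
  by rewrite ppE; apply: eq_E1 => g /=; lra.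
apply: E1_le => [|w _]; first exact: pw_ge0.
rewrite /Q; set v := (fun i => x i _).
have -> : (fun i => x' i (w i)) = (fun i => t i / 6 + (4 * (if (w i).2 then u i else - u i) + 4 * v i)).
  apply/funext => i; rewrite /x' /v ffunE; case: (w i).2; lra.
have b1 : f (fun i => t i / 6) <= T.
  apply: fT; apply: (ball_shrink (fun i => (Hgood i).2.1) bt) => i.
  rewrite normrM (ger0_norm (x := 6^-1)) ?invr_ge0 //; have := normr_ge0 (t i); lra.
have b2 : f (fun i => if (w i).2 then u i else - u i) <= T.
  apply: fT; apply: (ball_shrink (fun i => (Hgood i).2.1) bt) => i.
  by have [_ [_ [_ [_ [h _]]]]] := hd i; case: ifP => _; rewrite ?normrN.
have h : f (fun i => t i / 6 + (4 * (if (w i).2 then u i else - u i) + 4 * v i)) <= 5 * T + 4 * f v.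
  apply: le_trans (f2 _ _) _; have -> : 5 * T = T + 4 * T by lra.
  rewrite -addrA; apply: lerD => //; apply: le_trans (f2 _ _) _; apply: lerD.
    by apply: le_trans (f1 _ _ _) _ => //; rewrite ler_wpM2l.
  by apply: f1.
have fv0 := f0 v.
apply: (@le_trans _ _ ((5 * T + 4 * f v) ^+ 2)).
  by rewrite lerXn2r // nnegrE; [exact: f0|apply: addr_ge0; apply: mulr_ge0].
have := sqr_ge0 (5 * T - 4 * f v); nra.
Qed.
End TiltProduct.
End Tilt.

(** * Finite suprema of bilinear forms *)

Section Bilinear.
Variables (R : realType) (n m : nat) (K : finType) (k0 : K) (b : K -> 'I_n -> 'I_m -> R).
Hypothesis b0 : forall i j, b k0 i j = 0.

Definition bil k (x : 'I_n -> R) (y : 'I_m -> R) : R := \sum_i \sum_j b k i j * x i * y j.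
Definition rowv k (x : 'I_n -> R) : 'I_m -> R := fun j => \sum_i b k i j * x i.
Definition colv k (y : 'I_m -> R) : 'I_n -> R := fun i => \sum_j b k i j * y j.
Definition NN x y : R := maxf k0 (fun k => bil k x y).

Lemma bil_row k x y : bil k x y = dot (rowv k x) y.
Proof.
by rewrite /bil exchange_big; apply: eq_bigr => j _; rewrite mulr_suml.
Qed.

Lemma bil_col k x y : bil k x y = dot (colv k y) x.
Proof.
by apply: eq_bigr => i _; rewrite mulr_suml; apply: eq_bigr => j _; rewrite mulrAC.
Qed.

Lemma NN_ge0 x y : 0 <= NN x y.
Proof.
apply: le_trans (le_maxf k0 _ k0); rewrite /bil big1 // => i _; rewrite big1 // => j _.
by rewrite b0 !mul0r.
Qed.

Lemma NN_ge k x y : bil k x y <= NN x y. Proof. exact: (le_maxf k0 (fun k => bil k x y)). Qed.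

Lemma supported_NNr x : supported (NN x).
Proof.
move=> t; have [k e] := maxf_ex k0 (fun k => bil k x t).
exists (rowv k x) => [|t']; rewrite -bil_row ?NN_ge //; exact/esym.
Qed.

Lemma supported_NNl y : supported (NN ^~ y).
Proof.
move=> t; have [k e] := maxf_ex k0 (fun k => bil k t y).
exists (colv k y) => [|t']; rewrite -bil_col ?NN_ge //; exact/esym.
Qed.
End Bilinear.

(** Lets [moment] be applied to the mean of [NN] over one family as a function of the other. *)
Lemma supported_avg (R : realType) n (W : finType) (P : W -> R) (f : W -> ('I_n -> R) -> R) :
  (forall w, 0 <= P w) -> (forall w, supported (f w)) -> supported (fun t => E1 P (f ^~ t)).
Proof.
move=> P0 sf t.
have [a ha] : {a : W -> 'I_n -> R & forall w, dot (a w) t = f w t /\ forall t', dot (a w) t' <= f w t'}.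
  apply: (@choice _ _ (fun w a => dot a t = f w t /\ forall t', dot a t' <= f w t')).
  by move=> w; have [a h1 h2] := sf w t; exists a.
have e t' : dot (fun i => E1 P (a ^~ i)) t' = E1 P (fun w => dot (a w) t').
  rewrite /dot /E1; under eq_bigr do rewrite mulr_suml.
  rewrite exchange_big; apply: eq_bigr => w _; rewrite mulr_sumr.
  by apply: eq_bigr => i _; rewrite mulrA.
exists (fun i => E1 P (a ^~ i)) => [|t']; rewrite e.
  by apply: eq_E1 => w; have [] := ha w.
by apply: E1_le => // w _; have [] := ha w.
Qed.

Definition CBr (R : realType) (CR : R) : R := 20 * (1 + CA R + CR).
Definition CB (R : realType) (CR : R) : R := 6 * CBr CR * (expR 8 + 3).

Lemma CA_gt0 (R : realType) : 0 < CA R.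
Proof. by apply: mulr_gt0; [rewrite ltr0n|exact: expR_gt0]. Qed.

Lemma CA_ge0 (R : realType) : 0 <= CA R.
Proof. exact: ltW (CA_gt0 R). Qed.

(** * The process indexed by the ball *)

Section Process.
Variables (R : realType) (n m : nat) (K : finType) (k0 : K) (b : K -> 'I_n -> 'I_m -> R).
Hypothesis b0 : forall i j, b k0 i j = 0.
Variables (G H : finType) (p x c : 'I_n -> G -> R) (p' x' c' : 'I_m -> H -> R).
Variables (dom : 'I_n -> R -> Prop) (cost : 'I_n -> R -> R).
Variables (dom' : 'I_m -> R -> Prop) (cost' : 'I_m -> R -> R).
Hypothesis HX : forall i, good (p i) (x i) (c i) (dom i) (cost i).
Hypothesis HY : forall i, good (p' i) (x' i) (c' i) (dom' i) (cost' i).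

Let lX i : law (p i) (x i) (c i) := (HX i).1.
Let lY i : law (p' i) (x' i) (c' i) := (HY i).1.
Let sX i : cost_spec (dom i) (cost i) := (HX i).2.1.
Let sY i : cost_spec (dom' i) (cost' i) := (HY i).2.1.
Let aX i : adapted (p i) (x i) (c i) (dom i) (cost i) := (HX i).2.2.1.
Let aY i : adapted (p' i) (x' i) (c' i) (dom' i) (cost' i) := (HY i).2.2.1.

Let PX0 : forall w, 0 <= pw p w.
Proof. by apply: pw_ge0 => i g; case: (lX i). Qed.
Let PY0 : forall w, 0 <= pw p' w.
Proof. by apply: pw_ge0 => i g; case: (lY i). Qed.
Let PX1 : \sum_w pw p w = 1.
Proof. by apply: sum_pw => i; case: (lX i) => _ []. Qed.
Let PY1 : \sum_w pw p' w = 1.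
Proof. by apply: sum_pw => i; case: (lY i) => _ []. Qed.

Variables (q T CR : R) (r : nat).
Let P := (4 + r)%N.
Hypothesis q1 : 1 <= q.
Hypothesis T0 : 0 < T.
Hypothesis CR0 : 0 <= CR.
Hypothesis rq : q / 2 <= r%:R.
Hypothesis qP : q <= P%:R.
Hypothesis Pq : P%:R <= 8 * q.

Let alpha v := EX p' x' (NN k0 b v).
Let s k v := sball dom' cost' q (rowv b k v).

Hypothesis h1 : EX p x alpha <= T.
Hypothesis h2 : forall v, ball dom cost q v -> alpha v <= T.
Hypothesis h5 : forall k v t, ball dom cost q v -> ball dom' cost' q t -> bil b k v t <= T.
Hypothesis hR : forall k, EX p x (fun v => s k v ^+ 2) <= (CR * T) ^+ 2.

Let q0 : 0 <= q. Proof. exact: le_trans ler01 q1. Qed.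
Let alpha0 v : 0 <= alpha v. Proof. by apply: (EX_ge0 lY) => t; exact: NN_ge0. Qed.
Let s0 k v : 0 <= s k v. Proof. exact: sball_ge0. Qed.

Let salpha : supported alpha.
Proof. by apply: supported_avg => // w; exact: supported_NNl. Qed.

Let alpha2 : EX p x (fun v => alpha v ^+ 2) <= (CA R * T) ^+ 2.
Proof.
apply: (moment lX sX aX (q := 1)) => //; try lra.
by move=> t bt; apply: h2; apply: ballS bt q1.
Qed.

(** Size of the form [b k] at [v]. Dividing by it makes both quantities required by [moment], the
    supremum over the ball and the mean over [Y], at most 1 for every [v]; this is [psiP]. *)
Let Rad k v := T + alpha v + s k v.
Let Rad0 k v : 0 < Rad k v. Proof. by rewrite /Rad -addrA ltr_wpDr // addr_ge0. Qed.
Let psi v t := maxf k0 (fun k => bil b k v t / Rad k v).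

Let slin k : sublin (s k).
Proof.
split=> [u v u0|u v]; apply: sball_le => // t bt; rewrite -bil_row.
  have -> : bil b k (fun i => u * v i) t = u * bil b k v t by rewrite !bil_col dotZr.
  by rewrite ler_wpM2l // bil_row sball_ge.
by rewrite bil_col dotDr -!bil_col !bil_row lerD // sball_ge.
Qed.

Let psi0 v t : 0 <= psi v t.
Proof.
apply: le_trans (le_maxf k0 _ k0); rewrite /bil big1 ?mul0r // => i _; rewrite big1 // => j _.
by rewrite b0 !mul0r.
Qed.

Let psiP v : EX p' x' (fun t => psi v t ^+ P) <= CA R ^+ P.
Proof.
rewrite -[CA R in leRHS]mulr1; apply: (moment lY sY aY (q := q)) => //.
- move=> t; have [k e] := maxf_ex k0 (fun k => bil b k v t / Rad k v).
  have h k' t' : dot (fun j => (Rad k' v)^-1 * rowv b k' v j) t' = bil b k' v t' / Rad k' v.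
    by rewrite dotZl -bil_row mulrC.
  exists (fun j => (Rad k v)^-1 * rowv b k v j) => [|t']; rewrite h; first exact/esym.
  exact: (le_maxf k0 (fun k => bil b k v t' / Rad k v)).
- move=> t bt; apply: maxf_le => k; rewrite ler_pdivrMr // mul1r bil_row.
  apply: le_trans (sball_ge sY q0 _ bt) _; by rewrite -/(s k v) /Rad lerDr addr_ge0 ?alpha0 ?(ltW T0).
- apply: (@le_trans _ _ (EX p' x' (fun t => (T + alpha v)^-1 * NN k0 b v t))).
    apply: (EX_le lY) => t; apply: maxf_le => k; have N0 := NN_ge0 b0 v t.
    have Ta : 0 < T + alpha v by rewrite ltr_wpDr.
    case: (leP 0 (bil b k v t)) => bk; last first.
      apply: (@le_trans _ _ 0); first by rewrite ltW // pmulr_llt0 ?invr_gt0.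
      by rewrite mulr_ge0 // invr_ge0 ltW.
    rewrite mulrC ler_pM ?invr_ge0 ?(ltW (Rad0 _ _)) ?NN_ge //.
    by rewrite lef_pV2 ?posrE // /Rad lerDl.
  rewrite EXZ -/(alpha v) ler_pdivrMl ?mulr1 ?ltr_wpDr // lerDr ltW //.
Qed.

Let Y (w : {ffun 'I_m -> H}) j : R := x' j (w j).
Let X (w : {ffun 'I_n -> G}) i : R := x i (w i).

(** Up to an added 1, [beta] is the [P]-norm of the normalized process over an independent copy of
    [X]. It depends on neither [v] nor [k]; the point [v] enters only through the density [D]. *)
Lemma sup_process : exists beta : {ffun 'I_m -> H} -> R,
  (forall w, 0 <= beta w) /\ E1 (pw p') (fun w => beta w ^+ P) <= CA R ^+ P + 1 /\
  forall v w, ball dom cost q v -> NN k0 b v (Y w) <= CB CR * T * beta w.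
Proof.
pose Gam w := E1 (pw p) (fun th => psi (X th) (Y w) ^+ P) + 1.
have Gam1 w : 1 <= Gam w by rewrite lerDr; apply: E1_ge0 => // th _; exact: exprn_ge0.
pose beta w := Gam w `^ (P%:R^-1).
have betaP w : beta w ^+ P = Gam w.
  rewrite -powR_mulrn ?powR_ge0 // -powRrM mulVf ?powRr1 //; last by rewrite pnatr_eq0.
  by apply: le_trans (Gam1 w).
have beta1 w : 1 <= beta w.
  have : 1 `^ (P%:R^-1) <= beta w.
    by rewrite ge0_ler_powR ?nnegrE ?invr_ge0 // (le_trans _ (Gam1 w)).
  by rewrite powR1.
exists beta; split; [|split].
- by move=> w; apply: le_trans (beta1 w).
- under eq_E1 do rewrite betaP.
  rewrite E1D E1_cst // lerD2r E1_swap -[leRHS](E1_cst PX1); apply: E1_le => // th _.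
  exact: psiP.
move=> v w bv; apply: maxf_le => k.
have [D [D0 [D1 [D2 [Dm DS]]]]] := tilt_product HX q1 bv.
have CB0 := CA_ge0 R.
have C0 : 0 < CBr CR by rewrite /CBr mulr_gt0 // -addrA ltr_wpDr // addr_ge0.
pose rr := CBr CR * T.
have rr0 : 0 < rr by rewrite mulr_gt0.
(* [(T + alpha + s)^2 <= 3 (T^2 + alpha^2 + s^2)] and the tilting bound give the factor
   [303 + 96 CA^2 + 96 CR^2], below [20^2 (1 + CA + CR)^2]: hence the 20 in [CBr]. *)
have ER : E1 (pw p) (fun th => D th * Rad k (X th) ^+ 2) <= rr ^+ 2.
  have e1 := DS alpha T (supported_sublin salpha) alpha0 h2.
  have {}e2 : E1 (pw p) (fun th => D th * s k (X th) ^+ 2) <= 50 * T ^+ 2 + 32 * EX p x (fun v => s k v ^+ 2).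
    by apply: DS => // t bt; apply: sball_le => // y by'; rewrite -bil_row; exact: h5.
  apply: (@le_trans _ _ (E1 (pw p) (fun th => 3 * T ^+ 2 * D th +
      (3 * (D th * alpha (X th) ^+ 2) + 3 * (D th * s k (X th) ^+ 2))))).
    apply: E1_le => // th _; have Dp := D0 th.
    have -> : 3 * T ^+ 2 * D th + (3 * (D th * alpha (X th) ^+ 2) + 3 * (D th * s k (X th) ^+ 2)) =
       D th * (3 * (T ^+ 2 + alpha (X th) ^+ 2 + s k (X th) ^+ 2)) by ring.
    rewrite ler_wpM2l // /Rad; move: (alpha _) (s k _) => a a'.
    have := sqr_ge0 (T - a); have := sqr_ge0 (T - a'); have := sqr_ge0 (a - a'); nra.
  rewrite E1D E1D !E1Z D1 /rr /CBr; have a2 := alpha2; have s2 := hR k.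
  have TT : 0 < T ^+ 2 by rewrite exprn_gt0.
  move: e1 e2 a2 s2; rewrite -/(EX p x (fun v => alpha v ^+ 2)).
  move: (E1 _ _) (E1 _ _) (EX p x _) (EX p x _) => e1 e2 a2 s2.
  move: (CA R) CB0 => A A0; rewrite !exprMn; move: (T ^+ 2) TT => TT TT0 g1 g2 g3 g4.
  have : 303 + 96 * A ^+ 2 + 96 * CR ^+ 2 <= 20 ^+ 2 * (1 + A + CR) ^+ 2.
    have := CR0; have := mulr_ge0 A0 CR0; nra.
  move=> u; have : (303 + 96 * A ^+ 2 + 96 * CR ^+ 2) * TT <= 20 ^+ 2 * (1 + A + CR) ^+ 2 * TT.
    by rewrite ler_wpM2r // ltW.
  lra.
have bp : 0 < beta w by apply: lt_le_trans (beta1 w).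
(* With [u = Rad / rr] and [g = psi / beta], first [u g <= u^2 + g^2]. Where [g > e^4], the density
   is split off by [D g^2 <= e^{-2q} D^2 + e^{2q} g^4], and [e^{2q} <= g^r] because [r >= q / 2].
   The four resulting means give [1 + e^8 + 1 + 1], the last factor of [CB]. *)
have key th : D th * (Rad k (X th) * psi (X th) (Y w)) <= rr * beta w *
   (D th * Rad k (X th) ^+ 2 / rr ^+ 2 + (expR 8 * D th + (expR (- (2 * q)) * D th ^+ 2 + psi (X th) (Y w) ^+ P / beta w ^+ P))).
  have Dp := D0 th; have Gp := psi0 (X th) (Y w); have Rp := ltW (Rad0 k (X th)).
  pose g := psi (X th) (Y w) / beta w; pose u := Rad k (X th) / rr.
  have g0 : 0 <= g by rewrite divr_ge0 // ltW.
  have -> : Rad k (X th) * psi (X th) (Y w) = rr * beta w * (u * g).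
    by rewrite /u /g; field; rewrite !gt_eqF.
  rewrite mulrCA; apply: ler_wpM2l; first by rewrite mulr_ge0 ?ltW.
  have -> : D th * Rad k (X th) ^+ 2 / rr ^+ 2 = D th * u ^+ 2.
    by rewrite /u; field; rewrite gt_eqF.
  rewrite -expr_div_n -/g.
  have e1 : D th * (u * g) <= D th * u ^+ 2 + D th * g ^+ 2.
    rewrite -mulrDr ler_wpM2l //; have := sqr_ge0 (u - g); nra.
  apply: le_trans e1 _; rewrite lerD2l.
  have gP : 0 <= g ^+ P by exact: exprn_ge0.
  have Dq : 0 <= expR (- (2 * q)) * D th ^+ 2 by rewrite mulr_ge0 ?sqr_ge0 ?expR_ge0.
  case: (leP g (expR 4)) => g4.
    have : g ^+ 2 <= expR 8.
      have -> : (8 : R) = 4 * 2%:R by lra.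
      by rewrite expRM_natr lerXn2r // nnegrE expR_ge0.
    move=> g2; have : D th * g ^+ 2 <= D th * expR 8 by rewrite ler_wpM2l.
    lra.
  have e8 : 0 <= expR 8 * D th by rewrite mulr_ge0 ?expR_ge0.
  have e2 : expR (2 * q) * g ^+ 4 <= g ^+ P.
    rewrite /P exprD mulrC ler_wpM2l ?exprn_ge0 //.
    apply: (@le_trans _ _ (expR 4 ^+ r)).
      by rewrite -expRM_natr ler_expR; have := rq; lra.
    by rewrite lerXn2r ?nnegrE ?expR_ge0 // ltW.
  have e3 : D th * g ^+ 2 <= expR (- (2 * q)) * D th ^+ 2 + expR (2 * q) * g ^+ 4.
    have ee := expRxMexpNx_1 (2 * q); have p1 := expR_gt0 (2 * q); have p2 := expR_gt0 (- (2 * q)).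
    set A := expR (2 * q) in ee p1 *; set B := expR (- (2 * q)) in ee p2 *.
    have := sqr_ge0 (B * D th - g ^+ 2) => sq.
    have : 0 <= A * (B * D th - g ^+ 2) ^+ 2 by rewrite mulr_ge0 // ltW.
    have -> : A * (B * D th - g ^+ 2) ^+ 2 = (A * B) * B * D th ^+ 2 - 2 * (A * B) * D th * g ^+ 2 + A * g ^+ 4 by ring.
    rewrite ee; have : 0 <= D th * g ^+ 2 by rewrite mulr_ge0 ?sqr_ge0.
    lra.
  lra.
have e6 : bil b k v (Y w) = 6 * E1 (pw p) (fun th => D th * bil b k (X th) (Y w)).
  under eq_E1 do rewrite bil_col.
  rewrite Dm bil_col; lra.
rewrite e6; have -> : CB CR * T * beta w = 6 * (rr * beta w * (expR 8 + 3)) by rewrite /CB /rr; ring.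
rewrite ler_wpM2l //; apply: (@le_trans _ _ (E1 (pw p) (fun th => rr * beta w *
   (D th * Rad k (X th) ^+ 2 / rr ^+ 2 + (expR 8 * D th + (expR (- (2 * q)) * D th ^+ 2 + psi (X th) (Y w) ^+ P / beta w ^+ P)))))).
  apply: E1_le => // th _; apply: le_trans (key th); rewrite ler_wpM2l //.
  rewrite -ler_pdivrMl // mulrC; exact: (le_maxf k0 (fun k => bil b k (X th) (Y w) / Rad k (X th))).
have rb0 : 0 <= rr * beta w := mulr_ge0 (ltW rr0) (ltW bp).
rewrite E1Z; apply: (ler_wpM2l rb0); rewrite !E1D !E1Z D1 mulr1.
have f1 : E1 (pw p) (fun th => D th * Rad k (X th) ^+ 2 / rr ^+ 2) <= 1.
  under eq_E1 do rewrite mulrC.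
  by rewrite E1Z ler_pdivrMl ?exprn_gt0 // mulr1.
have f2 : expR (- (2 * q)) * E1 (pw p) (fun th => D th ^+ 2) <= 1.
  by rewrite expRN ler_pdivrMl ?expR_gt0 // mulr1.
have f3 : E1 (pw p) (fun th => psi (X th) (Y w) ^+ P / beta w ^+ P) <= 1.
  under eq_E1 do rewrite mulrC.
  rewrite E1Z betaP ler_pdivrMl ?mulr1 ?(lt_le_trans ltr01) //.
  by rewrite /Gam lerDl.
lra.
Qed.
End Process.

(** * Second and eighth moments of linear forms *)

Section SecondMoments.
Variable R : realType.

Lemma CauchySchwarz_sum (I : finType) (u v : I -> R) :
  (\sum_i u i * v i) ^+ 2 <= (\sum_i u i ^+ 2) * (\sum_i v i ^+ 2).
Proof.
set P := \sum_i _; set U := \sum_i _; set S := \sum_i _.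
have S0 : 0 <= S by apply: sumr_ge0 => i _; exact: sqr_ge0.
have [Sz|Sn0] := eqVneq S 0.
  suff -> : P = 0 by rewrite expr0n /= Sz mulr0.
  apply: big1 => i _; have : v i ^+ 2 = 0.
    by apply/eqP; move/eqP: Sz; rewrite psumr_eq0 => [/allP/(_ i)|j _]; [apply; rewrite mem_index_enum|exact: sqr_ge0].
  by move/eqP; rewrite sqrf_eq0 => /eqP ->; rewrite mulr0.
have Sp : 0 < S by rewrite lt_neqAle eq_sym Sn0.
have : 0 <= \sum_i (u i * S - v i * P) ^+ 2 by apply: sumr_ge0 => i _; exact: sqr_ge0.
have -> : \sum_i (u i * S - v i * P) ^+ 2 = S ^+ 2 * U - 2 * S * P * P + P ^+ 2 * S.
  have e i : (u i * S - v i * P) ^+ 2 = S ^+ 2 * u i ^+ 2 - 2 * S * P * (u i * v i) + P ^+ 2 * v i ^+ 2.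
    by ring.
  by rewrite (eq_bigr _ (fun i _ => e i)) big_split sumrB -!mulr_sumr.
have -> : S ^+ 2 * U - 2 * S * P * P + P ^+ 2 * S = S * (U * S - P ^+ 2) by ring.
by rewrite pmulr_rge0 // subr_ge0.
Qed.

(** With [y = f / s], pointwise [y^2 <= 4 A^2 + 8 exp (q (y - A))]: beyond [2 A] one has
    [q (y - A) >= y / 2] and [exp (y / 2) >= 1 + y^2 / 8]. *)
Lemma exp_second_moment (W : finType) (p : W -> R) (f : W -> R) (q s A : R) :
  (forall w, 0 <= p w) -> \sum_w p w = 1 -> 1 <= q -> 0 < s -> 0 <= A -> (forall w, 0 <= f w) ->
  E1 p (fun w => expR (q / s * f w)) <= expR (A * q) ->
  E1 p (fun w => f w ^+ 2) <= s ^+ 2 * (4 * A ^+ 2 + 8).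
Proof.
move=> p0 p1 q1 s0 A0 f0 h.
apply: (@le_trans _ _ (E1 p (fun w => s ^+ 2 * (4 * A ^+ 2) + s ^+ 2 * 8 * expR (- (A * q)) * expR (q / s * f w)))).
  apply: E1_le => // w _; pose y := f w / s.
  have y0 : 0 <= y by rewrite divr_ge0 // ltW.
  have -> : f w = s * y by rewrite /y mulrC divfK // gt_eqF.
  rewrite -mulrA -expRD exprMn -[_ * 8 * _]mulrA -mulrDr ler_wpM2l ?sqr_ge0 //.
  have -> : - (A * q) + q / s * (s * y) = q * (y - A) by field; rewrite gt_eqF.
  have e0 := expR_ge0 (q * (y - A)).
  case: (leP y (2 * A)) => yA; first by nra.
  have e1 : 1 + (y / 2) ^+ 2 / 2 <= expR (y / 2) by apply: (@expR_ge1Dxn R (y / 2) 1); lra.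
  have e2 : expR (y / 2) <= expR (q * (y - A)) by rewrite ler_expR; nra.
  nra.
have -> : s ^+ 2 * (4 * A ^+ 2 + 8) = s ^+ 2 * (4 * A ^+ 2) + s ^+ 2 * 8 by ring.
rewrite E1D E1_cst // E1Z lerD2l -[leLHS]mulrA ler_piMr ?mulr_ge0 ?sqr_ge0 ?(ltW s0) //.
by rewrite expRN ler_pdivrMl ?expR_gt0 // mulr1.
Qed.

Lemma supported_abs n (a : 'I_n -> R) : supported (fun t => `|dot a t|).
Proof.
move=> t; have N t' : dot (fun i => - a i) t' = - dot a t'.
  by rewrite /dot -sumrN; apply: eq_bigr => i _; rewrite mulNr.
case: (leP 0 (dot a t)) => h.
  by exists a => [|t']; [rewrite ger0_norm|exact: ler_norm].
by exists (fun i => - a i) => [|t']; rewrite N; [rewrite ltr0_norm|rewrite -normrN ler_norm].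
Qed.

Section Linear.
Variables (n : nat) (G : finType) (p x c : 'I_n -> G -> R).
Variables (dom : 'I_n -> R -> Prop) (cost : 'I_n -> R -> R).
Hypothesis lX : forall i, law (p i) (x i) (c i).
Hypothesis sX : forall i, cost_spec (dom i) (cost i).
Hypothesis aX : forall i, adapted (p i) (x i) (c i) (dom i) (cost i).

Let p0 i g : 0 <= p i g. Proof. by case: (lX i). Qed.
Let p1 i : \sum_g p i g = 1. Proof. by case: (lX i) => _ []. Qed.
Let PX0 : forall w, 0 <= pw p w. Proof. exact: pw_ge0. Qed.
Let PX1 : \sum_w pw p w = 1. Proof. exact: sum_pw. Qed.

(** Independent centered coordinates are uncorrelated; [240 = 30 * 8] combines [law_sqr_exp] with
    [law_expc]. *)
Lemma EX_dot_sqr a : EX p x (fun v => dot a v ^+ 2) <= 240 * \sum_i a i ^+ 2.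
Proof.
have E0 i : E1 (p i) (x i) = 0.
  case: (lX i) => _ [_ [sym _]]; have := sym id; rewrite /= => e.
  have e' : E1 (p i) (x i) = E1 (p i) (fun g => - x i g) := e.
  have : E1 (p i) (fun g => - x i g) = - E1 (p i) (x i).
    by rewrite /E1 -sumrN; apply: eq_bigr => h _; rewrite mulrN.
  rewrite -e'; lra.
have E2 i : E1 (p i) (fun g => x i g ^+ 2) <= 240.
  apply: (@le_trans _ _ (E1 (p i) (fun g => 30 * expR (c i g / 2)))).
    apply: E1_le => // g pg; apply: le_trans (law_sqr_exp (lX i) pg).
    by rewrite ler_peMr ?sqr_ge0 // -expR0 ler_expR divr_ge0.
  by rewrite E1Z; have := law_expc (lX i); lra.
have Eij i j : j != i -> E1 (pw p) (fun w => x i (w i) * x j (w j)) = 0.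
  move=> ji; pose f k g := (if k == i then x i g else 1) * (if k == j then x j g else 1).
  transitivity (E1 (pw p) (fun w : {ffun 'I_n -> G} => \prod_k f k (w k))).
    apply: eq_E1 => w; rewrite (bigD1 i) //= (bigD1 j) //= big1 => [|k /andP[ki kj]].
      by rewrite /f !eqxx (negPf ji) eq_sym (negPf ji) mul1r !mulr1.
    by rewrite /f (negPf ki) (negPf kj) mulr1.
  rewrite (E1_prod p f) (bigD1 i) //= (_ : E1 _ _ = 0) ?mul0r // -(E0 i).
  by apply: eq_E1 => g; rewrite /f eqxx eq_sym (negPf ji) mulr1.
have -> : EX p x (fun v => dot a v ^+ 2) = \sum_i \sum_j a i * a j * E1 (pw p) (fun w => x i (w i) * x j (w j)).
  rewrite /EX /E1; under [RHS]eq_bigr do under eq_bigr do rewrite mulr_sumr.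
  under [RHS]eq_bigr do rewrite exchange_big /=.
  rewrite [RHS]exchange_big; apply: eq_bigr => w _ /=; rewrite expr2 /dot mulr_suml mulr_sumr.
  apply: eq_bigr => i _; rewrite !mulr_sumr; apply: eq_bigr => j _; ring.
rewrite mulr_sumr; apply: ler_sum => i _.
rewrite (bigD1 i) //= big1 => [|j ji]; last by rewrite Eij // mulr0.
rewrite addr0 -expr2 mulrC; under eq_E1 do rewrite -expr2.
by rewrite (@E1_coord _ _ _ p i (fun g => x i g ^+ 2)) // ler_wpM2r // sqr_ge0.
Qed.

(** The ball of radius 1 is inside the Euclidean unit ball: a coordinate beyond 1 would cost more
    than 1, so every cost is a square. *)
Lemma dot_ball1 a t : ball dom cost 1 t -> dot a t ^+ 2 <= \sum_i a i ^+ 2.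
Proof.
move=> [dt ct]; have c0 i : 0 <= cost i (t i) by case: (sX i) => h _; exact: h.
apply: le_trans (CauchySchwarz_sum _ _) _; apply: ler_piMr.
  by apply: sumr_ge0 => i _; exact: sqr_ge0.
apply: (le_trans _ ct); apply: ler_sum => i _.
have [_ [h1 [h2 _]]] := sX i; case: (leP `|t i| 1) => ti; first by have [_ ->] := h1 _ ti.
have := h2 _ (dt i) ti; have : cost i (t i) <= 1.
  by apply: (le_trans _ ct); rewrite (bigD1 i) //= lerDl sumr_ge0.
lra.
Qed.

(** The exponent 8 serves [Q] below, a sum of fourth powers whose second moment is required. The
    first moment comes from [|d| <= 8 s + d^2 / (32 s)], and [8 + 240 / 32 <= 16]. *)
Lemma EX_dot_8 a s : 0 <= s -> \sum_i a i ^+ 2 <= s ^+ 2 ->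
  EX p x (fun v => dot a v ^+ 8) <= (16 * CA R * s) ^+ 8.
Proof.
rewrite le_eqVlt => /orP[/eqP<-|s0] hs.
  have a0 i : a i = 0.
    apply/eqP; rewrite -sqrf_eq0; move: hs; rewrite expr0n /= => hs.
    rewrite eq_le sqr_ge0 andbT; apply: le_trans hs; rewrite (bigD1 i) //= lerDl sumr_ge0 // => *; exact: sqr_ge0.
  rewrite (_ : EX _ _ _ = 0) ?exprn_even_ge0 //; apply: big1 => w _.
  by rewrite /dot big1 => [|i _]; rewrite ?expr0n ?mulr0 // a0 mul0r.
have e2 := EX_dot_sqr a.
have e1 : EX p x (fun v => `|dot a v|) <= 16 * s.
  apply: (@le_trans _ _ (EX p x (fun v => 8 * s + (32 * s)^-1 * dot a v ^+ 2))).
    apply: (EX_le lX) => v; rewrite -(real_normK (num_real (dot a v))).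
    rewrite -lerBlDl ler_pdivlMl ?mulr_gt0 //; move: (`|dot a v|) => d.
    have := sqr_ge0 (d - 16 * s); nra.
  rewrite EXD (EX_cst lX) EXZ.
  have : (32 * s)^-1 * EX p x (fun v => dot a v ^+ 2) <= 8 * s.
    by rewrite ler_pdivrMl ?mulr_gt0 //; nra.
  lra.
have := moment lX sX aX (q := 1) (P := 8) (supported_abs a) (lexx _) (s := 16 * s).
rewrite [CA R * (16 * s)]mulrCA mulrA => M.
have ev v : dot a v ^+ 8 = `|dot a v| ^+ 8.
  by rewrite (exprM _ 2 4) (exprM `|_| 2 4) real_normK ?num_real.
apply: (@le_trans _ _ (EX p x (fun v => `|dot a v| ^+ 8))).
  by apply: (EX_le lX) => v; rewrite ev.
apply: M => //; rewrite ?mulr_gt0 // ?mulr1 // ?ler1n // => t bt.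
have := dot_ball1 a bt => h; apply: (@le_trans _ _ s); last by lra.
rewrite -(ler_pXn2r (n := 2)) ?nnegrE ?normr_ge0 ?(ltW s0) // real_normK ?num_real //.
exact: le_trans h hs.
Qed.
End Linear.
End SecondMoments.

#[local] Opaque CA.

(** * Dual norm of the random vector of column forms *)

Section RandomColumns.
Variable R : realType.

(** The largest radius at cost at most [k] need not be attained; a radius above half of it serves as
    net point, at the price of the factor 2. *)
Lemma cost_radius dom cost (k : R) : cost_spec dom cost -> 0 <= k -> exists eta,
  0 <= eta /\ dom eta /\ cost eta <= k /\ forall t, dom t -> cost t <= k -> `|t| <= 2 * eta.
Proof.
move=> H k0; have [_ [h0 [_ [_ [ev [M hM]]]]]] := H.
have [d0 c0] : dom 0 /\ cost 0 = 0 ^+ 2 by apply: h0; rewrite normr0.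
pose S := [set `|t| | t in [set t | dom t /\ cost t <= k]]%classic.
have hs : has_sup S.
  split; first by exists `|0 : R|, 0 => //; split=> //; rewrite c0 expr0n.
  by exists M => _ [t [dt _] <-]; exact: hM.
have ub t : dom t -> cost t <= k -> `|t| <= sup S.
  by move=> dt ct; apply: ub_le_sup; [case: hs|exists t].
case: (leP (sup S) 0) => s0.
  exists 0; split=> //; split=> //; split=> [|t dt ct]; first by rewrite c0 expr0n.
  by rewrite mulr0; apply: le_trans (ub _ dt ct) s0.
have [|_ [t [dt ct] <-] ht] := sup_adherent (eps := sup S / 2) _ hs; first by rewrite divr_gt0.
exists `|t|; split=> //.
have [dt' ct'] : dom `|t| /\ cost `|t| <= k.
  case: (leP 0 t) => tt; [by rewrite ger0_norm|rewrite ltr0_norm //].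
  by have [? ->] := ev _ dt.
split=> //; split=> // u du cu; have := ub _ du cu; lra.
Qed.

Lemma sum_half_pow M : \sum_(i < M) (1 / 2 : R) ^+ i.+1 <= 1.
Proof.
suff -> : \sum_(i < M) (1 / 2 : R) ^+ i.+1 = 1 - (1 / 2) ^+ M by rewrite gerBl exprn_ge0 // divr_ge0.
elim: M => [|M IH]; first by rewrite big_ord0 expr0 subrr.
rewrite big_ord_recr /= IH exprS; lra.
Qed.

Lemma expRN_le_half (k : nat) : expR (- k%:R) <= (1 / 2 : R) ^+ k.
Proof.
rewrite -mulN1r expRM_natr lerXn2r ?nnegrE ?expR_ge0 ?divr_ge0 //.
have := expR_ge1Dx (1 : R); have := expRxMexpNx_1 (1 : R); have := expR_gt0 (- 1 : R); nra.
Qed.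

(* The Boolean is a sign, pinned to [true] where the integer cost vanishes, so that exactly the sign
   patterns of the nonzero entries are counted. *)
Lemma net_count m M (q : R) (z : 'I_m -> R) (N : pred {ffun 'I_m -> 'I_M.+1 * bool}) :
  (forall j, 0 <= z j) -> \sum_j z j <= q ->
  (forall k, N k -> \sum_j ((k j).1 : nat)%:R <= 2 * q) ->
  (forall k j, N k -> (if (k j).1 == ord0 then (k j).2 else 1 <= z j * expR ((k j).1 : nat)%:R)) ->
  \sum_(k | N k) 1 <= expR (6 * q).
Proof.
move=> z0 zq N1 N2.
(* On [N] the weight [e^{4q}] times the product of [e^{-2 k_j}] is at least 1, and the sum of the
   products over all patterns factorizes. The condition [1 <= z_j e^k] turns one [e^{-k}] into
   [z_j], so a factor is at most [1 + 2 z_j], counting both signs. *)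
pose om j (h : 'I_M.+1 * bool) : R :=
  if (if h.1 == ord0 then h.2 else 1 <= z j * expR (h.1 : nat)%:R) then expR (- (2 * (h.1 : nat)%:R)) else 0.
have om0 j h : 0 <= om j h by rewrite /om; case: ifP => // _; exact: expR_ge0.
apply: (@le_trans _ _ (\sum_(k : {ffun 'I_m -> 'I_M.+1 * bool}) expR (4 * q) * \prod_j om j (k j))).
  rewrite [leRHS](bigID N) /= -[leLHS]addr0; apply: lerD; last first.
    by apply: sumr_ge0 => k _; rewrite mulr_ge0 ?expR_ge0 // prodr_ge0.
  apply: ler_sum => k Nk.
  have -> : \prod_j om j (k j) = \prod_j expR (- (2 * ((k j).1 : nat)%:R)).
    by apply: eq_bigr => j _; rewrite /om N2.
  rewrite -expR_sum -expRD -[leLHS]expR0 ler_expR sumrN -mulr_sumr.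
  by have := N1 _ Nk; lra.
rewrite -mulr_sumr -(bigA_distr_bigA om) /=.
have -> : 6 * q = 4 * q + 2 * q by lra.
rewrite expRD ler_wpM2l ?expR_ge0 //.
apply: (@le_trans _ _ (\prod_j expR (2 * z j))); last first.
  by rewrite -expR_sum ler_expR -mulr_sumr ler_wpM2l.
apply: ler_prod => j _; rewrite sumr_ge0 //=.
apply: (@le_trans _ _ (1 + 2 * z j)); last exact: expR_ge1Dx.
have -> : \sum_h om j h = \sum_(k < M.+1) \sum_(s : bool) om j (k, s).
  by rewrite pair_bigA; apply: eq_bigr => -[].
rewrite big_ord_recl big_bool /= {1 2}/om /= mulr0 oppr0 expR0 addr0 lerD2l.
apply: (@le_trans _ _ (\sum_(i < M) 2 * z j * (1 / 2) ^+ i.+1)); last first.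
  by rewrite -mulr_sumr ler_piMr ?sum_half_pow // mulr_ge0.
apply: ler_sum => i _; rewrite big_bool /om /=.
case: ifP => h; last by rewrite addr0 mulr_ge0 ?mulr_ge0 // exprn_ge0 // divr_ge0.
have e1 : expR (- (2 * (lift ord0 i : nat)%:R)) <= z j * expR (- i.+1%:R).
  have -> : - (2 * (lift ord0 i : nat)%:R) = - i.+1%:R - i.+1%:R :> R by rewrite /= /bump /= add1n; lra.
  rewrite expRD; apply: ler_wpM2r; first exact: expR_ge0.
  by rewrite expRN -[leLHS]mul1r ler_pdivrMr ?expR_gt0.
have := expRN_le_half i.+1; have := z0 j; move: e1; nra.
Qed.

(** The bound of [exp_second_moment] with [s = 300 T] and [A = 1007 = 1001 + 6]: the exponent of a
    single linear form plus the logarithmic size of the net, both per unit of [q]. *)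
Definition Cnet : R := 300 ^+ 2 * (4 * 1007 ^+ 2 + 8).
Definition Ccol : R := 4 * (241 * 4 + 16 * (16 * CA R) ^+ 8 + 16 * Cnet).

Variables (n m : nat) (G : finType) (p x c : 'I_n -> G -> R).
Variables (dom : 'I_n -> R -> Prop) (cost : 'I_n -> R -> R).
Variables (dom' : 'I_m -> R -> Prop) (cost' : 'I_m -> R -> R).
Hypothesis lX : forall i, law (p i) (x i) (c i).
Hypothesis sX : forall i, cost_spec (dom i) (cost i).
Hypothesis aX : forall i, adapted (p i) (x i) (c i) (dom i) (cost i).
Hypothesis sY : forall i, cost_spec (dom' i) (cost' i).

Variables (B : 'I_n -> 'I_m -> R) (q T : R).
Let W (v : 'I_n -> R) j := \sum_i B i j * v i.
Let C j := \sum_i B i j ^+ 2.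
Let A := \sum_j C j.
Hypothesis q1 : 1 <= q.
Hypothesis T0 : 0 < T.
Hypothesis h3 : forall t, ball dom' cost' q t -> EX p x (fun v => Num.max 0 (dot (W v) t)) <= T.
Hypothesis h5 : forall v t, ball dom cost q v -> ball dom' cost' q t -> dot (W v) t <= T.
Hypothesis hHS : q * A <= 4 * T ^+ 2.

Let q0 : 0 < q. Proof. exact: lt_le_trans ltr01 q1. Qed.
Let C0 j : 0 <= C j. Proof. by apply: sumr_ge0 => i _; exact: sqr_ge0. Qed.
Let A0 : 0 <= A. Proof. exact: sumr_ge0. Qed.
(** Threshold balancing the pieces: [q * a] is the square root of [q * A], at most [2 T] by [hHS],
    and for nonzero [a] the ratios [C j / a^2] sum to [q], as the counting of the net requires. *)
Let a := Num.sqrt (A / q).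
Let a0 : 0 <= a. Proof. exact: sqrtr_ge0. Qed.
Let a2 : a ^+ 2 = A / q. Proof. by rewrite sqr_sqrtr // divr_ge0 // ltW. Qed.
Let cc j := Num.sqrt (C j).
Let cc2 j : cc j ^+ 2 = C j. Proof. by rewrite sqr_sqrtr. Qed.
Let cc0 j : 0 <= cc j. Proof. exact: sqrtr_ge0. Qed.

Let p0 i g : 0 <= p i g. Proof. by case: (lX i). Qed.
Let p1 i : \sum_g p i g = 1. Proof. by case: (lX i) => _ []. Qed.
Let PX0 : forall w, 0 <= pw p w. Proof. exact: pw_ge0. Qed.
Let PX1 : \sum_w pw p w = 1. Proof. exact: sum_pw. Qed.

Let Wdot v j : W v j = dot (B ^~ j) v. Proof. by []. Qed.

Let Q v := \sum_(j | C j <= a ^+ 2) 2 * W v j ^+ 4 / (cc j * a ^+ 2).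

(** Cauchy-Schwarz with weights [cc j / a], whose squares sum to [q]. The remaining factor at [j]
    has second moment at most [4 D C j], because [E (W j)^8 <= D (C j)^4] and [C j <= a^2]. *)
Let EQ : EX p x (fun v => Q v ^+ 2) <= 4 * (16 * CA R) ^+ 8 * (q * A).
Proof.
have [D eD] : exists D, D = (16 * CA R) ^+ 8 by exists ((16 * CA R) ^+ 8).
have D0 : 0 <= D by rewrite eD; apply: exprn_ge0; apply: mulr_ge0; [exact: ler0n|exact: CA_ge0].
rewrite -eD.
have [az|an0] := eqVneq a 0.
  rewrite (_ : EX _ _ _ = 0).
    by apply: mulr_ge0; [exact: mulr_ge0|apply: mulr_ge0; [exact: ltW|exact: A0]].
  apply: big1 => w _; rewrite /Q big1 ?expr0n ?mulr0 // => j _.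
  by rewrite az expr0n mulr0 invr0 mulr0.
have ap : 0 < a by rewrite lt_neqAle eq_sym an0.
pose u v j := (if C j <= a ^+ 2 then 2 * W v j ^+ 4 / (cc j * C j) else 0) * (cc j / a).
have sl : \sum_j (cc j / a) ^+ 2 = q.
  have -> : \sum_j (cc j / a) ^+ 2 = A / a ^+ 2.
    by rewrite /A mulr_suml; apply: eq_bigr => j _; rewrite expr_div_n cc2.
  rewrite a2 invf_div mulrC divfK // gt_eqF //; move: ap; rewrite /a sqrtr_gt0.
  by rewrite pmulr_lgt0 // invr_gt0.
have QE v : Q v = \sum_j cc j / a * u v j.
  rewrite /Q big_mkcond; apply: eq_bigr => j _; rewrite /u; case: ifP => _; last by rewrite mul0r mulr0.
  have [cz|cn] := eqVneq (cc j) 0; first by rewrite cz !mul0r invr0 !mulr0.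
  by rewrite -cc2; field; rewrite an0 cn.
apply: (@le_trans _ _ (EX p x (fun v => q * \sum_j u v j ^+ 2))).
  by apply: (EX_le lX) => v; rewrite QE -[X in _ <= X * _]sl; exact: CauchySchwarz_sum.
rewrite EXZ mulrCA ler_wpM2l ?(ltW q0) //.
have -> : EX p x (fun v => \sum_j u v j ^+ 2) = \sum_j EX p x (fun v => u v j ^+ 2).
  by rewrite /EX /E1 exchange_big; apply: eq_bigr => w _; rewrite mulr_sumr.
have -> : 4 * D * A = \sum_j 4 * D * C j by rewrite mulr_sumr.
apply: ler_sum => j _.
rewrite /u; case: (leP (C j) (a ^+ 2)) => Ca; last first.
  rewrite (_ : EX _ _ _ = 0) ?mulr_ge0 //; apply: big1 => w _; by rewrite mul0r expr0n mulr0.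
have [cz|cn] := eqVneq (cc j) 0.
  rewrite (_ : EX _ _ _ = 0) ?mulr_ge0 //; apply: big1 => w _.
  by rewrite cz !(mul0r, mulr0) expr0n mulr0.
have cp : 0 < cc j by rewrite lt_neqAle eq_sym cn cc0.
have -> : EX p x (fun v => (2 * W v j ^+ 4 / (cc j * C j) * (cc j / a)) ^+ 2) =
  4 / (C j ^+ 2 * a ^+ 2) * EX p x (fun v => dot (B ^~ j) v ^+ 8).
  rewrite -EXZ; apply: eq_E1 => w; rewrite Wdot -cc2; field; by rewrite an0 cn.
have e8 : EX p x (fun v => dot (B ^~ j) v ^+ 8) <= D * C j ^+ 4.
  have -> : D * C j ^+ 4 = (16 * CA R * cc j) ^+ 8 by rewrite [RHS]exprMn -eD -cc2 -exprM.
  by apply: (EX_dot_8 lX sX aX) => //; rewrite cc2.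
have Cp : 0 < C j by rewrite -cc2 exprn_gt0.
have Cap : 0 < C j ^+ 2 * a ^+ 2 by rewrite mulr_gt0 ?exprn_gt0.
rewrite mulrAC ler_pdivrMr //; apply: (@le_trans _ _ (4 * (D * C j ^+ 4))); first by rewrite ler_wpM2l.
have -> : 4 * D * C j * (C j ^+ 2 * a ^+ 2) = 4 * D * C j ^+ 3 * a ^+ 2 by ring.
have -> : 4 * (D * C j ^+ 4) = 4 * D * C j ^+ 3 * C j by ring.
by rewrite ler_wpM2l // !mulr_ge0 // exprn_ge0.
Qed.

Let M := (Num.truncn q).+2.
Let zz j := C j / a ^+ 2.

Let N (k : {ffun 'I_m -> 'I_M.+1 * bool}) : bool :=
  (\sum_j ((k j).1 : nat)%:R <= 2 * q) &&
  [forall j, if (k j).1 == ord0 then (k j).2 else 1 <= zz j * expR ((k j).1 : nat)%:R].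

Section Net.
Hypothesis an0 : a != 0.
Variable eta : 'I_m -> 'I_M.+1 -> R.
Hypothesis Heta : forall j k, 0 <= eta j k /\ dom' j (eta j k) /\ cost' j (eta j k) <= (k : nat)%:R /\
  forall t, dom' j t -> cost' j t <= (k : nat)%:R -> `|t| <= 2 * eta j k.

Let ap : 0 < a. Proof. by rewrite lt_neqAle eq_sym an0. Qed.

(** The halving restores the ball: the integer costs may total [2 q], and star-shapedness halves
    them. *)
Let yv (k : {ffun 'I_m -> 'I_M.+1 * bool}) j : R :=
  if (k j).1 == ord0 then 0 else 1 / 2 * (if (k j).2 then eta j (k j).1 else - eta j (k j).1).

Let yv_ball k : N k -> ball dom' cost' q (yv k).
Proof.
move=> /andP[Nk _]; pose u j := if (k j).1 == ord0 then 0 else if (k j).2 then eta j (k j).1 else - eta j (k j).1.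
have hu j : dom' j (u j) /\ cost' j (u j) <= ((k j).1 : nat)%:R.
  have [e0 [de [ce _]]] := Heta j (k j).1; rewrite /u.
  case: eqP => [->|_].
    have [_ [h0 _]] := sY j; have [d c0] : dom' j 0 /\ cost' j 0 = 0 ^+ 2 by apply: h0; rewrite normr0.
    by rewrite c0 expr0n.
  case: ifP => _ //; have [_ [_ [_ [_ [ev _]]]]] := sY j; by have [? ->] := ev _ de.
have bu : ball dom' cost' (2 * q) u.
  split=> [j|]; first by case: (hu j).
  by apply: le_trans Nk; apply: ler_sum => j _; case: (hu j).
have := ballZ (k := 1 / 2) sY _ _ bu; have -> : 1 / 2 * (2 * q) = q by lra.
have -> : (fun j => 1 / 2 * u j) = yv k by apply/funext => j; rewrite /u /yv; case: ifP; rewrite ?mulr0.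
by apply; lra.
Qed.

Let f k v : R := if N k then Num.max 0 (dot (W v) (yv k)) else 0.
Let f0 k v : 0 <= f k v. Proof. by rewrite /f; case: ifP => // _; rewrite le_max lexx. Qed.
Let k0 : {ffun 'I_m -> 'I_M.+1 * bool} := [ffun=> (ord0, true)].
Let Nk0 : N k0.
Proof.
apply/andP; split; last by apply/forallP => j; rewrite ffunE eqxx.
by rewrite big1 => [|j _]; rewrite ?ffunE //=; have := q0; lra.
Qed.
Let mm v := maxf k0 (f ^~ v).
Let mm0 v : 0 <= mm v. Proof. exact: le_trans (f0 k0 v) (le_maxf k0 (f^~ v) k0). Qed.

Let dotW v y : dot (W v) y = dot (fun i => \sum_j B i j * y j) v.
Proof.
rewrite /dot; under eq_bigr do rewrite mulr_suml.
rewrite exchange_big; apply: eq_bigr => i _; rewrite mulr_suml.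
by apply: eq_bigr => j _; rewrite mulrAC.
Qed.

Let smax y : supported (fun v => Num.max 0 (dot (W v) y)).
Proof.
move=> v; have W0 v' : dot (fun=> 0) v' = 0 :> R by rewrite /dot big1 // => i _; rewrite mul0r.
case: (leP (dot (W v) y) 0) => h.
  exists (fun=> 0) => [|v']; rewrite W0 //; last by rewrite le_max lexx.
by exists (fun i => \sum_j B i j * y j) => [|v']; rewrite -dotW // le_max lexx orbT.
Qed.

Let Emm : EX p x (fun v => mm v ^+ 2) <= Cnet * T ^+ 2.
Proof.
have zq : \sum_j zz j = q.
  rewrite /zz -mulr_suml -/A a2 invf_div mulrC divfK // gt_eqF //.
  by move: ap; rewrite /a sqrtr_gt0 pmulr_lgt0 // invr_gt0.
have cnt : \sum_(k | N k) 1 <= expR (6 * q).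
  apply: (@net_count _ _ _ zz) => [j||k /andP[]//|k j /andP[_ /forallP]//].
    by rewrite /zz divr_ge0 // sqr_ge0.
  by rewrite zq.
have Ek k : N k -> EX p x (fun v => expR (q / T / 300 * f k v)) <= expR (1001 * q).
  move=> Nk; rewrite /f Nk; apply: (exp_moment lX sX aX (smax _) q0 T0).
    by move=> v bv; rewrite ge_max (ltW T0) h5 //; exact: yv_ball.
  by apply: h3; exact: yv_ball.
have -> : Cnet * T ^+ 2 = (300 * T) ^+ 2 * (4 * 1007 ^+ 2 + 8) by rewrite /Cnet exprMn; ring.
have s0 : 0 < 300 * T by apply: mulr_gt0 T0; rewrite ltr0n.
apply: (exp_second_moment PX0 PX1 q1 s0 (ler0n _ _) (fun w => mm0 _)).
apply: (@le_trans _ _ (\sum_(k | N k) EX p x (fun v => expR (q / T / 300 * f k v)))).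
  have -> : \sum_(k | N k) EX p x (fun v => expR (q / T / 300 * f k v)) =
     EX p x (fun v => \sum_(k | N k) expR (q / T / 300 * f k v)).
    by rewrite /EX /E1 exchange_big; apply: eq_bigr => w _; rewrite mulr_sumr.
  apply: E1_le => // w _; set v := (fun i => x i (w i)).
  have -> : q / (300 * T) = q / T / 300 by rewrite invfM [X in _ * X]mulrC mulrA.
  have h k : N k -> expR (q / T / 300 * f k v) <= \sum_(k | N k) expR (q / T / 300 * f k v).
    by move=> Nk; rewrite (bigD1 k Nk) /= lerDl; apply: sumr_ge0 => *; exact: expR_ge0.
  rewrite /mm; have [k ->] := maxf_ex k0 (f^~ v).
  case Nk : (N k); first exact: h.
  by apply: le_trans (h _ Nk0); rewrite ler_expR {1}/f Nk mulr0; apply: mulr_ge0 (f0 _ _);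
     apply: divr_ge0; [apply: divr_ge0; exact: ltW|exact: ler0n].
apply: (@le_trans _ _ (\sum_(k | N k) expR (1001 * q))); first by apply: ler_sum => k Nk; exact: Ek.
have -> : 1007 * q = 6 * q + 1001 * q by lra.
rewrite expRD -[X in \sum_(k | N k) X]mul1r -mulr_suml; apply: ler_wpM2r cnt; exact: expR_ge0.
Qed.

Let S v := \sum_j W v j ^+ 2.
Let ES : EX p x S <= 240 * A.
Proof.
have -> : EX p x S = \sum_j EX p x (fun v => dot (B ^~ j) v ^+ 2).
  by rewrite /EX /E1 exchange_big; apply: eq_bigr => w _; rewrite mulr_sumr.
rewrite /A mulr_sumr; apply: ler_sum => j _; exact: (EX_dot_sqr lX).
Qed.

(** Four kinds of coordinates. Those with [|t j| <= 1] go to Cauchy-Schwarz, those with [L j] to the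
    net. Of the others, if [|W v j| <= a] each unit of cost pays [a]. If [|W v j| > a], then
    [cc j * expR (kk / 2) < a] forces [|t j| * cc j <= 2 a], and inserting [(|W v j| / a)^3 >= 1]
    produces the term of [Q]. *)
Let pointwise v t : ball dom' cost' q t ->
  dot (W v) t <= Num.sqrt q * Num.sqrt (S v) + q * a + Q v + 4 * mm v.
Proof.
move=> [dt ct].
have cst j : 0 <= cost' j (t j) by case: (sY j) => h _; exact: h.
have cbig j : 1 < `|t j| -> `|t j| <= cost' j (t j) by case: (sY j) => _ [_ [h _]]; exact: h.
have csm j : `|t j| <= 1 -> cost' j (t j) = t j ^+ 2.
  by move=> h; case: (sY j) => _ [h1 _]; have [] := h1 _ h.
pose L j := (1 < `|t j|) && (1 <= zz j * expR (cost' j (t j))).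
have c_le j : cost' j (t j) <= q.
  by apply: le_trans ct; rewrite (bigD1 j) //= lerDl sumr_ge0.
(* Costs in [L] exceed 1, so replacing them by [truncn + 1] at most doubles them: this is the budget
   [2 q] in [N]. *)
pose k : {ffun 'I_m -> 'I_M.+1 * bool} :=
  [ffun j => if L j then (inord (Num.truncn (cost' j (t j))).+1, 0 <= W v j) else (ord0, true)].
have trunc j : (Num.truncn (cost' j (t j)))%:R <= cost' j (t j) < (Num.truncn (cost' j (t j))).+1%:R.
  exact: truncn_itv.
have kE j : L j -> ((k j).1 : nat) = (Num.truncn (cost' j (t j))).+1.
  move=> Lj; rewrite ffunE Lj /= inordK // /M !ltnS.
  exact: leqW (le_truncn (c_le j)).
have k0E j : L j -> ((k j).1 == ord0) = false.
  by move=> Lj; apply/negP => /eqP/(congr1 val); rewrite [val _]kE.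
have Nk : N k.
  apply/andP; split.
    apply: (@le_trans _ _ (\sum_j 2 * cost' j (t j))); last by rewrite -mulr_sumr ler_wpM2l.
    apply: ler_sum => j _; case Lj : (L j); last by rewrite ffunE Lj /= mulr_ge0.
    rewrite kE // -natr1; move: Lj => /andP[t1 _]; have := cbig _ t1; have /andP[h _] := trunc j; lra.
  apply/forallP => j; case Lj : (L j); last by rewrite ffunE Lj.
  rewrite k0E // kE //; move/andP: (Lj) => [_ h]; apply: le_trans h _.
  rewrite ler_wpM2l /zz ?divr_ge0 ?sqr_ge0 // ler_expR; by have /andP[_ /ltW] := trunc j.
have kn j : L j = false -> (k j).1 == ord0 by move=> Lj; rewrite ffunE Lj.
have k2E j : L j -> (k j).2 = (0 <= W v j) by move=> Lj; rewrite ffunE Lj.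
pose s1 j := if `|t j| <= 1 then `|t j| else 0.
pose Qj j := if C j <= a ^+ 2 then 2 * W v j ^+ 4 / (cc j * a ^+ 2) else 0.
have W4 j : 0 <= W v j ^+ 4 by rewrite exprn_even_ge0.
have Qj0 j : 0 <= Qj j.
  rewrite /Qj; case: ifP => // _; apply: divr_ge0; first exact: mulr_ge0.
  by apply: mulr_ge0 => //; exact: sqr_ge0.
(* [|t j| <= 2 eta], while [yv] is [eta / 2] with the sign of [W v j]: hence the factor 4. *)
have yW j : L j -> `|t j| * `|W v j| <= 4 * (W v j * yv k j).
  move=> Lj; rewrite /yv k0E // k2E //; have [e0 [_ [_ hh]]] := Heta j (k j).1.
  have : `|t j| <= 2 * eta j (k j).1.
    by apply: hh => //; rewrite kE //; have /andP[_ /ltW] := trunc j.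
  move: (eta _ _) e0 => e e0 te; case: (leP 0 (W v j)) => w0.
    by rewrite (ger0_norm w0); nra.
  by rewrite (ltr0_norm w0); nra.
have yW0 j : 0 <= W v j * yv k j.
  case Lj : (L j); last by rewrite /yv kn // mulr0.
  rewrite -(pmulr_rge0 (x := 4)) //; apply: le_trans (yW _ Lj); exact: mulr_ge0.
have term j : W v j * t j <= s1 j * `|W v j| + cost' j (t j) * a + Qj j + 4 * (W v j * yv k j).
  have ca : 0 <= cost' j (t j) * a by exact: mulr_ge0.
  apply: (@le_trans _ _ (`|t j| * `|W v j|)); first by rewrite -normrM mulrC ler_norm.
  have := Qj0 j; have := yW0 j; rewrite /s1; case: (leP `|t j| 1) => t1; first by lra.
  case Lj : (L j); first by have := yW _ Lj; rewrite mul0r; lra.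
  have z1 : zz j * expR (cost' j (t j)) < 1 by move: Lj; rewrite /L t1 /= => /negbT; rewrite -ltNge.
  rewrite mul0r add0r => y0 Q0; case: (leP `|W v j| a) => Wa.
    have : `|t j| * `|W v j| <= cost' j (t j) * a by apply: ler_pM => //; exact: cbig.
    lra.
  have cp : 0 < cc j.
    rewrite lt_neqAle cc0 andbT eq_sym; apply/negP => /eqP cz.
    have Bz i : B i j = 0.
      have : C j = 0 by rewrite -cc2 cz expr0n.
      move=> /eqP; rewrite psumr_eq0 => [/allP/(_ i)|i' _]; last exact: sqr_ge0.
      by rewrite mem_index_enum sqrf_eq0 => /(_ isT)/eqP.
    have : W v j = 0 by rewrite /W big1 // => i _; rewrite Bz mul0r.
    by move=> w0; move: Wa; rewrite w0 normr0; have := ap; lra.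
  set kk := cost' j (t j) in ca z1 *.
  have kt : `|t j| <= kk by exact: cbig.
  have ek : 1 + kk / 2 <= expR (kk / 2) by exact: expR_ge1Dx.
  have ekk : expR kk = expR (kk / 2) ^+ 2 by rewrite -expRM_natr; congr expR; lra.
  have ca1 : cc j * expR (kk / 2) < a.
    rewrite -(ltr_pXn2r (n := 2)) ?nnegrE ?mulr_ge0 ?expR_ge0 // exprMn cc2 -ekk.
    by move: z1; rewrite /zz mulrAC ltr_pdivrMr ?mul1r // exprn_gt0.
  have k0' : 0 <= kk by exact: cst.
  have Ca : C j <= a ^+ 2.
    rewrite -cc2 lerXn2r ?nnegrE //; apply: le_trans (ltW ca1).
    by rewrite ler_peMr // -expR0 ler_expR divr_ge0.
  have tc : `|t j| * cc j <= 2 * a.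
    apply: (@le_trans _ _ (kk * cc j)); first by rewrite ler_wpM2r.
    nra.
  have Q1 : `|t j| * `|W v j| <= Qj j.
    rewrite /Qj Ca ler_pdivlMr ?mulr_gt0 ?exprn_gt0 //.
    have -> : W v j ^+ 4 = `|W v j| ^+ 4 by rewrite (exprM _ 2 2) (exprM `|_| 2 2) real_normK ?num_real.
    move: (`|W v j|) Wa (`|t j|) tc => w wa u uc.
    have w0 : 0 <= w by have := ap; lra.
    have e3 : a ^+ 3 <= w ^+ 3 by apply: lerXn2r; rewrite ?nnegrE //; exact: ltW.
    apply: (@le_trans _ _ (2 * a * (w * a ^+ 2))).
      have -> : u * w * (cc j * a ^+ 2) = (u * cc j) * (w * a ^+ 2) by ring.
      by apply: ler_wpM2r uc; apply: mulr_ge0 => //; exact: sqr_ge0.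
    have -> : 2 * a * (w * a ^+ 2) = 2 * w * a ^+ 3 by ring.
    have -> : 2 * w ^+ 4 = 2 * w * w ^+ 3 by ring.
    by apply: ler_wpM2l e3; apply: mulr_ge0.
  lra.
have -> : Q v = \sum_j Qj j by rewrite /Q big_mkcond.
apply: (@le_trans _ _ (\sum_j (s1 j * `|W v j| + cost' j (t j) * a + Qj j + 4 * (W v j * yv k j)))).
  exact: ler_sum.
rewrite !big_split /= -mulr_suml -mulr_sumr; apply: lerD; [apply: lerD; [apply: lerD|]|] => //.
- apply: (@le_trans _ _ (Num.sqrt (\sum_j s1 j ^+ 2) * Num.sqrt (S v))); last first.
    rewrite ler_wpM2r ?sqrtr_ge0 // ler_wsqrtr //; apply: (le_trans _ ct); apply: ler_sum => j _.
    rewrite /s1; case: (leP `|t j| 1) => t1; last by rewrite expr0n.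
    by rewrite csm // real_normK ?num_real.
  have -> : S v = \sum_j `|W v j| ^+ 2 by apply: eq_bigr => j _; rewrite real_normK ?num_real.
  rewrite -sqrtrM ?sumr_ge0 // => [|j _]; last exact: sqr_ge0.
  by apply: le_trans (ler_norm _) _; rewrite -sqrtr_sqr ler_wsqrtr // CauchySchwarz_sum.
- by rewrite ler_wpM2r.
- rewrite ler_wpM2l //; apply: le_trans (le_maxf k0 (f^~ v) k).
  by rewrite /f Nk le_max lexx orbT.
Qed.

Lemma random_columns_pos : EX p x (fun v => sball dom' cost' q (W v) ^+ 2) <= Ccol * T ^+ 2.
Proof.
have D0 : 0 <= 4 * (16 * CA R) ^+ 8.
  by apply: mulr_ge0 => //; apply: exprn_ge0; apply: mulr_ge0; [exact: ler0n|exact: CA_ge0].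
have S0 v : 0 <= S v by apply: sumr_ge0 => j _; exact: sqr_ge0.
apply: (@le_trans _ _ (EX p x (fun v => 4 * (q * S v) + (4 * (q * a) ^+ 2 + (4 * Q v ^+ 2 + 64 * mm v ^+ 2))))).
  apply: (EX_le lX) => v.
  have sb : sball dom' cost' q (W v) <= Num.sqrt q * Num.sqrt (S v) + q * a + Q v + 4 * mm v.
    by apply: sball_le => //; [exact: ltW|move=> t bt; exact: pointwise].
  apply: (@le_trans _ _ ((Num.sqrt q * Num.sqrt (S v) + q * a + Q v + 4 * mm v) ^+ 2)).
    have s0 : 0 <= sball dom' cost' q (W v) by apply: sball_ge0 => //; exact: ltW.
    by rewrite lerXn2r ?nnegrE // (le_trans s0).
  have -> : q * S v = (Num.sqrt q * Num.sqrt (S v)) ^+ 2 by rewrite exprMn !sqr_sqrtr // ltW.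
  move: (_ * _) (q * a) (Q v) (mm v) => u1 u2 u3 u4.
  have := sqr_ge0 (u1 - u2); have := sqr_ge0 (u1 - u3); have := sqr_ge0 (u1 - 4 * u4).
  have := sqr_ge0 (u2 - u3); have := sqr_ge0 (u2 - 4 * u4); have := sqr_ge0 (u3 - 4 * u4).
  nra.
rewrite !EXD (EX_cst lX) !EXZ; move: EQ ES Emm hHS.
have -> : (q * a) ^+ 2 = q * A by rewrite exprMn a2; field; rewrite gt_eqF.
rewrite /Ccol; have [D eD] : exists D, D = (16 * CA R) ^+ 8 by exists ((16 * CA R) ^+ 8).
rewrite -eD in D0 *; move: (Cnet) => E; move: (EX p x _) (EX p x _) (EX p x _) => e1 e2 e3 g1 g2 g3 g4.
have g5 : q * e2 <= q * (240 * A) by rewrite ler_wpM2l // ltW.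
have g6 : 4 * D * (q * A) <= 4 * D * (4 * T ^+ 2) by rewrite ler_wpM2l.
nra.
Qed.
End Net.

Lemma random_columns : EX p x (fun v => sball dom' cost' q (W v) ^+ 2) <= Ccol * T ^+ 2.
Proof.
have [az|an0] := eqVneq a 0; last first.
  have [eta Heta] : {eta : 'I_m -> 'I_M.+1 -> R & forall j k, 0 <= eta j k /\ dom' j (eta j k) /\
    cost' j (eta j k) <= (k : nat)%:R /\
    forall t, dom' j t -> cost' j t <= (k : nat)%:R -> `|t| <= 2 * eta j k}.
    have [e he] := choice (fun jk : 'I_m * 'I_M.+1 => @cost_radius _ _ (jk.2 : nat)%:R (sY jk.1) (ler0n _ _)).
    by exists (fun j k => e (j, k)) => j k; exact: (he (j, k)).
  exact: (random_columns_pos an0 Heta).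
have Az : A = 0.
  have := a2; rewrite az expr0n /= => /esym/eqP; rewrite mulf_eq0 invr_eq0 (gt_eqF q0) orbF.
  by move/eqP.
have Bz i j : B i j = 0.
  have Cz : C j = 0.
    move/eqP: Az; rewrite psumr_eq0 // => /allP/(_ j); rewrite mem_index_enum => /(_ isT).
    by move/eqP.
  move/eqP: Cz; rewrite psumr_eq0 => [/allP/(_ i)|i' _]; last exact: sqr_ge0.
  by rewrite mem_index_enum sqrf_eq0 => /(_ isT)/eqP.
rewrite (_ : EX _ _ _ = 0).
  apply: mulr_ge0; last exact: sqr_ge0.
  have h : 0 <= (16 * CA R) ^+ 8 by apply: exprn_ge0; apply: mulr_ge0; [exact: ler0n|exact: CA_ge0].
  have h' : 0 <= Cnet.
    apply: mulr_ge0; first exact: sqr_ge0.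
    by apply: addr_ge0; [apply: mulr_ge0; [exact: ler0n|exact: sqr_ge0]|exact: ler0n].
  by rewrite /Ccol; move: (_ ^+ 8) h (Cnet) h' => ? ? ? ?; lra.
apply: big1 => w _; rewrite (_ : sball _ _ _ _ = 0) ?expr0n ?mulr0 //.
apply/eqP; rewrite eq_le; apply/andP; split; last by apply: sball_ge0 => //; exact: ltW.
apply: sball_le => //; first exact: ltW.
move=> t _; rewrite /dot big1 // => j _; rewrite /W big1 ?mul0r // => i _; by rewrite Bz mul0r.
Qed.
End RandomColumns.

(** * The moment bound for finite laws *)

Section FiniteMain.
Variable R : realType.

Lemma exprD_le (a b : R) P : 0 <= a -> 0 <= b -> a ^+ P.+1 + b ^+ P.+1 <= (a + b) ^+ P.+1.
Proof.
move=> a0 b0; elim: P => [|P IH]; first by rewrite !expr1.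
rewrite (exprS (a + b)); apply: le_trans (ler_wpM2l (addr_ge0 a0 b0) IH).
rewrite [a ^+ P.+2]exprS [b ^+ P.+2]exprS.
have := mulr_ge0 a0 (exprn_ge0 P.+1 b0); have := mulr_ge0 b0 (exprn_ge0 P.+1 a0); nra.
Qed.

Lemma expr_sum3_le (a b c : R) P : 0 <= a -> 0 <= b -> 0 <= c ->
  (a + b + c) ^+ P <= 3 ^+ P * (a ^+ P + b ^+ P + c ^+ P).
Proof.
move=> a0 b0 c0; have p0 d : 0 <= d -> 0 <= d ^+ P := @exprn_ge0 R P d.
have h d : 0 <= d -> a <= d -> b <= d -> c <= d -> (a + b + c) ^+ P <= 3 ^+ P * d ^+ P.
  move=> d0 ad bd cd; rewrite -exprMn lerXn2r ?nnegrE ?addr_ge0 ?mulr_ge0 //; lra.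
have [d [d0 [ad [bd [cd dd]]]]] : exists d, 0 <= d /\ a <= d /\ b <= d /\ c <= d /\ d ^+ P <= a ^+ P + b ^+ P + c ^+ P.
  have := p0 _ a0; have := p0 _ b0; have := p0 _ c0 => pc pb pa.
  case: (leP a b) => ab; [case: (leP b c) => bc|case: (leP a c) => ac].
  - exists c; split=> //; split; [exact: le_trans ab bc|split=> //; split=> //; lra].
  - exists b; split=> //; split=> //; split=> //; split; [exact: ltW|lra].
  - exists c; split=> //; split=> //; split; [exact: le_trans (ltW ab) ac|split=> //; lra].
  - exists a; split=> //; split=> //; split; [exact: ltW|split; [exact: ltW|lra]].
apply: le_trans (h d d0 ad bd cd) _; by rewrite ler_wpM2l // exprn_ge0.
Qed.

(** With row norms [r i] and [u = sqrt (q A)], the test vector is [min (1, q r_i / u)]: entries at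
    most 1 have quadratic cost, and the total is at most [q]. If [u > T], the bound [q r_i <= T]
    prevents any cut at 1, and the pairing equals [q A / u = u]. *)
Lemma hs_le n m (dom : 'I_n -> R -> Prop) cost (b : 'I_n -> 'I_m -> R) (q T : R) :
  (forall i, cost_spec (dom i) (cost i)) -> 1 <= q -> 0 < T ->
  (forall v, ball dom cost q v -> \sum_i Num.sqrt (\sum_j b i j ^+ 2) * v i <= T) ->
  (forall i, q * Num.sqrt (\sum_j b i j ^+ 2) <= T) ->
  q * \sum_j \sum_i b i j ^+ 2 <= 4 * T ^+ 2.
Proof.
move=> sX q1 T0 h4 h6; rewrite exchange_big /=.
pose r i := Num.sqrt (\sum_j b i j ^+ 2).
have r2 i : r i ^+ 2 = \sum_j b i j ^+ 2.
  by rewrite sqr_sqrtr // sumr_ge0 // => j _; exact: sqr_ge0.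
have r0 i : 0 <= r i by exact: sqrtr_ge0.
under eq_bigr do rewrite -r2.
set A := \sum_i _; have A0 : 0 <= A by apply: sumr_ge0 => i _; exact: sqr_ge0.
have q0 : 0 < q := lt_le_trans ltr01 q1.
pose u := Num.sqrt (q * A).
have u2 : u ^+ 2 = q * A by rewrite sqr_sqrtr // mulr_ge0 // ltW.
rewrite -u2; case: (leP u T) => [uT|Tu].
  have : 0 <= u by exact: sqrtr_ge0.
  nra.
have u0 : 0 < u := lt_trans T0 Tu.
pose v i := if q * r i <= u then q * r i / u else 1.
have v01 i : 0 <= v i <= 1.
  rewrite /v; case: ifP => h; last by rewrite ler01 lexx.
  rewrite ler_pdivrMr // mul1r h andbT divr_ge0 ?mulr_ge0 ?(ltW q0) ?(ltW u0) //.
have vn i : `|v i| <= 1 by have /andP[? ?] := v01 i; rewrite ger0_norm.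
have bv : ball dom cost q v.
  have hv i : dom i (v i) /\ cost i (v i) = v i ^+ 2 by case: (sX i) => _ [h _]; exact: h.
  split=> [i|]; first by case: (hv i).
  apply: (@le_trans _ _ (\sum_i (q / u) ^+ 2 * r i ^+ 2)).
    apply: ler_sum => i _; have [_ ->] := hv i; rewrite /v -exprMn.
    have e : q / u * r i = q * r i / u by rewrite mulrAC.
    case: ifP => h; rewrite e // expr1n -[leLHS](expr1n _ 2) lerXn2r ?nnegrE //.
      by rewrite divr_ge0 ?mulr_ge0 ?(ltW q0) ?(ltW u0).
    by rewrite ler_pdivlMr // mul1r ltW // ltNge h.
  rewrite -mulr_sumr -/A expr_div_n u2; have [->|An0] := eqVneq A 0; first by rewrite mulr0 ltW.
  by rewrite le_eqVlt; apply/orP; left; apply/eqP; field; rewrite An0 gt_eqF.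
have := h4 _ bv; rewrite -/(r _) => hT.
have : q * A <= u * \sum_i r i * v i.
  rewrite /A !mulr_sumr; apply: ler_sum => i _; rewrite /v; case: ifP => h.
    have -> : u * (r i * (q * r i / u)) = q * r i ^+ 2 by field; rewrite gt_eqF.
    by [].
  have := h6 i; rewrite -/(r i) mulr1 => h6i; have := r0 i; nra.
by rewrite -u2; have := hT; rewrite -/r => {}hT; nra.
Qed.

(** The factor [3 * CA] comes from the moment in [X] given [Y] and from splitting its scale into
    three parts. The bracket collects the [P]-norms of these parts over [Y]: [CA] for the partial
    mean, [CB * (CA + 1)] for [beta], and 1 for [T]. *)
Definition Cmain : R := 3 * CA R * (CA R + CB (1 + Ccol R) * (CA R + 1) + 1).

Lemma Ccol_ge0 : 0 <= Ccol R.
Proof.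
have h : 0 <= (16 * CA R) ^+ 8 by apply: exprn_ge0; apply: mulr_ge0; [exact: ler0n|exact: CA_ge0].
have h' : 0 <= Cnet R.
  apply: mulr_ge0; first exact: sqr_ge0.
  by apply: addr_ge0; [apply: mulr_ge0; [exact: ler0n|exact: sqr_ge0]|exact: ler0n].
by rewrite /Ccol; move: (_ ^+ 8) h (Cnet R) h' => ? ? ? ?; lra.
Qed.

Lemma CB_ge0 (CR : R) : 0 <= CR -> 0 <= CB CR.
Proof.
move=> c0; rewrite /CB /CBr; apply: mulr_ge0; last by rewrite addr_ge0 ?expR_ge0.
apply: mulr_ge0 => //; apply: mulr_ge0 => //; apply: addr_ge0 => //; apply: addr_ge0 => //.
exact: CA_ge0.
Qed.

#[local] Opaque Ccol CB.
Lemma Cmain_gt0 : 0 < Cmain.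
Proof.
have cA := CA_gt0 R.
have cB : 0 <= CB (1 + Ccol R) by apply: CB_ge0; apply: addr_ge0 => //; exact: Ccol_ge0.
rewrite /Cmain; apply: mulr_gt0; first exact: mulr_gt0.
apply: ltr_wpDl => //; apply: addr_ge0; first exact: ltW.
by apply: mulr_ge0 => //; apply: addr_ge0 => //; exact: ltW.
Qed.

Section Main.
Variables (n m : nat) (K : finType) (k0 : K) (b : K -> 'I_n -> 'I_m -> R).
Hypothesis b0 : forall i j, b k0 i j = 0.
Variables (G H : finType) (p x c : 'I_n -> G -> R) (p' x' c' : 'I_m -> H -> R).
Variables (dom : 'I_n -> R -> Prop) (cost : 'I_n -> R -> R).
Variables (dom' : 'I_m -> R -> Prop) (cost' : 'I_m -> R -> R).
Hypothesis HX : forall i, good (p i) (x i) (c i) (dom i) (cost i).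
Hypothesis HY : forall i, good (p' i) (x' i) (c' i) (dom' i) (cost' i).
Variables (q T : R) (r : nat).
Let P := (4 + r)%N.
Hypothesis q1 : 1 <= q.
Hypothesis T0 : 0 < T.
Hypothesis rq : q / 2 <= r%:R.
Hypothesis qP : q <= P%:R.
Hypothesis Pq : P%:R <= 8 * q.
Hypothesis h1 : EX p x (fun v => EX p' x' (NN k0 b v)) <= T.
Hypothesis h2 : forall v, ball dom cost q v -> EX p' x' (NN k0 b v) <= T.
Hypothesis h3 : forall t, ball dom' cost' q t -> EX p x (NN k0 b ^~ t) <= T.
Hypothesis h4 : forall k v, ball dom cost q v -> \sum_i Num.sqrt (\sum_j b k i j ^+ 2) * v i <= T.
Hypothesis h5 : forall k v t, ball dom cost q v -> ball dom' cost' q t -> bil b k v t <= T.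
Hypothesis h6 : forall k i, q * Num.sqrt (\sum_j b k i j ^+ 2) <= T.

Lemma finite_main : EX p x (fun v => EX p' x' (fun t => NN k0 b v t ^+ P)) <= (Cmain * T) ^+ P.
Proof.
have lX i : law (p i) (x i) (c i) := (HX i).1.
have lY i : law (p' i) (x' i) (c' i) := (HY i).1.
have sX i : cost_spec (dom i) (cost i) := (HX i).2.1.
have aX i : adapted (p i) (x i) (c i) (dom i) (cost i) := (HX i).2.2.1.
have sY i : cost_spec (dom' i) (cost' i) := (HY i).2.1.
have aY i : adapted (p' i) (x' i) (c' i) (dom' i) (cost' i) := (HY i).2.2.1.
have PX0 : forall w, 0 <= pw p w by apply: pw_ge0 => i g; case: (lX i).
have PY0 : forall w, 0 <= pw p' w by apply: pw_ge0 => i g; case: (lY i).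
have PY1 : \sum_w pw p' w = 1 by apply: sum_pw => i; case: (lY i) => _ [].
have C0 := Ccol_ge0; have cA := CA_ge0 R.
(* [1 + Ccol] replaces the square root of [Ccol], as [Ccol <= (1 + Ccol)^2]. *)
have hR k : EX p x (fun v => sball dom' cost' q (rowv b k v) ^+ 2) <= ((1 + Ccol R) * T) ^+ 2.
  have RC := random_columns lX sX aX sY (B := b k) q1 T0.
  apply: (@le_trans _ _ (Ccol R * T ^+ 2)).
    apply: RC => [t bt|v t bv bt|].
    - apply: le_trans (h3 bt); apply: (EX_le lX) => v; rewrite ge_max NN_ge0 //=.
      by rewrite -bil_row NN_ge.
    - by rewrite -bil_row; exact: h5.
    - exact: (hs_le sX q1 T0 (h4 k) (h6 k)).
  by rewrite exprMn ler_wpM2r ?sqr_ge0 //; nra.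
have CR0 : 0 <= 1 + Ccol R by rewrite addr_ge0.
have cB := CB_ge0 CR0.
have [beta [beta0 [betaP hb]]] := sup_process b0 HX HY q1 T0 CR0 rq qP Pq h1 h2 h5 hR.
pose Y (w : {ffun 'I_m -> H}) j := x' j (w j).
pose al t := EX p x (NN k0 b ^~ t).
have al0 t : 0 <= al t by apply: (EX_ge0 lX) => v; exact: NN_ge0.
(* Given [Y], this dominates both quantities that [moment] asks for, the mean over [X] and the
   supremum over the ball; the summand [T] makes it positive. *)
pose s w := al (Y w) + CB (1 + Ccol R) * T * beta w + T.
have cbb w : 0 <= CB (1 + Ccol R) * T * beta w by apply: mulr_ge0 => //; apply: mulr_ge0 => //; exact: ltW.
have s0 w : 0 < s w by rewrite /s ltr_wpDl // addr_ge0.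
have step1 w : EX p x (fun v => NN k0 b v (Y w) ^+ P) <= (CA R * s w) ^+ P.
  apply: (moment lX sX aX (q := q)) => //; first exact: supported_NNl.
  - by move=> v; exact: NN_ge0.
  - move=> v bv; apply: le_trans (hb v w bv) _.
    by rewrite /s -addrA addrCA lerDl addr_ge0 // ltW.
  - by rewrite /s -addrA -/(al (Y w)) lerDl addr_ge0 // ltW.
have EalP : EX p' x' (fun t => al t ^+ P) <= (CA R * T) ^+ P.
  apply: (moment lY sY aY (q := q)) => //.
    by apply: supported_avg => // w; exact: supported_NNr.
  by apply: le_trans h1; rewrite /al /EX E1_swap.
rewrite {1}/EX; under eq_E1 do rewrite /EX.
rewrite E1_swap; apply: (@le_trans _ _ (E1 (pw p') (fun w => (3 * CA R) ^+ P *
    (al (Y w) ^+ P + (CB (1 + Ccol R) * T) ^+ P * beta w ^+ P + T ^+ P)))).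
  apply: E1_le => // w _; apply: le_trans (step1 w) _.
  have -> : (3 * CA R) ^+ P = CA R ^+ P * 3 ^+ P by rewrite exprMn mulrC.
  rewrite [leLHS]exprMn -[leRHS]mulrA; apply: ler_wpM2l; first exact: exprn_ge0.
  rewrite -(exprMn P _ (beta w)); apply: expr_sum3_le => //; exact: ltW.
rewrite E1Z !E1D E1Z E1_cst //.
rewrite /Cmain; set D := CB _; have D0 : 0 <= D by [].
have -> : (3 * CA R * (CA R + D * (CA R + 1) + 1) * T) ^+ P =
  (3 * CA R) ^+ P * ((CA R + D * (CA R + 1) + 1) ^+ P * T ^+ P) by rewrite -mulrA exprMn (exprMn _ _ T).
apply: ler_wpM2l; first by apply: exprn_ge0; apply: mulr_ge0.
apply: (@le_trans _ _ ((CA R * T) ^+ P + (D * T) ^+ P * (CA R ^+ P + 1) + T ^+ P)).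
  rewrite lerD2r; apply: lerD; first exact: EalP.
  by apply: ler_wpM2l => //; apply: exprn_ge0; apply: mulr_ge0 => //; exact: ltW.
have -> : (CA R * T) ^+ P + (D * T) ^+ P * (CA R ^+ P + 1) + T ^+ P =
  (CA R ^+ P + D ^+ P * (CA R ^+ P + 1) + 1) * T ^+ P by rewrite !exprMn; ring.
apply: ler_wpM2r; first by apply: exprn_ge0; exact: ltW.
have e1 : CA R ^+ P + 1 <= (CA R + 1) ^+ P.
  by have := @exprD_le (CA R) 1 (3 + r) cA ler01; rewrite expr1n.
have u0 : 0 <= D * (CA R + 1) by apply: mulr_ge0 => //; exact: addr_ge0.
have e2 : D ^+ P * (CA R ^+ P + 1) <= (D * (CA R + 1)) ^+ P.
  by rewrite [leRHS]exprMn; apply: ler_wpM2l => //; exact: exprn_ge0.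
have e3 := @exprD_le (CA R + D * (CA R + 1)) 1 (3 + r) (addr_ge0 cA u0) ler01.
have e4 := @exprD_le (CA R) (D * (CA R + 1)) (3 + r) cA u0.
rewrite expr1n in e3; rewrite -/P in e3 e4 *.
apply: le_trans e3; rewrite lerD2r; apply: le_trans e4; exact: lerD.
Qed.
End Main.
End FiniteMain.

(** * Discretized log-concave laws *)

Section Layers.
Variable R : realType.
Implicit Types (a b phi : nat -> R).

(* expectation of [phi] under the law on [0 .. M] with tail function [a] *)
Definition layer a M phi : R := \sum_(j < M.+1) (a j - a j.+1) * phi j.

Lemma layer_abel a M phi :
  layer a M phi = a 0%N * phi 0%N + \sum_(j < M) a j.+1 * (phi j.+1 - phi j) - a M.+1 * phi M.
Proof.
rewrite /layer; elim: M => [|M IH].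
  by rewrite big_ord_recr !big_ord0 /=; ring.
by rewrite big_ord_recr /= IH [in RHS]big_ord_recr /=; ring.
Qed.

(** Stochastic domination: after summation by parts only tail values occur, multiplied by the
    nonnegative increments of [phi]. *)
Lemma layer_mono a b M phi : (forall i j, (i <= j)%N -> phi i <= phi j) -> 0 <= phi 0%N ->
  (forall j, (j <= M)%N -> a j <= b j) -> b M.+1 <= a M.+1 -> layer a M phi <= layer b M phi.
Proof.
move=> hphi phi0 ab abM; have phige j : 0 <= phi j by apply: le_trans (hphi 0%N j _).
rewrite !layer_abel; apply: lerB; last by rewrite ler_wpM2r.
apply: lerD; first by rewrite ler_wpM2r // ab.
by apply: ler_sum => j _; apply: ler_wpM2r; [rewrite subr_ge0 hphi|exact: ab].
Qed.

Lemma layer_le a M phi psi : (forall j, (j <= M)%N -> a j.+1 <= a j) ->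
  (forall j, (j <= M)%N -> a j.+1 < a j -> phi j <= psi j) -> layer a M phi <= layer a M psi.
Proof.
move=> ha h; apply: ler_sum => j _; have jM : (j <= M)%N by rewrite -ltnS.
have [e|ne] := eqVneq (a j) (a j.+1); first by rewrite e subrr !mul0r.
by rewrite ler_wpM2l ?subr_ge0 ?ha // h // lt_neqAle eq_sym ne ha.
Qed.

Lemma layerZ a M k phi : layer a M (fun j => k * phi j) = k * layer a M phi.
Proof. by rewrite /layer mulr_sumr; apply: eq_bigr => j _; rewrite mulrCA. Qed.

Lemma layerD a M phi psi : layer a M (fun j => phi j + psi j) = layer a M phi + layer a M psi.
Proof. by rewrite /layer -big_split; apply: eq_bigr => j _; rewrite mulrDr. Qed.

Lemma layer_from a M k : (k <= M)%N -> a M.+1 = 0 -> layer a M (fun j => (k <= j)%N%:R) = a k.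
Proof.
move=> kM aM; have -> : a k = a k - a M.+1 by rewrite aM subr0.
rewrite /layer; elim: M kM {aM} => [|M IH] kM.
  by move: kM; rewrite leqn0 => /eqP ->; rewrite big_ord_recr big_ord0 /=; ring.
rewrite big_ord_recr /= kM mulr1; move: kM; rewrite leq_eqVlt => /orP[/eqP->|kM].
  rewrite big1 ?add0r // => i _; by rewrite leqNgt ltn_ord mulr0.
by rewrite IH // addrA subrK.
Qed.

Lemma layer_cst a M k : a 0%N = 1 -> a M.+1 = 0 -> layer a M (fun=> k) = k.
Proof.
move=> a0 aM; have := layer_from (leq0n M) aM; rewrite a0.
have -> : (fun j => (0 <= j)%N%:R) = (fun=> 1 : R) by apply/funext.
by move=> h; rewrite -[in RHS](mulr1 k) -h -layerZ; congr layer; apply/funext => j; rewrite mulr1.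
Qed.

Lemma layer_extend a M L phi : (M <= L)%N -> (forall j, (M < j)%N -> a j = 0) ->
  layer a L phi = layer a M phi.
Proof.
move=> ML h; elim: L ML => [|L IH]; first by rewrite leqn0 => /eqP ->.
rewrite leq_eqVlt => /orP[/eqP->//|ML]; rewrite ltnS in ML.
by rewrite /layer big_ord_recr /= -/(layer a L phi) IH // !h ?subrr ?mul0r ?addr0 // ltnS ltnW.
Qed.

(** If [a] is the tail function of an integer variable, [a (ceil3 j)] is that of its triple. *)
Definition ceil3 j := ((j + 2) %/ 3)%N.

Lemma layer_ceil3 a M phi : layer (fun j => a (ceil3 j)) (3 * M) phi =
  layer a M (fun i => phi (3 * i)%N).
Proof.
elim: M => [|M IH].
  by rewrite muln0 /layer !big_ord_recr !big_ord0 /= /ceil3.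
have -> : (3 * M.+1 = (3 * M).+3)%N by lia.
have rec L psi c : layer c L.+1 psi = layer c L psi + (c L.+1 - c L.+2) * psi L.+1.
  by rewrite /layer big_ord_recr.
rewrite !rec IH /ceil3.
have -> : (((3 * M).+1 + 2) %/ 3 = M.+1)%N by lia.
have -> : (((3 * M).+2 + 2) %/ 3 = M.+1)%N by lia.
have -> : (((3 * M).+3 + 2) %/ 3 = M.+1)%N by lia.
have -> : (((3 * M).+4 + 2) %/ 3 = M.+2)%N by lia.
have -> : (3 * M.+1 = (3 * M).+3)%N by lia.
by rewrite !subrr !mul0r !addr0.
Qed.
End Layers.

(** * Grid laws built from a tail function *)

Section GridLaw.
Variables (R : realType) (Gt : R -> R).

(** Log-concavity is kept only as star-shapedness of [- ln Gt] at 0; the last two clauses carry the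
    normalization. *)
Definition tail_spec : Prop :=
  Gt 0 = 1 /\ (forall t, 0 <= t -> 0 <= Gt t) /\ (forall u v, 0 <= u -> u <= v -> Gt v <= Gt u) /\
  (forall k t, 0 <= t -> 0 <= k -> k <= 1 -> 0 < Gt t -> - ln (Gt (k * t)) <= k * - ln (Gt t)) /\
  (forall t, 1 < t -> 0 < Gt t -> t <= - ln (Gt t)) /\ expR (- 1) <= Gt (1 / 2).

Hypothesis HG : tail_spec.
Variables (s' M : nat).
Hypothesis s'0 : (0 < s')%N.
(** An even number of steps puts 1/2 on the grid, where the last clause of [law] is read off. *)
Let s := (2 * s')%N.
Hypothesis sM : (s <= M)%N.

(** The tail drops to 0 after [M]: all mass beyond the top of the grid is moved onto the top
    point. *)
Definition gr j : R := if (j <= M)%N then Gt (j%:R / s%:R) else 0.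
Definition gridT : finType := ('I_M.+1 * bool)%type.
Definition grid_x (h : gridT) : R := (if h.2 then 1 else - 1) * (h.1%:R / s%:R).
Definition grid_p (h : gridT) : R := (gr h.1 - gr h.1.+1) / 2.
Definition grid_dom (t : R) : Prop := `|t| <= 1 \/ `|t| <= M%:R / s%:R /\ 0 < Gt `|t|.
Definition grid_cost (t : R) : R := if `|t| <= 1 then t ^+ 2 else - ln (Gt `|t|).

Let s0 : 0 < s%:R :> R. Proof. by rewrite ltr0n /s muln_gt0. Qed.
Let s2 : 2 <= s%:R :> R. Proof. by rewrite (ler_nat _ 2) /s; lia. Qed.
Let pos j : 0 <= j%:R / s%:R :> R. Proof. by rewrite divr_ge0. Qed.

Let G0 : Gt 0 = 1. Proof. by case: HG. Qed.
Let Gge0 t : 0 <= t -> 0 <= Gt t. Proof. by case: HG => _ [h _]; exact: h. Qed.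
Let Gmono u v : 0 <= u -> u <= v -> Gt v <= Gt u. Proof. by case: HG => _ [_ [h _]]; exact: h. Qed.
Let Gle1 t : 0 <= t -> Gt t <= 1. Proof. by move=> t0; rewrite -G0 Gmono. Qed.
Let Gshrink k t : 0 <= t -> 0 <= k -> k <= 1 -> 0 < Gt t -> - ln (Gt (k * t)) <= k * - ln (Gt t).
Proof. by case: HG => _ [_ [_ [h _]]]; exact: h. Qed.

Let g0 : gr 0 = 1. Proof. by rewrite /gr leq0n mul0r G0. Qed.
Let gM : gr M.+1 = 0. Proof. by rewrite /gr ltnn. Qed.
Let gge0 j : 0 <= gr j. Proof. by rewrite /gr; case: ifP => // _; exact: Gge0. Qed.
Let gmono i j : (i <= j)%N -> gr j <= gr i.
Proof.
move=> ij; rewrite /gr; case: (leqP j M) => jM; last by case: ifP => // _; exact: Gge0.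
by rewrite (leq_trans ij jM) Gmono // ler_wpM2r ?invr_ge0 ?ler_nat // ltW.
Qed.

Let expRlnG t : 0 < Gt t -> expR (ln (Gt t)) = Gt t. Proof. by move=> h; rewrite lnK // posrE. Qed.

(** Star-shapedness gives superadditivity of [- ln Gt]: compare [u] and [v] with [u + v], with
    ratios that sum to 1. *)
Let Gadd u v : 0 <= u -> 0 <= v -> Gt (u + v) <= Gt u * Gt v.
Proof.
move=> u0 v0; have w0 : 0 <= u + v by exact: addr_ge0.
case: (leP (Gt (u + v)) 0) => [h|Gp]; first by apply: le_trans h _; rewrite mulr_ge0 ?Gge0.
have Gup : 0 < Gt u by apply: lt_le_trans Gp (Gmono _ _) => //; rewrite lerDl.
have Gvp : 0 < Gt v by apply: lt_le_trans Gp (Gmono _ _) => //; rewrite lerDr.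
have [e|ne] := eqVneq (u + v) 0.
  have [-> ->] : u = 0 /\ v = 0 by split; lra.
  by rewrite addr0 G0 mulr1.
have wp : 0 < u + v by rewrite lt_neqAle eq_sym ne.
have hu := @Gshrink (u / (u + v)) (u + v) w0 (divr_ge0 u0 w0) _ Gp.
have hv := @Gshrink (v / (u + v)) (u + v) w0 (divr_ge0 v0 w0) _ Gp.
have {}hu : - ln (Gt u) <= u / (u + v) * - ln (Gt (u + v)).
  by rewrite divfK // in hu; apply: hu; rewrite ler_pdivrMr // mul1r lerDl.
have {}hv : - ln (Gt v) <= v / (u + v) * - ln (Gt (u + v)).
  by rewrite divfK // in hv; apply: hv; rewrite ler_pdivrMr // mul1r lerDr.
have : ln (Gt (u + v)) <= ln (Gt u) + ln (Gt v).
  have e : u / (u + v) * - ln (Gt (u + v)) + v / (u + v) * - ln (Gt (u + v)) = - ln (Gt (u + v)).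
    by rewrite -mulrDl -mulrDl divff // mul1r.
  lra.
by rewrite -ler_expR expRD !expRlnG.
Qed.

Let gadd i j : gr (i + j) <= gr i * gr j.
Proof.
case: (leqP (i + j) M) => h; last by rewrite {1}/gr leqNgt h mulr_ge0.
have iM : (i <= M)%N by apply: leq_trans h; exact: leq_addr.
have jM : (j <= M)%N by apply: leq_trans h; exact: leq_addl.
by rewrite /gr h iM jM natrD mulrDl Gadd.
Qed.

Lemma gr0 : gr 0 = 1. Proof. exact: g0. Qed.
Lemma grM : gr M.+1 = 0. Proof. exact: gM. Qed.
Lemma gr_ge0 j : 0 <= gr j. Proof. exact: gge0. Qed.
Lemma gr_mono i j : (i <= j)%N -> gr j <= gr i. Proof. exact: gmono. Qed.
Lemma gr_add i j : gr (i + j) <= gr i * gr j. Proof. exact: gadd. Qed.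

Lemma E1_grid (F : gridT -> R) : E1 grid_p F =
  layer gr M (fun j => (F (inord j, true) + F (inord j, false)) / 2).
Proof.
rewrite /E1 /layer; transitivity (\sum_(j < M.+1) \sum_(b : bool) grid_p (j, b) * F (j, b)).
  by rewrite pair_bigA; apply: eq_bigr => -[].
by apply: eq_bigr => j _; rewrite big_bool /grid_p /= inord_val; lra.
Qed.

Lemma E1_grid_abs (phi : R -> R) (psi : R -> R) :
  E1 grid_p (fun h => psi (`|grid_x h|) * phi `|grid_x h|) =
  layer gr M (fun j => psi (j%:R / s%:R) * phi (j%:R / s%:R)).
Proof.
rewrite E1_grid; apply: eq_bigr => j _; congr (_ * _).
have a b : `|grid_x (inord j, b)| = j%:R / s%:R.
  by rewrite /grid_x /= normrM inordK // (ger0_norm (pos _)); case: b; rewrite ?normrN normr1 mul1r.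
by rewrite !a; lra.
Qed.

Lemma grid_cost_spec : cost_spec grid_dom grid_cost.
Proof.
have M1 : 1 <= M%:R / s%:R :> R by rewrite ler_pdivlMr // mul1r ler_nat.
have big t : 1 < t -> 0 < Gt t -> t <= - ln (Gt t) by case: HG => _ [_ [_ [_ [h _]]]]; exact: h.
split; [|split; [|split; [|split; [|split]]]].
- move=> t _; rewrite /grid_cost; case: ifP => _; first exact: sqr_ge0.
  by rewrite oppr_ge0 ln_le0 // Gle1.
- by move=> t t1; rewrite /grid_dom /grid_cost t1; split=> //; left.
- move=> t [t1|[tM Gp]] t2; first by move: t1; rewrite leNgt t2.
  by rewrite /grid_cost (leNgt `|t| 1) t2 /=; exact: big.
- move=> t k dt k0 k1; rewrite /grid_dom /grid_cost normrM (ger0_norm k0).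
  case: (leP (k * `|t|) 1) => kt.
    split; [by left|case: (leP `|t| 1) => t1].
      by rewrite exprMn; apply: ler_wpM2r; [exact: sqr_ge0|nra].
    have [|[tM Gp]] := dt; first by rewrite leNgt t1.
    rewrite -(real_normK (num_real (k * t))) normrM (ger0_norm k0).
    apply: (@le_trans _ _ (k * `|t|)); first by rewrite expr2 ler_piMl // mulr_ge0.
    by rewrite ler_wpM2l // big.
  have t1 : 1 < `|t|.
    by apply: lt_le_trans kt _; rewrite -[leRHS]mul1r ler_wpM2r.
  have [|[tM Gp]] := dt; first by rewrite leNgt t1.
  rewrite (leNgt `|t| 1) t1 /=; split; last exact: Gshrink.
  have ktt : k * `|t| <= `|t| by rewrite -[leRHS]mul1r ler_wpM2r.
  right; split; first exact: le_trans ktt tM.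
  by apply: lt_le_trans Gp (Gmono _ _) => //; exact: mulr_ge0.
- by move=> t; rewrite /grid_dom /grid_cost normrN sqrrN.
- exists (M%:R / s%:R) => t [t1|[]//]; exact: le_trans t1 M1.
Qed.

Lemma grid_adapted : adapted grid_p grid_x (grid_cost \o grid_x) grid_dom grid_cost.
Proof.
move=> h ph; split=> //; have e : `|grid_x h| = h.1%:R / s%:R.
  by rewrite /grid_x normrM (ger0_norm (pos _)); case: (h.2); rewrite ?normrN normr1 mul1r.
right; rewrite e; have hM : (h.1 <= M)%N by rewrite -ltnS.
split; first by rewrite ler_wpM2r ?invr_ge0 ?ler_nat // ltW.
have : 0 < gr h.1.
  move: ph; rewrite /grid_p pmulr_lgt0 ?invr_gt0 // subr_gt0; exact: le_lt_trans.
by rewrite /gr hM.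
Qed.

Let expN1 : (1 / 3 : R) <= expR (- 1).
Proof.
have h : 5 / 6 <= expR (- (1 / 6)) :> R by apply: le_trans (expR_ge1Dx _); lra.
have -> : (- 1 : R) = - (1 / 6) * 6%:R by lra.
rewrite expRM_natr; apply: (@le_trans _ _ ((5 / 6) ^+ 6)); first by lra.
by apply: lerXn2r h; rewrite nnegrE ?expR_ge0 //; lra.
Qed.

Let glayer_le phi psi : (forall j, (j <= M)%N -> gr j.+1 < gr j -> phi j <= psi j) -> layer gr M phi <= layer gr M psi.
Proof. by apply: layer_le => j _; exact: gmono. Qed.

Let layer_ge0 phi : (forall j, 0 <= phi j) -> 0 <= layer gr M phi.
Proof. by move=> h; rewrite -(layer_cst 0 g0 gM); apply: glayer_le => j _ _; exact: h. Qed.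

(** At half the argument [- ln Gt] is at most halved, and [ceil3 j <= j / 2] once [j >= 2]. Rounding
    on the grid thus turns the natural dilation by 2 into the 3 of [law]. *)
Lemma sqrt_gr j : (2 <= j)%N -> Num.sqrt (gr j) <= gr (ceil3 j).
Proof.
move=> j2; case: (leqP j M) => jM; last by rewrite {1}/gr leqNgt jM sqrtr0.
have cM : (ceil3 j <= M)%N by rewrite /ceil3; lia.
rewrite /gr jM cM.
case: (leP (Gt (j%:R / s%:R)) 0) => [h|Gp]; first by rewrite ler0_sqrtr // Gge0.
have e := @Gshrink (1 / 2) _ (pos j) _ _ Gp.
have {}e : - ln (Gt (1 / 2 * (j%:R / s%:R))) <= 1 / 2 * - ln (Gt (j%:R / s%:R)) by apply: e; lra.
have Gh : 0 < Gt (1 / 2 * (j%:R / s%:R)).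
  apply: lt_le_trans Gp (Gmono _ _); first by rewrite mulr_ge0.
  by have := pos j; lra.
apply: (@le_trans _ _ (Gt (1 / 2 * (j%:R / s%:R)))); last first.
  apply: Gmono => //; rewrite mulrA ler_wpM2r ?invr_ge0 ?(ltW s0) //.
  have : (2 * ceil3 j <= j)%N by rewrite /ceil3; lia.
  rewrite -(ler_nat R) natrM; lra.
rewrite -(ler_pXn2r (n := 2)) ?nnegrE ?sqrtr_ge0 ?(ltW Gh) // sqr_sqrtr ?(ltW Gp) //.
by rewrite -[leLHS](expRlnG Gp) -[X in _ <= X ^+ 2](expRlnG Gh) -expRM_natr ler_expR; lra.
Qed.

Lemma grid_law : law grid_p grid_x (grid_cost \o grid_x).
Proof.
split; [|split; [|split; [|split; [|split]]]].
- by move=> h; rewrite /grid_p divr_ge0 // subr_ge0 gmono.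
- have := E1_grid (fun=> 1); rewrite /E1; under eq_bigr do rewrite mulr1.
  by move=> ->; rewrite layer_cst //; lra.
- move=> F; rewrite !E1_grid; apply: eq_bigr => j _; congr (_ * _).
  by rewrite /grid_x /= !mulN1r !mul1r opprK addrC.
- move=> h ph; have [dx _] := grid_adapted ph; have [c0 [_ [cb _]]] := grid_cost_spec.
  split; first exact: c0.
  case: (leP `|grid_x h| 1) => x1; first by have := c0 _ dx; rewrite /comp; lra.
  by have := cb _ dx x1; rewrite /comp; lra.
- move=> phi hphi phi0.
  have E3 : E1 grid_p (fun h => phi (3 * `|grid_x h|)) = layer gr M (fun i => phi (3 * (i%:R / s%:R))).
    have := E1_grid_abs (fun y => phi (3 * y)) (fun=> 1).
    rewrite (eq_E1 grid_p (F' := fun h => phi (3 * `|grid_x h|))) => [->|h]; last by rewrite mul1r.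
    by congr layer; apply/funext => j; rewrite mul1r.
  have -> : E1 grid_p (fun g => expR ((grid_cost \o grid_x) g / 2) * phi `|grid_x g|) =
     layer gr M (fun j => expR (grid_cost (j%:R / s%:R) / 2) * phi (j%:R / s%:R)).
    rewrite -(E1_grid_abs phi (fun y => expR (grid_cost y / 2))); apply: eq_E1 => h.
    by rewrite /grid_cost /= normr_id real_normK ?num_real.
  (* For [|x| <= 1] the density is at most [e^{1/2} <= 2]. Beyond, with [A] and [B] the roots of
     consecutive tail values, [(A^2 - B^2) / A <= 2 (A - B)]: the reweighted law is at most twice
     the layer of the tail [sqrt gr]. *)
  rewrite E3; pose psi j : R := if (s < j)%N then phi (j%:R / s%:R) else 0.
  have psi0 j : 0 <= psi j by rewrite /psi; case: ifP => // _; exact: phi0.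
  apply: (@le_trans _ _ (2 * phi 1 + 2 * layer (fun j => Num.sqrt (gr j)) M psi)).
    rewrite -{1}(layer_cst (2 * phi 1) g0 gM) -layerZ /layer -big_split /=; apply: ler_sum => j _.
    have dg : 0 <= gr j - gr j.+1 by rewrite subr_ge0 gmono.
    rewrite /psi /grid_cost (ger0_norm (pos _)) ler_pdivrMr // mul1r ler_nat.
    case: (leqP j s) => js.
      rewrite !mulr0 addr0; apply: ler_wpM2l => //; apply: ler_pM; rewrite ?expR_ge0 ?phi0 //.
        apply: le_trans (expR_half_le R); rewrite ler_expR ler_wpM2r ?invr_ge0 //.
        rewrite expr_le1 // ler_pdivrMr // mul1r ler_nat //.
      by apply: hphi => //; rewrite ler_pdivrMr // mul1r ler_nat.
    apply: (@le_trans _ _ (2 * ((Num.sqrt (gr j) - Num.sqrt (gr j.+1)) * phi (j%:R / s%:R)))); last first.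
      by rewrite [leRHS](_ : _ = (gr j - gr j.+1) * (2 * phi 1) + 2 * ((Num.sqrt (gr j) - Num.sqrt (gr j.+1)) * phi (j%:R / s%:R))) ?lerDr ?mulr_ge0 ?phi0 //; ring.
    rewrite [leLHS]mulrA [leRHS]mulrA; apply: ler_wpM2r; first exact: phi0.
    have [gz|gn] := eqVneq (gr j) 0.
      have : gr j.+1 <= gr j by exact: gmono.
      rewrite gz => h; have -> : gr j.+1 = 0 by apply/eqP; rewrite eq_le h gge0.
      by rewrite !subrr mul0r mulr0.
    have gp : 0 < gr j by rewrite lt_neqAle eq_sym gn gge0.
    have jM : (j <= M)%N by rewrite -ltnS.
    have Gj : gr j = Gt (j%:R / s%:R) by rewrite /gr jM.
    set A := Num.sqrt (gr j); set B := Num.sqrt (gr j.+1).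
    have A2 : A ^+ 2 = gr j by rewrite sqr_sqrtr.
    have B2 : B ^+ 2 = gr j.+1 by rewrite sqr_sqrtr.
    have Ap : 0 < A by rewrite sqrtr_gt0.
    have B0 : 0 <= B by exact: sqrtr_ge0.
    have BA : B <= A by rewrite ler_wsqrtr // gmono.
    have -> : expR (- ln (Gt (j%:R / s%:R)) / 2) = A^-1.
      rewrite mulNr expRN -Gj; congr (_^-1); apply/eqP; rewrite -(eqrXn2 (n := 2)) ?expR_ge0 ?(ltW Ap) //.
      by rewrite A2 -expRM_natr divfK // Gj expRlnG // -Gj.
    rewrite -A2 -B2 ler_pdivrMr //; nra.
  (* The first two values are set to 0 because [sqrt_gr] starts at [j = 2]; [psi] vanishes up to
     [s >= 2], so the layer sum does not change. *)
  pose a j := if (j <= 1)%N then 0 else Num.sqrt (gr j).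
  have -> : layer (fun j => Num.sqrt (gr j)) M psi = layer a (3 * M) psi.
    rewrite (layer_extend (M := M) (L := 3 * M) (a := a)); last first.
    - by move=> j jM; rewrite /a; case: ifP => // _; rewrite /gr leqNgt jM sqrtr0.
    - by lia.
    apply: eq_bigr => j _; rewrite /psi; case: ifP => sj; last by rewrite !mulr0.
    have j2 : (2 < j)%N by apply: leq_ltn_trans sj; rewrite /s; lia.
    have j1 : (j <= 1)%N = false by lia.
    have j1' : (j.+1 <= 1)%N = false by lia.
    by rewrite /a j1 j1'.
  have : layer a (3 * M) psi <= layer (fun j => gr (ceil3 j)) (3 * M) psi.
    apply: layer_mono => [i j ij||j _|].
    - rewrite /psi; case: ifP => si; last by case: ifP => // _; exact: phi0.
      rewrite (leq_trans si ij); apply: hphi => //.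
      by rewrite ler_wpM2r ?invr_ge0 ?ler_nat // ltW.
    - by rewrite /psi ltn0.
    - by rewrite /a; case: ifP => [_|/negbT]; [exact: gge0|rewrite -ltnNge; exact: sqrt_gr].
    - have -> : gr (ceil3 (3 * M).+1) = 0 by rewrite -gM /ceil3; congr gr; lia.
      by rewrite /a; case: ifP => // _; exact: sqrtr_ge0.
  rewrite layer_ceil3 => h1.
  have : layer gr M (fun i => psi (3 * i)%N) <= layer gr M (fun i => phi (3 * (i%:R / s%:R))).
    apply: glayer_le => j _ _; rewrite /psi natrM mulrA; case: ifP => // _; apply: phi0.
    by rewrite -mulrA mulr_ge0.
  have p1 := phi0 1 ler01; have l0 : 0 <= layer gr M (fun i => phi (3 * (i%:R / s%:R))).
    by apply: layer_ge0 => j; apply: phi0; rewrite mulr_ge0.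
  move=> h2; apply: (@le_trans _ _ (2 * phi 1 + 2 * layer gr M (fun i => phi (3 * (i%:R / s%:R))))); last by lra.
  by rewrite lerD2l ler_wpM2l // (le_trans h1).
- move=> phi hphi phi0.
  have -> : E1 grid_p (fun g => phi `|grid_x g|) = layer gr M (fun j => phi (j%:R / s%:R)).
    have := E1_grid_abs phi (fun=> 1).
    rewrite (eq_E1 grid_p (F' := fun h => phi `|grid_x h|)) => [->|h]; last by rewrite mul1r.
    by congr layer; apply/funext => j; rewrite mul1r.
  have : layer gr M (fun j => phi (1 / 2) * (s' <= j)%N%:R) <= layer gr M (fun j => phi (j%:R / s%:R)).
    apply: glayer_le => j _ _; case: (leqP s' j) => sj; last by rewrite mulr0 phi0.
    rewrite mulr1; apply: hphi; first lra.
    rewrite ler_pdivlMr // /s natrM; have : s'%:R <= j%:R :> R by rewrite ler_nat.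
    lra.
  rewrite layerZ layer_from //; last by apply: leq_trans sM; rewrite /s; lia.
  have -> : gr s' = Gt (1 / 2).
    rewrite /gr (leq_trans _ sM) ?/s; last by lia.
    by congr Gt; rewrite /s natrM; field; rewrite pnatr_eq0 -lt0n.
  have := phi0 (1 / 2) _; have : expR (- 1) <= Gt (1 / 2) by case: HG => _ [_ [_ [_ []]]].
  move=> h1 h2; have {}h2 : 0 <= phi (1 / 2) by apply: h2; lra.
  have := expN1; nra.
Qed.
End GridLaw.

Section Jensen.
Variable R : realType.

Lemma cvx1_jensen (I : finType) (w z : I -> R) F : cvx1 F -> (forall i, 0 <= w i) ->
  \sum_i w i = 1 -> F (\sum_i w i * z i) <= \sum_i w i * F (z i).
Proof.
move=> cF w0 w1.
have H (r : seq I) : 0 < \sum_(i <- r) w i ->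
    F ((\sum_(i <- r) w i * z i) / \sum_(i <- r) w i) <= (\sum_(i <- r) w i * F (z i)) / \sum_(i <- r) w i.
  elim: r => [|i r IH]; first by rewrite big_nil ltxx.
  rewrite !big_cons; set W := \sum_(j <- r) w j.
  have W0 : 0 <= W by apply: sumr_ge0.
  have [Wz|Wn] := eqVneq W 0.
    have wz j : j \in r -> w j = 0.
      move=> jr; move/eqP: Wz; rewrite /W psumr_eq0 // => /allP/(_ j jr)/eqP; exact.
    rewrite [\sum_(j <- r) w j * z j]big_seq big1 => [|j /wz ->]; last by rewrite mul0r.
    rewrite [\sum_(j <- r) w j * F _]big_seq big1 => [|j /wz ->]; last by rewrite mul0r.
    rewrite Wz !addr0 => wp; by rewrite ![w i * _]mulrC !mulfK ?gt_eqF.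
  have Wp : 0 < W by rewrite lt_neqAle eq_sym Wn.
  move=> wW; set A := \sum_(j <- r) _; set B := \sum_(j <- r) w j * F (z j).
  have := cF (z i) (A / W) (w i / (w i + W)) _ _.
  have -> : w i / (w i + W) * z i + (1 - w i / (w i + W)) * (A / W) = (w i * z i + A) / (w i + W).
    by field; rewrite Wn gt_eqF.
  move=> h; apply: le_trans (h _ _) _.
  - by rewrite divr_ge0 // ltW.
  - by rewrite ler_pdivrMr // mul1r lerDl.
  have := IH Wp; rewrite -/A -/B -/W => h2.
  have -> : (w i * F (z i) + B) / (w i + W) = w i / (w i + W) * F (z i) + W / (w i + W) * (B / W).
    by field; rewrite Wn gt_eqF.
  have -> : 1 - w i / (w i + W) = W / (w i + W) by field; rewrite gt_eqF.
  by rewrite lerD2l ler_wpM2l // divr_ge0 // ltW.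
have := H (index_enum I); rewrite w1 !divr1; apply; exact: ltr01.
Qed.
(** [a] is the midpoint of [a + b] and [a - b], and [b] that of [a + b] and [- (a - b)]; by evenness
    the same two values of [H] appear. *)
Lemma midpoint_bound (H : R -> R) (a b : R) : (forall z, H (- z) = H z) ->
  (forall a b, H ((a + b) / 2) <= (H a + H b) / 2) ->
  H ((a + b) / 2) <= (H (a + b) + H (a - b)) / 2.
Proof.
move=> Hev Hhalf; have h1 := Hhalf a b.
have h2 := Hhalf (a + b) (a - b); have e2 : (a + b + (a - b)) / 2 = a by lra.
have h3 := Hhalf (a + b) (- (a - b)); have e3 : (a + b + - (a - b)) / 2 = b by lra.
rewrite e2 in h2; rewrite e3 Hev in h3; lra.
Qed.

Lemma half_dilate (y z k : R) : 2 * ((y + z) / k) = (4 * (y / k) + 4 * (z / k)) / 2.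
Proof. by rewrite mulrDl; lra. Qed.

Lemma half_regroup (x y z w : R) :
  ((x + y) / 2 + (z + w) / 2) / 2 = ((x + w) / 2 + (z + y) / 2) / 2.
Proof. lra. Qed.
End Jensen.

(** * Tilting a grid law *)

Section GridTilt.
Variables (R : realType) (Gt : R -> R).
Hypothesis HG : tail_spec Gt.
Variables (s' M : nat).
Hypothesis s'0 : (0 < s')%N.
Let s := (2 * s')%N.
Hypothesis sM : (s <= M)%N.
Local Notation gr := (gr Gt s' M).
Local Notation grid_x := (@grid_x R s' M).
Local Notation grid_p := (@grid_p R Gt s' M).
Local Notation grid_dom := (grid_dom Gt s' M).
Local Notation grid_cost := (grid_cost Gt).

Let s0 : 0 < s%:R :> R. Proof. by rewrite ltr0n /s muln_gt0. Qed.
Let s2 : 2 <= s%:R :> R. Proof. by rewrite (ler_nat _ 2) /s; lia. Qed.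
Let pos j : 0 <= j%:R / s%:R :> R. Proof. by rewrite divr_ge0. Qed.

Let g0 : gr 0 = 1. Proof. exact: gr0. Qed.
Let gM : gr M.+1 = 0. Proof. exact: grM. Qed.
Let gge0 j : 0 <= gr j. Proof. exact: gr_ge0. Qed.
Let gmono i j : (i <= j)%N -> gr j <= gr i. Proof. exact: gr_mono. Qed.
Let gadd i j : gr (i + j) <= gr i * gr j. Proof. exact: gr_add. Qed.

Section Fixed.
Variable u : nat.
Hypothesis uM : (u <= M)%N.
Hypothesis gu : 0 < gr u.

Let Lr phi := layer gr M (fun j => (u <= j)%N%:R / gr u * phi j).

Lemma shifted_cst k : layer gr M (fun j => (u <= j)%N%:R / gr u * k) = k.
Proof.
have -> : (fun j => (u <= j)%N%:R / gr u * k) = (fun j => k / gr u * (u <= j)%N%:R).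
  by apply/funext => j; rewrite [LHS]mulrC -[RHS]mulrA [X in _ = _ * X]mulrC.
by rewrite layerZ layer_from // divfK // gt_eqF.
Qed.

Lemma shifted_le phi psi : (forall j, (u <= j)%N -> phi j <= psi j) -> Lr phi <= Lr psi.
Proof.
move=> h; apply: layer_le => [j _|j _ _]; first exact: gmono.
case: (leqP u j) => uj; last by rewrite !mul0r.
by rewrite ler_wpM2l ?h // divr_ge0 ?ltW.
Qed.

(** [gr (u + i) / gr u <= gr i]: conditioned to be at least [u], the index is stochastically below
    [u] plus an unconditioned copy. *)
Lemma tail_shift phi : (forall i j, (i <= j)%N -> phi i <= phi j) ->
  Lr phi <= layer gr M (fun i => phi (u + i)%N).
Proof.
move=> hphi; pose psi j := phi j - phi u.
have e1 : Lr phi = Lr psi + phi u.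
  rewrite -[X in _ + X]shifted_cst -layerD; congr layer; apply/funext => j; rewrite /psi; ring.
have e2 : layer gr M (fun i => phi (u + i)%N) = layer gr M (fun i => psi (u + i)%N) + phi u.
  rewrite -[X in _ + X](layer_cst (phi u) g0 gM) -layerD; congr layer; apply/funext => j; rewrite /psi; ring.
rewrite e1 e2 lerD2r.
have -> : Lr psi = layer (fun i => gr (u + i) / gr u) M (fun i => psi (u + i)%N).
  rewrite /Lr -(@layer_extend _ gr M (u + M)) ?leq_addl // => [|j jM]; last first.
    by apply/eqP; rewrite eq_le gge0 andbT -gM gmono.
  rewrite /layer; have -> : ((u + M).+1 = u + M.+1)%N by rewrite addnS.
  rewrite big_split_ord /= big1 ?add0r => [|i _]; last by rewrite leqNgt ltn_ord !mul0r mulr0.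
  apply: eq_bigr => i _; rewrite /= leq_addr addnS /= mulr1n; by field; rewrite gt_eqF.
apply: layer_mono => [i j ij||j _|].
- by rewrite /psi lerD2r hphi // leq_add2l.
- by rewrite /psi addn0 subrr.
- by rewrite ler_pdivrMr // mulrC gadd.
- by rewrite gM divr_ge0 // ltW.
Qed.
End Fixed.

(** The density conditions on [|x| >= u / s] and biases the sign by [del]. Conditioning supplies the
    magnitude when [|t| > 1], and the bias adjusts the mean to [t / 6] exactly. *)
Lemma grid_tilt : tiltable grid_p grid_x grid_dom grid_cost.
Proof.
move=> t dt.
have HL := grid_law HG s'0 sM.
have [u [uM [gu [ut [um gG]]]]] : exists u : nat, (u <= M)%N /\ 0 < gr u /\ u%:R / s%:R <= `|t| /\
   (if `|t| <= 1 then u = 0%N else `|t| / 2 <= u%:R / s%:R) /\ (1 < `|t| -> 0 < Gt `|t| /\ Gt `|t| <= gr u).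
  case: (leP `|t| 1) => t1.
    exists 0%N; split=> //; split; first by rewrite g0.
    by split; [rewrite mul0r|split].
  have [|[tM Gp]] := dt; first by rewrite leNgt t1.
  have ts : 0 <= `|t| * s%:R by rewrite mulr_ge0 // ltW.
  have /andP[h1 h2] := truncn_itv ts; exists (Num.truncn (`|t| * s%:R)).
  have uM : (Num.truncn (`|t| * s%:R) <= M)%N.
    rewrite -(ler_nat R); apply: le_trans h1 _.
    by rewrite -ler_pdivlMr.
  have ut : (Num.truncn (`|t| * s%:R))%:R / s%:R <= `|t| by rewrite ler_pdivrMr.
  have Gg : Gt `|t| <= gr (Num.truncn (`|t| * s%:R)).
    by rewrite /gr uM; case: HG => _ [_ [h _]]; apply: h.
  split=> //; split; first exact: lt_le_trans Gp Gg.
  split=> //; split=> //; rewrite ler_pdivlMr //.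
  have : 1 * 2 <= `|t| * s%:R by apply: ler_pM => //; exact: ltW.
  rewrite -natr1 in h2; lra.
pose m := layer gr M (fun j => (u <= j)%N%:R / gr u * (j%:R / s%:R)).
(* Origin of the 6: for [|t| <= 1] the last clause of [law] gives [E |x| >= 1 / 6]. For [|t| > 1],
   rounding [|t|] down to the grid keeps at least half of it. *)
have m16 : `|t| / 6 <= m /\ 1 / 6 <= m /\ (1 < `|t| -> `|t| / 2 <= m).
  case: (leP `|t| 1) => t1.
    have u0 : u = 0%N by move: um; rewrite t1.
    have mE : m = E1 grid_p (fun g => `|grid_x g|).
      have := @E1_grid_abs R Gt s' M id (fun=> 1).
      rewrite (eq_E1 grid_p (F' := fun h => `|grid_x h|)) => [->|h]; last by rewrite mul1r.
      rewrite /m u0; congr layer; apply/funext => j; by rewrite leq0n g0 divr1.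
    have : 1 / 2 <= 3 * m.
      rewrite mE; case: HL => _ [_ [_ [_ [_ h]]]]; exact: (h id).
    by move=> h; split; [lra|split; [lra|done]].
  have um' : `|t| / 2 <= u%:R / s%:R by move: um; rewrite leNgt t1.
  have h : u%:R / s%:R <= m.
    rewrite -(shifted_cst uM gu (u%:R / s%:R)); apply: shifted_le => // j uj.
    by rewrite ler_wpM2r ?invr_ge0 ?ler_nat // ltW.
  by split; [lra|split; [lra|move=> _; lra]].
have [mt [m6 mb]] := m16; have mp : 0 < m by lra.
pose del := t / 6 / m.
have del1 : `|del| <= 1.
  by rewrite /del normrM normfV (gtr0_norm mp) ler_pdivrMr // mul1r normrM (ger0_norm (x := 6^-1)).
pose sg (b : bool) : R := if b then 1 else - 1.
pose d (h : gridT M) : R := (u <= h.1)%N%:R / gr u * (1 + del * sg h.2).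
have /andP[dl du] : - 1 <= del <= 1 by rewrite -ler_norml.
have d0 h : 0 <= d h.
  rewrite /d; apply: mulr_ge0; first by rewrite divr_ge0 // (ltW gu).
  by rewrite /sg; case: (h.2); rewrite ?mulr1 ?mulrN1; lra.
have Ed F : E1 grid_p (fun g => d g * F (grid_x g)) =
   layer gr M (fun j => (u <= j)%N%:R / gr u * (((1 + del) * F (j%:R / s%:R) + (1 - del) * F (- (j%:R / s%:R))) / 2)).
  rewrite E1_grid; apply: eq_bigr => j _; congr (_ * _).
  by rewrite /d /grid_x /sg /= inordK // !mul1r !mulN1r; lra.
have Ed1 : E1 grid_p d = 1.
  rewrite -[RHS](shifted_cst uM gu 1); have := Ed (fun=> 1).
  rewrite (eq_E1 grid_p (F' := d)) => [->|h]; last by rewrite mulr1.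
  by congr layer; apply/funext => j; congr (_ * _); lra.
have mu : E1 grid_p (fun g => d g * grid_x g) = t / 6.
  have -> : t / 6 = del * m by rewrite /del divfK // gt_eqF.
  rewrite (Ed id) -layerZ; congr layer; apply/funext => j /=.
  by move: (_ / gr u) (_ / s%:R) => a b; field.
exists d, (u%:R / s%:R); split=> //; split=> //; split=> //; split.
  have -> : E1 grid_p (fun g => d g ^+ 2) = (1 + del ^+ 2) / gr u.
    rewrite E1_grid -(shifted_cst uM gu ((1 + del ^+ 2) / gr u)); apply: eq_bigr => j _; congr (_ * _).
    rewrite /d /sg /= inordK //; case: (leqP u j) => _ /=; last by rewrite !mul0r; lra.
    by rewrite mulr1n; field; rewrite gt_eqF.
  case: (leP `|t| 1) => t1.
    have u0 : u = 0%N by move: um; rewrite t1.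
    rewrite u0 g0 divr1 /grid_cost t1; apply: le_trans (expR_ge1Dx _); rewrite lerD2l.
    have -> : del ^+ 2 = t ^+ 2 / (36 * m ^+ 2) by rewrite /del; field; rewrite gt_eqF.
    rewrite ler_pdivrMr; last by rewrite mulr_gt0 ?exprn_gt0.
    have : 1 <= 36 * m ^+ 2 by nra.
    have := sqr_ge0 t; nra.
  have [Gp Gg] := gG t1.
  rewrite /grid_cost (leNgt `|t| 1) t1 /=.
  have N1 : 1 <= - ln (Gt `|t|).
    have : `|t| <= - ln (Gt `|t|) by case: HG => _ [_ [_ [_ [h _]]]]; exact: h.
    lra.
  (* One exponential factor pays for the conditioning, the other for [1 + del^2 <= 2], since the
     cost is at least 1. *)
  have -> : expR (2 * - ln (Gt `|t|)) = expR (- ln (Gt `|t|)) * (Gt `|t|)^-1.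
    have -> : 2 * - ln (Gt `|t|) = - ln (Gt `|t|) - ln (Gt `|t|) by lra.
    by rewrite expRD [X in _ * X]expRN lnK // posrE.
  apply: ler_pM; rewrite ?invr_ge0 ?(ltW gu) //; last by rewrite lef_pV2 ?posrE.
    by rewrite addr_ge0 // sqr_ge0.
  apply: le_trans (expR_ge1Dx _); nra.
split; first by rewrite ger0_norm.
(* Symmetrization about the mean: [H] is even and convex, hence nondecreasing on the half-line, and
   functions of [|x|] do not see the sign bias. *)
move=> F cF; pose mm := t / 6; pose H z := (F (mm + z) + F (mm - z)) / 2.
have Hev z : H (- z) = H z by rewrite /H opprK addrC.
have Hc : cvx1 H.
  move=> a b l l0 l1; have := cF (mm + a) (mm + b) l l0 l1; have := cF (mm - a) (mm - b) l l0 l1.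
  have -> : l * (mm - a) + (1 - l) * (mm - b) = mm - (l * a + (1 - l) * b) by ring.
  have -> : l * (mm + a) + (1 - l) * (mm + b) = mm + (l * a + (1 - l) * b) by ring.
  rewrite /H; lra.
have Hhalf a b : H ((a + b) / 2) <= (H a + H b) / 2.
  have -> : (a + b) / 2 = 1 / 2 * a + (1 - 1 / 2) * b by lra.
  by apply: le_trans (Hc _ _ _ _ _) _; lra.
have Hmono a b : 0 <= a -> a <= b -> H a <= H b.
  rewrite le_eqVlt => /orP[/eqP<-|a0] ab.
    have := Hhalf b (- b); rewrite subrr mul0r Hev; lra.
  have b0 : 0 < b by apply: lt_le_trans ab.
  pose l := (a / b + 1) / 2.
  have ab1 : a / b <= 1 by rewrite ler_pdivrMr // mul1r.
  have ab0 : 0 <= a / b by rewrite divr_ge0 ?ltW.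
  have := Hc b (- b) l _ _; have -> : l * b + (1 - l) * - b = a by rewrite /l; field; rewrite gt_eqF.
  by rewrite Hev => h; apply: le_trans (h _ _) _; rewrite /l; lra.
pose w g := grid_p g * d g.
have w0 g : 0 <= w g by rewrite mulr_ge0 //; case: HL.
have w1 : \sum_g w g = 1 by rewrite -Ed1.
have wm : \sum_g w g * grid_x g = mm.
  by rewrite /mm -mu /E1; apply: eq_bigr => g _; rewrite /w mulrA.
have Ew K : E1 grid_p (fun g => d g * K g) = E1 w K by apply: eq_bigr => g _; rewrite /w mulrA.
have Ew1 k : E1 w (fun=> k) = k by rewrite E1_cst.
(* Jensen against an independent copy [x'] gives [F (mm + x - x')]; exchanging the copies turns [F]
   into [H], and midpoint convexity with evenness splits [x - x'] into [2 x] and [2 x']. *)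
have st1 : E1 w (fun g => F (grid_x g)) <= E1 w (fun g => H (2 * grid_x g)).
  apply: (@le_trans _ _ (E1 w (fun g => E1 w (fun g' => F (mm + (grid_x g - grid_x g')))))).
    apply: E1_le => // g _; have := cvx1_jensen (fun g' => mm + (grid_x g - grid_x g')) cF w0 w1.
    have -> : \sum_i w i * (mm + (grid_x g - grid_x i)) = grid_x g.
      have -> : \sum_i w i * (mm + (grid_x g - grid_x i)) = E1 w (fun i => (mm + grid_x g) + (- 1) * grid_x i).
        by apply: eq_bigr => i _; ring.
      by rewrite E1D Ew1 E1Z /E1 wm; ring.
    by [].
  set L := E1 w _; have L2 : L = E1 w (fun g => E1 w (fun g' => F (mm - (grid_x g - grid_x g')))).
    rewrite E1_swap /L; apply: eq_E1 => g; apply: eq_E1 => g'; by rewrite opprB.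
  have -> : L = E1 w (fun g => E1 w (fun g' => H (grid_x g - grid_x g'))).
    have -> : L = 1 / 2 * L + 1 / 2 * L by lra.
    rewrite {2}L2 /L -!E1Z -E1D; apply: eq_E1 => g; rewrite -!E1Z -E1D; apply: eq_E1 => g'.
    by rewrite /H; lra.
  apply: (@le_trans _ _ (E1 w (fun g => E1 w (fun g' => 1 / 2 * H (2 * grid_x g) + 1 / 2 * H (2 * grid_x g'))))).
    apply: E1_le => // g _; apply: E1_le => // g' _.
    have := Hhalf (2 * grid_x g) (- (2 * grid_x g')); rewrite Hev.
    have -> : (2 * grid_x g - 2 * grid_x g') / 2 = grid_x g - grid_x g' by lra.
    lra.
  rewrite le_eqVlt; apply/orP; left; apply/eqP.
  set N := E1 w (fun g => H (2 * grid_x g)).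
  transitivity (E1 w (fun g => 1 / 2 * H (2 * grid_x g) + 1 / 2 * N)).
    by apply: eq_E1 => g; rewrite E1D Ew1 E1Z.
  by rewrite E1D E1Z Ew1 -/N; lra.
rewrite Ew; apply: le_trans st1 _; rewrite -Ew (Ed (fun z => H (2 * z))).
have -> : layer gr M (fun j => (u <= j)%N%:R / gr u * (((1 + del) * H (2 * (j%:R / s%:R)) + (1 - del) * H (2 * - (j%:R / s%:R))) / 2)) =
  layer gr M (fun j => (u <= j)%N%:R / gr u * H (2 * (j%:R / s%:R))).
  by congr layer; apply/funext => j; rewrite mulrN Hev; congr (_ * _); lra.
apply: le_trans (tail_shift uM gu (phi := fun j => H (2 * (j%:R / s%:R))) _) _.
  move=> i j ij; apply: Hmono; first exact: mulr_ge0 (ler0n _ _) (pos i).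
  apply: ler_wpM2l; first exact: ler0n.
  by apply: ler_wpM2r; [rewrite invr_ge0 (ltW s0)|rewrite ler_nat].
rewrite E1_grid; apply: layer_le => [j _|j jM _]; first exact: gmono.
rewrite /grid_x /= inordK ?ltnS //.
rewrite !mul1r !mulN1r natrD -/mm (mulrN 4 (j%:R / _)).
rewrite half_dilate; move: (4 * (u%:R / _)) (4 * (j%:R / _)) => a b.
have -> : mm + a + b = mm + (a + b) by rewrite addrA.
have -> : mm - a + b = mm - (a - b) by rewrite opprB addrAC addrA.
have -> : mm + a - b = mm + (a - b) by rewrite addrA.
have -> : mm - a - b = mm - (a + b) by rewrite opprD addrA.
apply: le_trans (midpoint_bound _ _ Hev Hhalf) _; rewrite /H.
by rewrite half_regroup.
Qed.

Lemma grid_good : good grid_p grid_x (grid_cost \o grid_x) grid_dom grid_cost.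
Proof.
split; first exact: grid_law.
split; first exact: grid_cost_spec.
split; first exact: grid_adapted.
exact: grid_tilt.
Qed.
End GridTilt.

(** * Rounding the random variables *)

Section Tails.
Context {R : realType} {d : measure_display} {Om : measurableType d} (P : probability Om R).

Definition Gt (Z : Om -> R) (t : R) : R := fine (P [set w | t <= `|Z w|]).

Lemma measurable_tail (Z : Om -> R) (t : R) : measurable_fun setT Z -> measurable [set w | t <= `|Z w|].
Proof.
move=> mZ; have mN : measurable_fun setT (fun w => `|Z w|) by exact: measurableT_comp.
rewrite -[X in measurable X]setTI.
have -> : [set w | t <= `|Z w|] = (fun w => `|Z w|) @^-1` `[t, +oo[%classic.
  by apply/seteqP; split=> w /=; rewrite in_itv /= andbT.
exact: mN.
Qed.

Section TailSpec.
Variable Z : Om -> R.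
Hypothesis mZ : measurable_fun setT Z.
Hypothesis lZ : logconcave_tails P Z.
Hypothesis nZ : normalized_tail P Z.

Let PG t : P [set w | t <= `|Z w|] = (Gt Z t)%:E.
Proof. by rewrite fineK // fin_num_measure //; exact: measurable_tail. Qed.

Let G_mono u v : u <= v -> Gt Z v <= Gt Z u.
Proof.
move=> uv; rewrite -lee_fin -!PG; apply: le_measure; rewrite ?inE; do ?exact: measurable_tail.
by move=> w /= h; exact: le_trans uv h.
Qed.

Let G0 : Gt Z 0 = 1.
Proof.
rewrite /Gt (_ : [set w | _] = setT) ?probability_setT //.
by apply/seteqP; split=> w //= _.
Qed.

Let G_ge0 t : 0 <= Gt Z t. Proof. by rewrite -lee_fin -PG. Qed.

Lemma NtailE t : 0 < Gt Z t -> Ntail P Z t = (- ln (Gt Z t))%:E.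
Proof. by move=> G0'; rewrite /Ntail PG eqe gt_eqF. Qed.

Let NtailE0 t : Gt Z t = 0 -> Ntail P Z t = +oo%E.
Proof. by move=> G0'; rewrite /Ntail PG G0' eqxx. Qed.

Let Ntail_mono u v : u <= v -> (Ntail P Z u <= Ntail P Z v)%E.
Proof.
move=> uv; have := G_mono uv; case: (leP (Gt Z v) 0) => [v0 _|v0 h].
  by rewrite (@NtailE0 v) ?leey //; apply/eqP; rewrite eq_le v0 G_ge0.
have u0 : 0 < Gt Z u by apply: lt_le_trans h.
by rewrite !NtailE // lee_fin lerN2 ler_ln.
Qed.

Lemma tail_spec_Gt : tail_spec (Gt Z).
Proof.
have shrink (k t : R) : 0 <= t -> 0 <= k -> k <= 1 -> 0 < Gt Z t -> - ln (Gt Z (k * t)) <= k * - ln (Gt Z t).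
  move=> t0; rewrite le_eqVlt => /orP[/eqP<- _ _|k0]; first by rewrite mul0r G0 ln1 oppr0 mul0r.
  rewrite le_eqVlt => /orP[/eqP->|k1 Gp]; first by rewrite !mul1r.
  have := lZ t0 (lexx 0) (l := k); rewrite k0 k1 => /(_ isT).
  rewrite mulr0 addr0 (NtailE Gp) [Ntail P Z 0]NtailE ?G0 // ln1 oppr0 mule0 adde0.
  case: (leP (Gt Z (k * t)) 0) => [z|kp].
    by rewrite NtailE0 //; apply/eqP; rewrite eq_le z G_ge0.
  by rewrite NtailE // -EFinM lee_fin.
pose A := [set t : R | 0 <= t /\ (1 <= Ntail P Z t)%E].
have one (u : R) : 1 < u -> (1 <= Ntail P Z u)%E.
  move=> u1; have : (ereal_inf (EFin @` A) < u%:E)%E.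
    by rewrite [X in (X < _)%E]nZ lte_fin.
  move=> /ereal_inf_lt[_ [t [t0 Nt] <-]]; rewrite lte_fin => tu.
  by apply: le_trans Nt (Ntail_mono (ltW tu)).
split; first exact: G0.
split; first by move=> t _; exact: G_ge0.
split; first by move=> u v _; exact: G_mono.
split; first exact: shrink.
split.
(* If [N = - ln (Gt Z t) < t], the point [u = (1 + t / N) / 2] lies between 1 and [t] and its cost
   is at most [u N / t < 1], against the normalization, which gives cost at least 1 beyond 1. *)
- move=> t t1 Gp; rewrite leNgt; apply/negP => Nt.
  have N1 : 1 <= - ln (Gt Z t) by have := one t t1; rewrite NtailE // lee_fin.
  have tp : 0 < t by lra.
  set N := - ln (Gt Z t) in Nt N1 *.
  have Np : 0 < N by lra.
  pose u := (1 + t / N) / 2.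
  have tN : 1 < t / N by rewrite ltr_pdivlMr // mul1r.
  have u1 : 1 < u by rewrite /u; lra.
  have ut : u <= t.
    have : t / N <= t by rewrite ler_pdivrMr // ler_peMr // ltW.
    rewrite /u; lra.
  have Gu : 0 < Gt Z u by apply: lt_le_trans Gp (G_mono ut).
  have := one u u1; rewrite NtailE // lee_fin => h1.
  have h2 := shrink (u / t) t (ltW tp) _ _ Gp; rewrite divfK ?gt_eqF // -/N in h2.
  have {}h2 : - ln (Gt Z u) <= u / t * N.
    apply: h2; first by apply: divr_ge0; apply: ltW => //; apply: lt_trans u1.
    by rewrite ler_pdivrMr // mul1r.
  have : u * N < t.
    rewrite /u mulrAC ltr_pdivrMr // mulrDl divfK ?gt_eqF // mul1r; lra.
  rewrite mulrAC in h2; have : 1 <= u * N / t by lra.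
  by rewrite ler_pdivlMr // mul1r leNgt => /negP.
- case: (ltP (Ntail P Z (1 / 2)) 1%:E) => [|h].
    case: (leP (Gt Z (1 / 2)) 0) => [z|kp].
      by rewrite NtailE0 //; apply/eqP; rewrite eq_le z G_ge0.
    rewrite NtailE // lte_fin => h; rewrite -[leRHS]lnK ?posrE // ler_expR; lra.
  have : (ereal_inf (EFin @` A) <= (1 / 2)%:E)%E.
    by apply: ereal_inf_lbound; exists (1 / 2) => //; split=> //; lra.
  rewrite [X in (X <= _)%E]nZ lee_fin; lra.
Qed.

Lemma Nhat_grid s' M t : (0 < s')%N -> grid_dom (Gt Z) s' M t -> Nhat P Z t = (grid_cost (Gt Z) t)%:E.
Proof.
move=> s0 dt; rewrite /Nhat /grid_cost; case: (leP `|t| 1) => // t1.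
by have [|[_ Gp]] := dt; [rewrite leNgt t1|rewrite NtailE].
Qed.
End TailSpec.

Section FiniteValued.
Variables (W : finType) (Z : Om -> W).
Hypothesis mZ : forall h, measurable [set w | Z w = h].

Lemma finite_valuedE (Phi : W -> R) (w : Om) :
  (Phi (Z w))%:E = (\sum_(h : W) (Phi h)%:E * (\1_([set w | Z w = h] : set Om) w)%:E)%E.
Proof.
rewrite (bigD1 (Z w)) //= big1 => [|h hZ].
  by rewrite indicE mem_set //= mule1 adde0.
by rewrite indicE memNset ?mule0 //= => e; rewrite e eqxx in hZ.
Qed.

Lemma measurable_finite_valued (Phi : W -> R) : measurable_fun setT (fun w : Om => Phi (Z w)).
Proof.
apply/measurable_EFinP; rewrite /comp; under eq_fun do rewrite finite_valuedE.
apply: emeasurable_sum => h.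
apply: measurable_funeM; apply/measurable_EFinP; exact: measurable_indic.
Qed.

Lemma integral_finite_valued (Phi : W -> R) : (forall h, 0 <= Phi h) ->
  (\int[P]_w (Phi (Z w))%:E = (\sum_h Phi h * fine (P [set w | Z w = h]))%:E)%E.
Proof.
move=> Phi0; under eq_integral do rewrite finite_valuedE.
rewrite ge0_integral_sum //; last first.
- by move=> h w _; rewrite mule_ge0 // lee_fin.
- by move=> h; apply: measurable_funeM; apply/measurable_EFinP; exact: measurable_indic.
rewrite -sumEFin; apply: eq_bigr => h _.
rewrite ge0_integralZl //; last by rewrite lee_fin.
  by rewrite integral_indic // setIT EFinM fineK // fin_num_measure.
by apply/measurable_EFinP; exact: measurable_indic.
Qed.
End FiniteValued.
End Tails.

Section Cells.
Variables (R : realType) (s' M : nat).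
Hypothesis s'0 : (0 < s')%N.
Let s := (2 * s')%N.

Definition cell_idx (x : R) : nat := minn (Num.truncn (`|x| * s%:R)) M.
(* the sign bit of the zero cell is always [true] *)
Definition cell (x : R) : gridT M := (inord (cell_idx x), (cell_idx x == 0%N) || (0 <= x)).

Let s0 : 0 < s%:R :> R. Proof. by rewrite ltr0n /s muln_gt0. Qed.

(** Rounding toward zero turns events on the index into tail events of [|x|]. The rounded law
    therefore keeps the original tail values at grid points, and with them the tail properties. *)
Lemma cell_idx_ge j x : (j <= cell_idx x)%N = (j <= M)%N && (j%:R / s%:R <= `|x|).
Proof.
by rewrite /cell_idx leq_min truncn_ge_nat ?mulr_ge0 // ler_pdivrMr // andbC.
Qed.

Lemma cell_fst x : (cell x).1 = cell_idx x :> nat.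
Proof. by rewrite /cell /= inordK // ltnS /cell_idx geq_minr. Qed.

Lemma cellE x (h : gridT M) : cell x = h <->
  cell_idx x = h.1 /\ (if h.1 == 0 :> nat then h.2 : Prop else h.2 = (0 <= x)).
Proof.
split=> [<-|]; first by rewrite cell_fst; split=> //=; case: (cell_idx x == 0%N).
case: h => i b /= [e h]; rewrite /cell e inord_val; congr (_, _).
by move: h; case: (i == 0 :> nat) => //= ->.
Qed.

Lemma cell_idxN x : cell_idx (- x) = cell_idx x. Proof. by rewrite /cell_idx normrN. Qed.

Lemma cellN x (i : 'I_M.+1) b : i != 0 :> nat -> (cell (- x) = (i, b)) <-> (cell x = (i, ~~ b)).
Proof.
move=> i0; rewrite !cellE /= cell_idxN (negbTE i0).
split=> -[e h]; split=> //; have : x != 0.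
- by apply/eqP => x0; move: i0; rewrite -e /cell_idx x0 normr0 mul0r truncn0 min0n.
- by rewrite h oppr_ge0; case: ltgtP.
- by apply/eqP => x0; move: i0; rewrite -e /cell_idx x0 normr0 mul0r truncn0 min0n.
- by rewrite oppr_ge0; move: h; case: b; case: ltgtP.
Qed.

Definition rnd (x : R) : R := grid_x R s' (cell x).

Lemma rndE x : rnd x = (if 0 <= x then 1 else - 1) * ((cell_idx x)%:R / s%:R).
Proof.
rewrite /rnd /grid_x cell_fst -/s /=.
by case: eqP => [->|] //=; rewrite mul0r !mulr0.
Qed.

Lemma rnd_abs x : `|x - rnd x| <= `|x|.
Proof.
have : (cell_idx x)%:R / s%:R <= `|x| by have := leqnn (cell_idx x); rewrite cell_idx_ge => /andP[].
have : 0 <= (cell_idx x)%:R / s%:R :> R by rewrite divr_ge0.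
rewrite rndE; set u := _ / _; move: u => u.
case: (leP 0 x) => x0; rewrite ?(ger0_norm x0) ?(ltr0_norm x0) => u0 ux; rewrite ler_norml; lra.
Qed.

Lemma rnd_abs_le x : `|rnd x| <= `|x|.
Proof.
have : (cell_idx x)%:R / s%:R <= `|x| by have := leqnn (cell_idx x); rewrite cell_idx_ge => /andP[].
have u0 : 0 <= (cell_idx x)%:R / s%:R :> R by rewrite divr_ge0.
by rewrite rndE normrM (ger0_norm u0); case: ifP; rewrite ?normrN normr1 mul1r.
Qed.

Lemma rnd_near x : `|x| <= M%:R / s%:R -> `|x - rnd x| <= 1 / s%:R.
Proof.
rewrite ler_pdivlMr // => xM.
have x0 : 0 <= `|x| * s%:R by rewrite mulr_ge0.
have /andP[t1 t2] := truncn_itv x0.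
have e : cell_idx x = Num.truncn (`|x| * s%:R).
  by apply/minn_idPl; rewrite -(ler_nat R); apply: le_trans xM.
rewrite rndE e; move: t1 t2; set k := Num.truncn _ => t1 t2.
have {}t1 : k%:R / s%:R <= `|x| by rewrite ler_pdivrMr.
have {}t2 : `|x| <= k%:R / s%:R + 1 / s%:R.
  by rewrite -mulrDl ler_pdivlMr // natr1 ltW.
move: t1 t2; set u := k%:R / _; set v := 1 / _; move: u v => u v.
case: (leP 0 x) => x1; rewrite ?(ger0_norm x1) ?(ltr0_norm x1) => t1 t2; rewrite ler_norml; lra.
Qed.

Lemma measurable_idx_ge j : measurable [set x : R | (j <= cell_idx x)%N].
Proof.
have -> : [set x : R | (j <= cell_idx x)%N] = if (j <= M)%N then [set x : R | j%:R / s%:R <= `|x|] else set0.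
  by apply/seteqP; split=> x /=; rewrite cell_idx_ge; case: (j <= M)%N.
case: ifP => // _; exact: (measurable_tail (Z := id)).
Qed.

Lemma measurable_cell h : measurable [set x : R | cell x = h].
Proof.
have mI : measurable [set x : R | cell_idx x = h.1].
  have -> : [set x : R | cell_idx x = h.1] =
      [set x : R | (h.1 <= cell_idx x)%N] `\` [set x : R | (h.1.+1 <= cell_idx x)%N].
    apply/seteqP; split=> x /=; first by move=> ->; rewrite leqnn ltnn.
    by move=> [h1 /negP h2]; apply/eqP; rewrite eqn_leq h1 leqNgt h2.
  by apply: measurableD; exact: measurable_idx_ge.
have mS : measurable [set x : R | if h.1 == 0 :> nat then h.2 : Prop else h.2 = (0 <= x)].
  case: (h.1 == 0 :> nat).
    case: (h.2); first by have -> : [set x : R | true] = setT by apply/seteqP; split.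
    by have -> : [set x : R | false] = set0 by apply/seteqP; split.
  case: (h.2).
    have -> : [set x : R | true = (0 <= x)] = `[0, +oo[%classic.
      by apply/seteqP; split=> x /=; rewrite in_itv /= andbT => // ->.
    exact: measurable_itv.
  have -> : [set x : R | false = (0 <= x)] = `]-oo, 0[%classic.
    by apply/seteqP; split=> x /=; rewrite in_itv /=; case: ltP.
  exact: measurable_itv.
have -> : [set x : R | cell x = h] = [set x : R | cell_idx x = h.1] `&`
    [set x : R | if h.1 == 0 :> nat then h.2 : Prop else h.2 = (0 <= x)].
  by apply/seteqP; split=> x /=; rewrite cellE.
exact: measurableI.
Qed.

Section Law.
Context {d : measure_display} {Om : measurableType d} (P : probability Om R).
Variable Z : Om -> R.
Hypothesis mZ : measurable_fun setT Z.
Hypothesis sZ : symmetric_rv P Z.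

Definition cell_p (h : gridT M) : R := fine (P (Z @^-1` [set x | cell x = h])).
(** The grid law splits the atom at 0 between two signs, while [cell] uses one. Merging them is
    harmless because both carry the value 0. *)
Definition collapse (h : gridT M) : gridT M := if h.1 == 0 :> nat then (h.1, true) else h.

Let pr A := fine (P A).

Let prU A B : measurable A -> measurable B -> A `&` B = set0 -> pr (A `|` B) = pr A + pr B.
Proof.
move=> mA mB AB; rewrite /pr measureU //.
by rewrite fineD // fin_num_measure.
Qed.

Let mZ' (B : set R) : measurable B -> measurable (Z @^-1` B).
Proof. by move=> mB; rewrite -[X in measurable X]setTI; exact: mZ. Qed.

Let pr_ge j : pr (Z @^-1` [set x | (j <= cell_idx x)%N]) = gr (Gt P Z) s' M j.
Proof.
rewrite /gr /Gt /pr; case: ifP => jM.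
  by congr (fine (P _)); apply/seteqP; split=> w /=; rewrite cell_idx_ge jM.
by rewrite (_ : _ @^-1` _ = set0) ?measure0 //; apply/seteqP; split=> w //=; rewrite cell_idx_ge jM.
Qed.

Lemma cell_p_sum (i : 'I_M.+1) : cell_p (i, true) + cell_p (i, false) =
  gr (Gt P Z) s' M i - gr (Gt P Z) s' M i.+1.
Proof.
have dj b b' : b != b' -> Z @^-1` [set x | cell x = (i, b)] `&` Z @^-1` [set x | cell x = (i, b')] = set0.
  by move=> bb; apply/seteqP; split=> w //= [-> [e]]; rewrite e eqxx in bb.
rewrite -!pr_ge /cell_p -!/(pr _) -prU ?dj //; do ?exact: mZ' (measurable_cell _).
apply/eqP; rewrite eq_sym subr_eq -prU.
- apply/eqP; congr pr; apply/seteqP; split=> w /=.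
    case: (ltnP i (cell_idx (Z w))) => h; first by right.
    move=> h'; left; have e : cell_idx (Z w) = i by apply/eqP; rewrite eqn_leq h h'.
    rewrite !cellE /= e; case: (i == 0 :> nat); first by left.
    by case: (0 <= Z w); [left|right].
  by case=> [[|]|/ltnW //]; rewrite cellE /= => -[->].
- by apply: measurableU; apply: mZ'; exact: measurable_cell.
- by apply: mZ'; exact: measurable_idx_ge.
- apply/seteqP; split=> w //= [[|] +]; rewrite cellE /= => -[->];
  by rewrite ltnn.
Qed.

Lemma cell_p0 : cell_p (ord0, false) = 0.
Proof.
rewrite /cell_p (_ : _ @^-1` _ = set0) ?measure0 //.
by apply/seteqP; split=> w //=; rewrite cellE /= => -[].
Qed.

Lemma cell_pN (i : 'I_M.+1) b : i != 0 :> nat -> cell_p (i, b) = cell_p (i, ~~ b).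
Proof.
move=> i0; rewrite /cell_p sZ; last exact: measurable_cell.
by congr (fine (P _)); apply/seteqP; split=> w /=; rewrite cellN.
Qed.

Lemma E1_collapse (F : gridT M -> R) :
  E1 (grid_p (Gt P Z) s' (M := M)) (fun h => F (collapse h)) = E1 cell_p F.
Proof.
rewrite E1_grid; rewrite /layer /E1.
transitivity (\sum_(j < M.+1) \sum_(b : bool) cell_p (j, b) * F (j, b)); last first.
  by rewrite pair_bigA; apply: eq_bigr => -[].
apply: eq_bigr => i _; rewrite big_bool -cell_p_sum inord_val /collapse /=.
case: eqP => [i0|/eqP i0].
  have -> : i = ord0 by apply: val_inj.
  by rewrite cell_p0 mul0r !addr0; field.
by rewrite (cell_pN false i0) /=; field.
Qed.
End Law.

Lemma grid_x_collapse h : grid_x R s' (collapse h) = grid_x R s' h.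
Proof. by rewrite /collapse; case: eqP => // e; rewrite /grid_x /= e mul0r !mulr0. Qed.
End Cells.

Section Rounding.
Context {R : realType} {d : measure_display} {Om : measurableType d} (P : probability Om R).
Variables (n : nat) (X Y : 'I_n -> Om -> R) (s' M : nat).
Hypothesis s'0 : (0 < s')%N.
Hypothesis mX : forall i, measurable_fun setT (X i).
Hypothesis mY : forall j, measurable_fun setT (Y j).
Hypothesis sX : forall i, symmetric_rv P (X i).
Hypothesis sY : forall j, symmetric_rv P (Y j).
Hypothesis ind : mutually_independent P
  (fun k : 'I_n + 'I_n => match k with inl i => X i | inr j => Y j end).

Definition rnd_vec (Z : 'I_n -> Om -> R) (w : Om) : 'I_n -> R := fun i => rnd s' M (Z i w).
Definition grid_ps (Z : 'I_n -> Om -> R) (i : 'I_n) : gridT M -> R := grid_p (Gt P (Z i)) s' (M := M).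
Definition grid_xs (i : 'I_n) : gridT M -> R := grid_x R s' (M := M).

Let cells (w : Om) : {ffun 'I_n -> gridT M} * {ffun 'I_n -> gridT M} :=
  ([ffun i => cell s' M (X i w)], [ffun j => cell s' M (Y j w)]).
Let vec (h : {ffun 'I_n -> gridT M}) : 'I_n -> R := fun i => grid_x R s' (h i).

Let cset (h : {ffun 'I_n -> gridT M} * {ffun 'I_n -> gridT M}) (k : 'I_n + 'I_n) : set R :=
  match k with inl i => [set x | cell s' M x = h.1 i] | inr j => [set x | cell s' M x = h.2 j] end.

Let cells_rect h : [set w | cells w = h] = [set w | forall k : 'I_n + 'I_n, cset h k
  (match k with inl i => X i | inr j => Y j end w)].
Proof.
apply/seteqP; split=> w /=.
  by move=> <- [i|j] /=; rewrite ffunE.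
case: h => h1 h2 /= H; congr (_, _); apply/ffunP => i; rewrite ffunE; first exact: (H (inl i)).
exact: (H (inr i)).
Qed.

Let mZ' (Z : Om -> R) (B : set R) : measurable_fun setT Z -> measurable B -> measurable (Z @^-1` B).
Proof. by move=> mZ mB; rewrite -[X in measurable X]setTI; exact: mZ. Qed.

Let mcells h : measurable [set w | cells w = h].
Proof.
have -> : [set w | cells w = h] =
  \bigcap_(i in [set: 'I_n]) (X i @^-1` [set x : R | cell s' M x = h.1 i]) `&`
  \bigcap_(i in [set: 'I_n]) (Y i @^-1` [set x : R | cell s' M x = h.2 i]).
  rewrite cells_rect; apply/seteqP; split=> w /=.
    by move=> H; split=> i _; [exact: (H (inl i))|exact: (H (inr i))].
  by move=> [H1 H2] [i|i]; [exact: H1|exact: H2].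
apply: measurableI; apply: fin_bigcap_measurable => [|i _]; do ?exact: finite_finset; apply: mZ' => //; exact: measurable_cell.
Qed.

Let P_cells h : fine (P [set w | cells w = h]) =
  pw (fun i => cell_p s' P (X i)) h.1 * pw (fun i => cell_p s' P (Y i)) h.2.
Proof.
rewrite cells_rect (ind (B := cset h)) => [|[i|j]]; [|exact: measurable_cell..].
by rewrite /= big_sumType.
Qed.

Let vecE w : rnd_vec X w = vec (cells w).1.
Proof. by apply/funext => i; rewrite /rnd_vec /vec ffunE. Qed.
Let vecE' w : rnd_vec Y w = vec (cells w).2.
Proof. by apply/funext => i; rewrite /rnd_vec /vec ffunE. Qed.

Lemma measurable_rnd (Phi : ('I_n -> R) -> ('I_n -> R) -> R) :
  measurable_fun setT (fun w => Phi (rnd_vec X w) (rnd_vec Y w)).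
Proof.
under eq_fun do rewrite vecE vecE'.
exact: (measurable_finite_valued mcells (fun h => Phi (vec h.1) (vec h.2))).
Qed.

Lemma integral_rnd (Phi : ('I_n -> R) -> ('I_n -> R) -> R) : (forall u v, 0 <= Phi u v) ->
  (\int[P]_w (Phi (rnd_vec X w) (rnd_vec Y w))%:E =
   (EX (grid_ps X) grid_xs (fun v => EX (grid_ps Y) grid_xs (Phi v)))%:E)%E.
Proof.
move=> Phi0; under eq_integral do rewrite vecE vecE'.
rewrite (integral_finite_valued P mcells (Phi := fun h => Phi (vec h.1) (vec h.2))) //.
congr (_%:E).
have coll (F : {ffun 'I_n -> gridT M} -> R) Z : (forall i, measurable_fun setT (Z i)) ->
    (forall i, symmetric_rv P (Z i)) ->
    E1 (pw (grid_ps Z)) (fun w : {ffun 'I_n -> gridT M} => F [ffun i => collapse (w i)]) =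
    E1 (pw (fun i => cell_p s' P (Z i))) F.
  by move=> mZ sZ; apply: E1_pw_map => i F'; apply: E1_collapse.
have vc (w : {ffun 'I_n -> gridT M}) : vec [ffun i => collapse (w i)] = (fun i => grid_xs i (w i)).
  by apply/funext => i; rewrite /vec ffunE grid_x_collapse.
transitivity (E1 (pw (fun i => cell_p s' P (X i))) (fun w => E1 (pw (fun i => cell_p s' P (Y i))) (fun w' => Phi (vec w) (vec w')))).
  transitivity (\sum_h1 \sum_h2 Phi (vec h1) (vec h2) * fine (P [set w | cells w = (h1, h2)])).
    by rewrite pair_bigA; apply: eq_bigr => -[].
  rewrite /E1.
  by apply: eq_bigr => h1 _; rewrite mulr_sumr; apply: eq_bigr => h2 _; rewrite P_cells /= mulrC mulrA.
rewrite -coll //; apply: eq_E1 => w; rewrite -coll //; apply: eq_E1 => w'.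
by rewrite !vc.
Qed.
End Rounding.

Section Levels.
Variable R : realType.

(** With mesh [1 / (2 (k + 1))] the grid reaches [k + 1]: the mesh shrinks while the range grows. *)
Definition mesh_top k := (2 * k.+1 * k.+1)%N.
Definition rd k (x : R) : R := rnd k.+1 (mesh_top k) x.

Lemma mesh_topE k : (mesh_top k)%:R / (2 * k.+1)%:R = k.+1%:R :> R.
Proof. by rewrite /mesh_top natrM mulrAC divff ?mul1r // pnatr_eq0. Qed.

Lemma rd_cvg x : rd k x @[k --> \oo] --> x.
Proof.
apply/cvgrPdist_lt => e e0; pose N := (Num.truncn (`|x| + e^-1)).+1.
have e10 : 0 < e^-1 by rewrite invr_gt0.
have Ne : `|x| + e^-1 < N%:R.
  by have := truncn_itv (addr_ge0 (normr_ge0 x) (ltW e10)) => /andP[].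
exists N => // k /= Nk.
have {}Nk : N%:R <= k.+1%:R :> R by rewrite ler_nat leqW.
have k0 : 0 < k.+1%:R :> R by rewrite ltr0n.
apply: (@le_lt_trans _ _ (1 / (2 * k.+1)%:R)).
  by apply: rnd_near => //; rewrite mesh_topE; have := normr_ge0 x; lra.
rewrite ltr_pdivrMr ?ltr0n // natrM.
have : e^-1 < k.+1%:R by have := normr_ge0 x; lra.
by rewrite -(ltr_pM2l e0) mulfV ?gt_eqF // => h; lra.
Qed.

Lemma measurable_rd k : measurable_fun setT (rd k : R -> R).
Proof.
apply: (@measurable_finite_valued R _ R _ (cell k.+1 (mesh_top k)) _ (@grid_x R k.+1 (mesh_top k))).
by move=> h; exact: measurable_cell.
Qed.

End Levels.

Section FatouBound.
Context {R : realType} {d : measure_display} {Om : measurableType d} (P : probability Om R).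

Lemma fatou_bound (f : nat -> Om -> R) (g : Om -> R) (c : R) N :
  (forall k, measurable_fun setT (f k)) -> (forall k w, 0 <= f k w) ->
  (forall w, f k w @[k --> \oo] --> g w) ->
  (forall k, (N <= k)%N -> (\int[P]_w (f k w)%:E <= c%:E)%E) ->
  (\int[P]_w (g w)%:E <= c%:E)%E.
Proof.
move=> mf f0 fg fc; pose h k w := (f (k + N)%N w)%:E.
have hg w : limn_einf (h ^~ w) = (g w)%:E.
  have : h ^~ w @ \oo --> (g w)%:E.
    apply: cvg_EFin; first by apply: nearW.
    by have := fg w; rewrite -(cvg_shiftn N).
  by move=> /cvg_limn_einf_sup[-> _].
under eq_integral do rewrite -hg.
apply: le_trans (fatou P measurableT _ _) _.
- by move=> k; apply/measurable_EFinP.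
- by move=> k w _; rewrite lee_fin.
rewrite limn_einf_lim; apply: lime_le; first exact: is_cvg_einfs.
apply: nearW => k; apply: (@le_trans _ _ (\int[P]_w h k w)%E); first by apply: ereal_inf_lbound; exists k => /=.
by rewrite fc // leq_addl.
Qed.
End FatouBound.

(** * From the finite model to general variables *)

Lemma cvg_fin_sum (R : realType) (I : finType) (f : I -> nat -> R) (l : I -> R) :
  (forall i, f i k @[k --> \oo] --> l i) -> (\sum_i f i k) @[k --> \oo] --> \sum_i l i.
Proof. by move=> h; apply: cvg_big => [|i _]; [exact: add_continuous|exact: h]. Qed.

Section NormingSet.
Variables (R : realType) (n : nat).
Implicit Types (b c : 'I_n -> 'I_n -> R) (u v : 'I_n -> R).

Definition pairing b c : R := \sum_i \sum_j b i j * c i j.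
Definition ten u v : 'I_n -> 'I_n -> R := fun i j => u i * v j.

(** The attainment in the last clause lets finitely many matrices of [B] reproduce the norm on a
    finite grid. *)
Definition norming (B : set ('I_n -> 'I_n -> R)) (nrm : ('I_n -> 'I_n -> R) -> R) : Prop :=
  B (fun _ _ => 0) /\ (forall b c, B b -> pairing b c <= nrm c) /\
  (forall c, exists b, B b /\ nrm c = pairing b c).

Variables (B : set ('I_n -> 'I_n -> R)) (nrm : ('I_n -> 'I_n -> R) -> R).
Hypothesis HB : norming B nrm.

Lemma norming_ge0 c : 0 <= nrm c.
Proof.
case: HB => b0 [h _]; apply: le_trans (h _ c b0).
by rewrite /pairing big1 // => i _; rewrite big1 // => j _; rewrite mul0r.
Qed.

(** Testing on plus and minus a unit matrix bounds the entry [(i, j)] of every matrix in [B]; it is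
    a Lipschitz constant of [nrm] in that entry. *)
Definition unit_norm (i j : 'I_n) : R :=
  nrm (fun k l => ((k == i) && (l == j))%:R) + nrm (fun k l => - ((k == i) && (l == j))%:R).

Lemma unit_norm_ge0 i j : 0 <= unit_norm i j.
Proof. by rewrite addr_ge0 ?norming_ge0. Qed.

Lemma norming_coef b i j : B b -> `|b i j| <= unit_norm i j.
Proof.
case: (HB) => _ [h _] Bb.
have e (s : R) (f : 'I_n -> 'I_n -> R) : (forall k l, f k l = s * ((k == i) && (l == j))%:R) ->
    pairing b f = s * b i j.
  move=> fE; rewrite /pairing (bigD1 i) //= [X in _ + X]big1 ?addr0 => [|k ki].
    rewrite (bigD1 j) //= big1 ?addr0 => [|l lj]; first by rewrite fE !eqxx mulr1 mulrC.
    by rewrite fE (negbTE lj) andbF !mulr0.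
  by rewrite big1 // => l _; rewrite fE (negbTE ki) !mulr0.
have h1 := h _ (fun k l => ((k == i) && (l == j))%:R) Bb.
have h2 := h _ (fun k l => - ((k == i) && (l == j))%:R) Bb.
have e1 := e 1 _ (fun k l => esym (mul1r _)); have e2 := e (- 1) _ (fun k l => esym (mulN1r _)).
rewrite e1 in h1; rewrite e2 in h2.
have := norming_ge0 (fun k l => ((k == i) && (l == j))%:R).
have := norming_ge0 (fun k l => - ((k == i) && (l == j))%:R).
by rewrite /unit_norm ler_norml; lra.
Qed.

Lemma norming_lip c c' : nrm c <= nrm c' + \sum_i \sum_j unit_norm i j * `|c i j - c' i j|.
Proof.
case: (HB) => _ [h1 h2]; have [b [Bb ->]] := h2 c.
apply: (@le_trans _ _ (pairing b c' + \sum_i \sum_j unit_norm i j * `|c i j - c' i j|)); last by rewrite lerD2r h1.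
rewrite -lerBlDl /pairing -sumrB; apply: ler_sum => i _; rewrite -sumrB; apply: ler_sum => j _.
rewrite -mulrBr; apply: le_trans (ler_norm _) _; rewrite normrM ler_wpM2r //; exact: norming_coef.
Qed.

Lemma norming_cvg (c : nat -> 'I_n -> 'I_n -> R) c' :
  (forall i j, c k i j @[k --> \oo] --> c' i j) -> nrm (c k) @[k --> \oo] --> nrm c'.
Proof.
move=> cc; have z : (\sum_i \sum_j unit_norm i j * `|c k i j - c' i j|) @[k --> \oo] --> (0 : R).
  have e0 : \sum_i \sum_j unit_norm i j * `|c' i j - c' i j| = 0.
    by rewrite big1 // => i _; rewrite big1 // => j _; rewrite subrr normr0 mulr0.
  rewrite -[X in _ --> X]e0.
  apply: cvg_fin_sum => i; apply: cvg_fin_sum => j; apply: cvgMl_tmp.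
  by apply: cvg_norm; apply: cvgB; [exact: cc|exact: cvg_cst].
apply/cvgrPdist_le => e e0; move/cvgrPdist_le : z => /(_ e e0).
apply: filterS => k; rewrite sub0r normrN => h.
have s0 : 0 <= \sum_i \sum_j unit_norm i j * `|c k i j - c' i j|.
  by apply: sumr_ge0 => i _; apply: sumr_ge0 => j _; rewrite mulr_ge0 ?unit_norm_ge0.
rewrite (ger0_norm s0) in h.
have h1 := norming_lip (c k) c'; have h2 := norming_lip c' (c k).
have e1 : \sum_i \sum_j unit_norm i j * `|c' i j - c k i j| = \sum_i \sum_j unit_norm i j * `|c k i j - c' i j|.
  by apply: eq_bigr => i _; apply: eq_bigr => j _; rewrite distrC.
rewrite e1 in h2; rewrite ler_norml; lra.
Qed.

End NormingSet.

(** * Rounding error and integrability *)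

Section Discretization.
Context {R : realType} {d : measure_display} {Om : measurableType d} (P : probability Om R).
Variables (n : nat) (X Y : 'I_n -> Om -> R).

Definition admissible (Z : 'I_n -> Om -> R) : Prop :=
  (forall i, measurable_fun setT (Z i)) /\ (forall i, symmetric_rv P (Z i)) /\
  (forall i, logconcave_tails P (Z i)) /\ (forall i, normalized_tail P (Z i)).

Hypothesis HX : admissible X.
Hypothesis HY : admissible Y.
Hypothesis ind : mutually_independent P
  (fun k : 'I_n + 'I_n => match k with inl i => X i | inr j => Y j end).

Definition rdv k (Z : 'I_n -> Om -> R) (w : Om) : 'I_n -> R := fun i => rd k (Z i w).
Definition lvl_p k (Z : 'I_n -> Om -> R) := grid_ps P k.+1 (M := mesh_top k) Z.
Definition lvl_x k := @grid_xs R n k.+1 (mesh_top k).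
Arguments lvl_p : clear implicits.
Arguments lvl_x : clear implicits.
Definition lvl_dom k (Z : 'I_n -> Om -> R) i := grid_dom (Gt P (Z i)) k.+1 (mesh_top k).
Definition lvl_cost (Z : 'I_n -> Om -> R) i := grid_cost (Gt P (Z i)).

Lemma lvl_good k Z i : admissible Z ->
  good (lvl_p k Z i) (lvl_x k i) (lvl_cost Z i \o lvl_x k i) (lvl_dom k Z i) (lvl_cost Z i).
Proof.
move=> [mZ [sZ [lZ nZ]]]; apply: grid_good => //; first exact: tail_spec_Gt.
by rewrite /mesh_top leq_pmulr.
Qed.

Lemma lvl_law k Z i : admissible Z -> law (lvl_p k Z i) (lvl_x k i) (lvl_cost Z i \o lvl_x k i).
Proof. by move=> aZ; case: (lvl_good k i aZ). Qed.

Lemma lvl_ball k Z p v : admissible Z -> ball (lvl_dom k Z) (lvl_cost Z) p v -> Bp P Z p v.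
Proof.
move=> [mZ _] [dv cv]; rewrite /Bp /=.
rewrite (eq_bigr (fun i => (lvl_cost Z i (v i))%:E)) ?sumEFin ?lee_fin // => i _.
exact: (Nhat_grid (mZ i) _ (dv i)).
Qed.

Lemma lvl_ball_le k Z p v i : admissible Z -> 1 <= p -> ball (lvl_dom k Z) (lvl_cost Z) p v -> `|v i| <= p.
Proof.
move=> aZ p1 [dv cv]; case: (leP `|v i| 1) => [|v1]; first by move=> h; exact: le_trans p1.
have cs j : cost_spec (lvl_dom k Z j) (lvl_cost Z j) by case: (lvl_good k j aZ) => _ [].
apply: (@le_trans _ _ (lvl_cost Z i (v i))).
  by case: (cs i) => _ [_ [h _]]; apply: h.
apply: le_trans cv; rewrite (bigD1 i) //= lerDl; apply: sumr_ge0 => j _.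
by case: (cs j) => h _; apply: h.
Qed.

Lemma integral_rdv k (Phi : ('I_n -> R) -> ('I_n -> R) -> R) : (forall u v, 0 <= Phi u v) ->
  (\int[P]_w (Phi (rdv k X w) (rdv k Y w))%:E =
   (EX (lvl_p k X) (lvl_x k) (fun v => EX (lvl_p k Y) (lvl_x k) (Phi v)))%:E)%E.
Proof. by case: HX => mX [sX _]; case: HY => mY [sY _]; exact: integral_rnd. Qed.

Lemma measurable_rdv k (Phi : ('I_n -> R) -> ('I_n -> R) -> R) :
  measurable_fun setT (fun w => Phi (rdv k X w) (rdv k Y w)).
Proof. by case: HX => mX _; case: HY => mY _; exact: measurable_rnd. Qed.

Lemma integral_rdvr k (Phi : ('I_n -> R) -> R) : (forall u, 0 <= Phi u) ->
  (\int[P]_w (Phi (rdv k Y w))%:E = (EX (lvl_p k Y) (lvl_x k) Phi)%:E)%E.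
Proof.
move=> Phi0; rewrite (integral_rdv k (Phi := fun _ => Phi)) //.
by rewrite (EX_cst (fun i => lvl_law k i HX)).
Qed.

Lemma integral_rdvl k (Phi : ('I_n -> R) -> R) : (forall u, 0 <= Phi u) ->
  (\int[P]_w (Phi (rdv k X w))%:E = (EX (lvl_p k X) (lvl_x k) Phi)%:E)%E.
Proof.
move=> Phi0; rewrite (integral_rdv k (Phi := fun u _ => Phi u)) //.
by congr (_%:E); apply: eq_E1 => w; rewrite (EX_cst (fun i => lvl_law k i HY)).
Qed.

Let sq (i : 'I_n) (v : 'I_n -> R) : R := v i ^+ 2.

Let sq_EX k Z i : admissible Z -> EX (lvl_p k Z) (lvl_x k) (sq i) <= 240.
Proof.
move=> aZ; have := EX_dot_sqr (fun i => lvl_law k i aZ) (fun j => (j == i)%:R).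
have -> : (fun v => dot (fun j => (j == i)%:R) v ^+ 2) = sq i.
  apply/funext => v; rewrite /sq /dot (bigD1 i) //= eqxx mul1r big1 ?addr0 // => j ji.
  by rewrite (negbTE ji) mul0r.
rewrite (bigD1 i) //= eqxx expr1n big1 ?addr0 ?mulr1 // => j ji.
by rewrite (negbTE ji) expr0n.
Qed.

Let fatou_sq (Z : 'I_n -> Om -> R) i :
  (forall k, measurable_fun setT (fun w => sq i (rdv k Z w))) ->
  (forall k, \int[P]_w (sq i (rdv k Z w))%:E <= 240%:E)%E -> (\int[P]_w (Z i w ^+ 2)%:E <= 240%:E)%E.
Proof.
move=> m h; apply: (@fatou_bound _ _ _ P (fun k w => sq i (rdv k Z w)) _ _ 0) => //.
- by move=> k w; rewrite sqr_ge0.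
- by move=> w; rewrite /sq expr2; apply: cvgM; exact: rd_cvg.
Qed.

(** Square integrability is derived: the bound 240 holds for all roundings and passes to the limit
    by Fatou. It provides the dominating function for [err]. *)
Lemma second_moment i : (\int[P]_w (X i w ^+ 2)%:E <= 240%:E)%E /\ (\int[P]_w (Y i w ^+ 2)%:E <= 240%:E)%E.
Proof.
split; apply: fatou_sq => k.
- exact: (measurable_rdv k (fun u _ => sq i u)).
- by rewrite integral_rdvl ?lee_fin ?sq_EX // => u; exact: sqr_ge0.
- exact: (measurable_rdv k (fun _ u => sq i u)).
- by rewrite integral_rdvr ?lee_fin ?sq_EX // => u; exact: sqr_ge0.
Qed.

Section Error.
Variables (m : 'I_n -> 'I_n -> R) (p t : R).
Hypothesis m0 : forall i j, 0 <= m i j.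
Hypothesis p0 : 0 <= p.
Hypothesis t0 : 0 < t.

(** One error serves three comparisons: both arguments random, or one of them a vector of the ball,
    whose coordinates are at most [p] by [lvl_ball_le]. *)
Definition err k (w : Om) : R := \sum_i \sum_j m i j *
  (`|X i w * Y j w - rdv k X w i * rdv k Y w j| +
   p * (`|X i w - rdv k X w i| + `|Y j w - rdv k Y w j|)).

Lemma err_ge0 k w : 0 <= err k w.
Proof.
apply: sumr_ge0 => i _; apply: sumr_ge0 => j _; apply: mulr_ge0 => //.
by rewrite addr_ge0 // mulr_ge0 // addr_ge0.
Qed.

Lemma measurable_err k : measurable_fun setT (err k).
Proof.
case: HX => mX _; case: HY => mY _.
have mr (Z : Om -> R) : measurable_fun setT Z -> measurable_fun setT (fun w => rd k (Z w)).
  by move=> mZ; apply: measurableT_comp mZ; exact: measurable_rd.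
apply: measurable_sum => i; apply: measurable_sum => j.
apply: measurable_funM; first exact: measurable_cst.
have mN (Z : Om -> R) : measurable_fun setT Z -> measurable_fun setT (fun w => `|Z w|).
  by move=> mZ; exact: measurableT_comp mZ.
apply: measurable_funD.
  by apply: mN; apply: measurable_funB; apply: measurable_funM => //; exact: mr.
apply: measurable_funM; first exact: measurable_cst.
by apply: measurable_funD; apply: mN; apply: measurable_funB => //; exact: mr.
Qed.

Let dom w : R := \sum_i \sum_j m i j * ((1 + p) * (1 + (X i w ^+ 2 + Y j w ^+ 2))).

Let err_term (x x' y y' : R) : `|x'| <= `|x| -> `|y'| <= `|y| -> `|x - x'| <= `|x| -> `|y - y'| <= `|y| ->
  `|x * y - x' * y'| + p * (`|x - x'| + `|y - y'|) <= (1 + p) * (1 + (x ^+ 2 + y ^+ 2)).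
Proof.
move=> h1 h2 h3 h4; have hp := p0.
have a1 : `|x * y - x' * y'| <= 2 * (`|x| * `|y|).
  apply: le_trans (ler_normB _ _) _; rewrite !normrM.
  have : `|x'| * `|y'| <= `|x| * `|y| by apply: ler_pM.
  lra.
have a2 : 2 * (`|x| * `|y|) <= x ^+ 2 + y ^+ 2.
  rewrite -(real_normK (num_real x)) -(real_normK (num_real y)).
  by have := sqr_ge0 (`|x| - `|y|); rewrite sqrrB; lra.
have a3 (z : R) : `|z| <= (1 + z ^+ 2) / 2.
  rewrite -(real_normK (num_real z)); have := sqr_ge0 (`|z| - 1); rewrite sqrrB expr1n mulr1; lra.
have a4 : `|x - x'| + `|y - y'| <= 1 + (x ^+ 2 + y ^+ 2).
  have := a3 x; have := a3 y; have := sqr_ge0 x; have := sqr_ge0 y; lra.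
rewrite mulrDl mul1r; apply: lerD; last exact: ler_wpM2l.
apply: (le_trans a1); apply: (le_trans a2); lra.
Qed.

Let err_le k w : err k w <= dom w.
Proof.
apply: ler_sum => i _; apply: ler_sum => j _; apply: ler_wpM2l => //.
by apply: err_term; rewrite /rdv; first [exact: rnd_abs_le|exact: rnd_abs].
Qed.

Let err_cvg w : err k w @[k --> \oo] --> (0 : R).
Proof.
have e0 : \sum_i \sum_j m i j * (`|X i w * Y j w - X i w * Y j w| + p * (`|X i w - X i w| + `|Y j w - Y j w|)) = 0.
  by rewrite big1 // => i _; rewrite big1 // => j _; rewrite !subrr !normr0 addr0 mulr0 addr0 mulr0.
have cX i : rdv k X w i @[k --> \oo] --> X i w by exact: rd_cvg.
have cY i : rdv k Y w i @[k --> \oo] --> Y i w by exact: rd_cvg.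
rewrite -[X in _ --> X]e0; apply: cvg_fin_sum => i; apply: cvg_fin_sum => j; apply: cvgMl_tmp.
apply: cvgD; first by apply: cvg_norm; apply: cvgB; [exact: cvg_cst|exact: cvgM].
by apply: cvgMl_tmp; apply: cvgD; apply: cvg_norm; apply: cvgB => //; exact: cvg_cst.
Qed.

Let int_sq (Z : Om -> R) : measurable_fun setT Z -> (\int[P]_w (Z w ^+ 2)%:E <= 240%:E)%E ->
  P.-integrable setT (fun w => (Z w ^+ 2)%:E).
Proof.
move=> mZ h; apply/integrableP; split; first by apply/measurable_EFinP; exact: measurable_funX.
under eq_integral do rewrite gee0_abs ?lee_fin ?sqr_ge0 //.
by apply: le_lt_trans h _; exact: ltry.
Qed.

Let dom_int : P.-integrable setT (EFin \o dom).
Proof.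
case: (HX) => mX _; case: (HY) => mY _.
have -> : EFin \o dom = (fun w => \sum_i \sum_j (m i j * (1 + p))%:E * (1%:E + ((X i w ^+ 2)%:E + (Y j w ^+ 2)%:E)))%E.
  apply/funext => w; rewrite /dom /= -sumEFin; apply: eq_bigr => i _; rewrite -sumEFin.
  by apply: eq_bigr => j _; rewrite -!EFinD -EFinM mulrA.
apply: integrable_sum => // i _; apply: integrable_sum => // j _.
apply: integrableZl => //; apply: integrableD => //.
  by apply: finite_measure_integrable_cst.
by apply: integrableD => //; apply: int_sq => //; case: (second_moment i); case: (second_moment j).
Qed.

Lemma err_small : exists N, forall k, (N <= k)%N -> (\int[P]_w (err k w)%:E <= t%:E)%E.
Proof.
have [] := @dominated_convergence _ _ _ P _ measurableT (fun k => EFin \o err k) (fun=> 0%E) (EFin \o dom).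
- by move=> k; apply/measurable_EFinP; exact: measurable_err.
- exact: measurable_cst.
- by apply: aeW => w _; apply: cvg_EFin; [exact: nearW|exact: err_cvg].
- exact: dom_int.
- by apply: aeW => w k _; rewrite /= lee_fin ger0_norm ?err_ge0 ?err_le.
move=> _ _; rewrite integral0 => /fine_cvgP[h1 h2].
have [N1 _ H1] := h1.
move/cvgrPdist_le : h2 => /(_ t t0)[N2 _ H2].
exists (maxn N1 N2) => k; rewrite geq_max => /andP[k1 k2].
have := H1 k k1; have := H2 k k2 => /=; rewrite sub0r normrN => h fk.
rewrite -(fineK fk) lee_fin; exact: le_trans (ler_norm _) h.
Qed.
End Error.
End Discretization.
Arguments lvl_x {R n} k i _.
Arguments lvl_p {R d Om} P {n} k Z i _.

(* Passage to the limit for a norm with a norming set *)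
#[local] Opaque Cmain.
Section NormMoments.
Context {R : realType} {d : measure_display} {Om : measurableType d} (P : probability Om R).
Variables (n : nat) (X Y : 'I_n -> Om -> R).
Hypothesis HX : admissible P X.
Hypothesis HY : admissible P Y.
Hypothesis ind : mutually_independent P
  (fun k : 'I_n + 'I_n => match k with inl i => X i | inr j => Y j end).
Variables (B : set ('I_n -> 'I_n -> R)) (nrm : ('I_n -> 'I_n -> R) -> R).
Hypothesis HB : norming B nrm.
Variables (p t : R).
Hypothesis p1 : 1 <= p.
Hypothesis t0 : 0 < t.

Let vec (Z : 'I_n -> Om -> R) w : 'I_n -> R := fun i => Z i w.

Hypothesis h1 : (\int[P]_w (nrm (ten (vec X w) (vec Y w)))%:E <= t%:E)%E.
Hypothesis h2 : forall v, Bp P X p v -> (\int[P]_w (nrm (ten v (vec Y w)))%:E <= t%:E)%E.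
Hypothesis h3 : forall v, Bp P Y p v -> (\int[P]_w (nrm (ten (vec X w) v))%:E <= t%:E)%E.
Hypothesis h4 : forall b v, B b -> Bp P X p v -> \sum_i Num.sqrt (\sum_j b i j ^+ 2) * v i <= t.
Hypothesis h5 : forall b v u, B b -> Bp P X p v -> Bp P Y p u -> \sum_i \sum_j b i j * v i * u j <= t.
Hypothesis h6 : forall b i, B b -> p * Num.sqrt (\sum_j b i j ^+ 2) <= t.

Let r := (Num.truncn p).+1.
Let Q := (4 + r)%N.

Let r_bounds : p / 2 <= r%:R /\ p <= Q%:R /\ Q%:R <= 8 * p.
Proof.
have hp := p1; have p0 : 0 <= p by lra.
have /andP[a] := truncn_itv p0; rewrite /Q /r natrD -natr1.
by move: a; set k := (Num.truncn p)%:R; move: k => k a b; split; [|split]; lra.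
Qed.

Let e k := err X Y (unit_norm nrm) p k.
Let e0 k w : 0 <= e k w.
Proof. by apply: err_ge0; [exact: (unit_norm_ge0 HB)|exact: le_trans p1]. Qed.
Let me k : measurable_fun setT (e k). Proof. exact: (measurable_err HX HY). Qed.
Let nrm0 c : 0 <= nrm c := norming_ge0 HB c.

Let cX i w : rdv k X w i @[k --> \oo] --> X i w. Proof. exact: rd_cvg. Qed.
Let cY i w : rdv k Y w i @[k --> \oo] --> Y i w. Proof. exact: rd_cvg. Qed.

Let m1 : measurable_fun setT (fun w => nrm (ten (vec X w) (vec Y w))).
Proof.
apply: (@measurable_fun_cvg _ _ _ _ (fun k w => nrm (ten (rdv k X w) (rdv k Y w)))).
  by move=> k; exact: (measurable_rdv HX HY k (fun u v => nrm (ten u v))).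
by move=> w _; apply: (norming_cvg HB) => i j; apply: cvgM; [exact: cX|exact: cY].
Qed.

Let m2 v : measurable_fun setT (fun w => nrm (ten v (vec Y w))).
Proof.
apply: (@measurable_fun_cvg _ _ _ _ (fun k w => nrm (ten v (rdv k Y w)))).
  by move=> k; exact: (measurable_rdv HX HY k (fun _ u => nrm (ten v u))).
by move=> w _; apply: (norming_cvg HB) => i j; apply: cvgMl_tmp; exact: cY.
Qed.

Let m3 v : measurable_fun setT (fun w => nrm (ten (vec X w) v)).
Proof.
apply: (@measurable_fun_cvg _ _ _ _ (fun k w => nrm (ten (rdv k X w) v))).
  by move=> k; exact: (measurable_rdv HX HY k (fun u _ => nrm (ten u v))).
by move=> w _; apply: (norming_cvg HB) => i j; apply: cvgMr_tmp; exact: cX.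
Qed.

Section Level.
Variable k : nat.
Hypothesis ek : (\int[P]_w (e k w)%:E <= t%:E)%E.

(* replacing the variables by their roundings costs at most [e k] *)
Let perturb (f : Om -> R) (I : R) : measurable_fun setT f -> (forall w, 0 <= f w) ->
  (\int[P]_w (f w)%:E <= t%:E)%E ->
  forall g : Om -> R, measurable_fun setT g -> (forall w, 0 <= g w) ->
  (forall w, g w <= f w + e k w) -> (\int[P]_w (g w)%:E = I%:E)%E -> I <= 2 * t.
Proof.
move=> mf f0 ft g mg g0 gf gI; rewrite -lee_fin -gI.
apply: (@le_trans _ _ (\int[P]_w ((f w)%:E + (e k w)%:E))%E).
  apply: ge0_le_integral => //; do ?[by move=> w _; rewrite lee_fin].
  - exact/measurable_EFinP.
  - by apply: emeasurable_funD; apply/measurable_EFinP.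
rewrite ge0_integralD //; do ?[by move=> w _; rewrite lee_fin]; do ?exact/measurable_EFinP.
by apply: (le_trans (leeD ft ek)); rewrite -EFinD lee_fin; lra.
Qed.

Let W := {ffun 'I_n -> gridT (mesh_top k)}.
Let pt (w : W) : 'I_n -> R := fun i => lvl_x k i (w i).

Let sel : {f : ('I_n -> 'I_n -> R) -> 'I_n -> 'I_n -> R | forall c, B (f c) /\ nrm c = pairing (f c) c}.
Proof. by case: HB => _ [_ h]; have [f fP] := choice h; exists f. Qed.

(** One norming matrix for each pair of grid points, and [None] for the zero matrix: a finite family
    whose maximum equals the norm on the grid. *)
Let bb (h : option (W * W)) : 'I_n -> 'I_n -> R :=
  if h is Some h then sval sel (ten (pt h.1) (pt h.2)) else fun _ _ => 0.

Let bbB h : B (bb h).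
Proof. by case: h => [h|] /=; [case: (svalP sel (ten (pt h.1) (pt h.2)))|case: HB]. Qed.

Let bil_pairing h u v : bil bb h u v = pairing (bb h) (ten u v).
Proof. by apply: eq_bigr => i _; apply: eq_bigr => j _; rewrite mulrA. Qed.

Let NN_le u v : NN None bb u v <= nrm (ten u v).
Proof. by apply: maxf_le => h; rewrite bil_pairing; case: (HB) => _ [hB _]; exact: hB. Qed.

Let NN_pt w w' : nrm (ten (pt w) (pt w')) <= NN None bb (pt w) (pt w').
Proof.
have [_ ->] := svalP sel (ten (pt w) (pt w')).
by have := NN_ge None bb (Some (w, w')) (pt w) (pt w'); rewrite bil_pairing.
Qed.

Lemma level_bound :
  (\int[P]_w (nrm (ten (rdv k X w) (rdv k Y w)) ^+ Q)%:E <= ((Cmain R * (2 * t)) ^+ Q)%:E)%E.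
Proof.
have [r1 [r2 r3]] := r_bounds.
have p0 : 0 <= p by apply: le_trans p1.
have u0 i j : 0 <= unit_norm nrm i j := unit_norm_ge0 HB i j.
have lX i := lvl_law k i HX; have lY i := lvl_law k i HY.
have nb v i : ball (lvl_dom P k X) (lvl_cost P X) p v -> `|v i| <= p by exact: lvl_ball_le.
have nb' v i : ball (lvl_dom P k Y) (lvl_cost P Y) p v -> `|v i| <= p by exact: lvl_ball_le.
rewrite (integral_rdv HX HY ind k (Phi := fun u v => nrm (ten u v) ^+ Q)); last by move=> u v; rewrite exprn_ge0.
rewrite lee_fin.
apply: (@le_trans _ _ (EX (lvl_p P k X) (lvl_x k) (fun v => EX (lvl_p P k Y) (lvl_x k) (fun u => NN None bb v u ^+ Q)))).
  apply: E1_le => [|w]; first by apply: pw_ge0 => i g; case: (lX i).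
  move=> _; apply: E1_le => [|w' _]; first by apply: pw_ge0 => i g; case: (lY i).
  by rewrite lerXn2r ?nnegrE // ?NN_pt // NN_ge0.
apply: (finite_main (q := p) (r := r) (k0 := None) (b := bb) _ (fun i => lvl_good k i HX) (fun i => lvl_good k i HY)) => //.
- by rewrite mulr_gt0.
- apply: (@le_trans _ _ (EX (lvl_p P k X) (lvl_x k) (fun v => EX (lvl_p P k Y) (lvl_x k) (fun u => nrm (ten v u))))).
    by apply: (EX_le lX) => v; apply: (EX_le lY) => u; exact: NN_le.
  apply: (perturb m1 _ h1 (g := fun w => nrm (ten (rdv k X w) (rdv k Y w)))) => //.
  + exact: (measurable_rdv HX HY k (fun u v => nrm (ten u v))).
  + move=> w; apply: le_trans (norming_lip HB _ (ten (vec X w) (vec Y w))) _; rewrite lerD2l.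
    apply: ler_sum => i _; apply: ler_sum => j _; apply: ler_wpM2l => //.
    by rewrite distrC lerDl mulr_ge0 // addr_ge0.
  + exact: (integral_rdv HX HY ind k (Phi := fun u v => nrm (ten u v))).
- move=> v bv; apply: (@le_trans _ _ (EX (lvl_p P k Y) (lvl_x k) (fun u => nrm (ten v u)))).
    by apply: (EX_le lY) => u; exact: NN_le.
  apply: (perturb (m2 v) _ (h2 (lvl_ball HX bv)) (g := fun w => nrm (ten v (rdv k Y w)))) => //.
  + exact: (measurable_rdv HX HY k (fun _ u => nrm (ten v u))).
  + move=> w; apply: le_trans (norming_lip HB _ (ten v (vec Y w))) _; rewrite lerD2l.
    apply: ler_sum => i _; apply: ler_sum => j _; apply: ler_wpM2l => //.
    rewrite /ten -mulrBr normrM distrC; apply: (@le_trans _ _ (p * `|Y j w - rdv k Y w j|)).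
      by rewrite ler_wpM2r // nb.
    by rewrite mulrDr addrA lerDr addr_ge0 // mulr_ge0.
  + exact: (integral_rdvr HX HY ind k (Phi := fun u => nrm (ten v u))).
- move=> v bv; apply: (@le_trans _ _ (EX (lvl_p P k X) (lvl_x k) (fun u => nrm (ten u v)))).
    by apply: (EX_le lX) => u; exact: NN_le.
  apply: (perturb (m3 v) _ (h3 (lvl_ball HY bv)) (g := fun w => nrm (ten (rdv k X w) v))) => //.
  + exact: (measurable_rdv HX HY k (fun u _ => nrm (ten u v))).
  + move=> w; apply: le_trans (norming_lip HB _ (ten (vec X w) v)) _; rewrite lerD2l.
    apply: ler_sum => i _; apply: ler_sum => j _; apply: ler_wpM2l => //.
    rewrite /ten -mulrBl normrM distrC mulrC; apply: (@le_trans _ _ (p * `|X i w - rdv k X w i|)).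
      by rewrite ler_wpM2r // nb'.
    by rewrite mulrDr addrCA lerDl addr_ge0 // mulr_ge0.
  + exact: (integral_rdvl HX HY ind k (Phi := fun u => nrm (ten u v))).
- move=> h v bv; apply: (le_trans (h4 (bbB h) (lvl_ball HX bv))); have := t0; lra.
- move=> h v u bv bu; apply: (le_trans (h5 (bbB h) (lvl_ball HX bv) (lvl_ball HY bu))); have := t0; lra.
- move=> h i; apply: (le_trans (h6 i (bbB h))); have := t0; lra.
Qed.
End Level.

Let D : R := 2 * Cmain R * t.
Let D0 : 0 < D. Proof. by rewrite mulr_gt0 // mulr_gt0 // Cmain_gt0. Qed.

Lemma norm_moment_nat : (\int[P]_w (nrm (ten (vec X w) (vec Y w)) ^+ Q)%:E <= (D ^+ Q)%:E)%E.
Proof.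
have [N hN] := @err_small _ _ _ P _ _ _ HX HY ind _ _ _ (unit_norm_ge0 HB) (le_trans ler01 p1) t0.
apply: (@fatou_bound _ _ _ P (fun k w => nrm (ten (rdv k X w) (rdv k Y w)) ^+ Q) _ _ N).
- by move=> k; exact: (measurable_rdv HX HY k (fun u v => nrm (ten u v) ^+ Q)).
- by move=> k w; rewrite exprn_ge0.
- move=> w; apply: (@continuous_cvg _ R R _ _ _ (fun x : R => x ^+ Q)); first exact: exprn_continuous.
  by apply: (norming_cvg HB) => i j; apply: cvgM; [exact: cX|exact: cY].
- move=> k /hN hk; have -> : D = Cmain R * (2 * t) by rewrite /D mulrAC mulrC mulrA mulrC.
  exact: level_bound.
Qed.

Lemma norm_moment : (\int[P]_w (nrm (ten (vec X w) (vec Y w)) `^ p)%:E <= ((4 * Cmain R * t) `^ p)%:E)%E.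
Proof.
have [_ [pQ _]] := r_bounds; have p0 : 0 <= p by apply: le_trans p1.
(* For [v = u / D], [v^p] is at most 1 or at most [v^Q]. Integrating gives [2 D^p <= (2 D)^p], which
   doubles the constant. *)
have pw u : 0 <= u -> u `^ p <= D `^ p * (1 + (u / D) ^+ Q).
  move=> u0; have -> : u = D * (u / D) by rewrite mulrC divfK // gt_eqF.
  have v0 : 0 <= u / D by rewrite divr_ge0 // ltW.
  rewrite [D * (u / D) / D]mulrAC divff ?gt_eqF // mul1r.
  move: v0; set v := u / D; move: v => v v0.
  rewrite powRM ?(ltW D0) // ler_wpM2l ?powR_ge0 //.
  case: (leP v 1) => v1.
    apply: (@le_trans _ _ 1); last by rewrite lerDl exprn_ge0.
    by have := ge0_ler_powR p0 (x := v) (y := 1); rewrite powR1 !nnegrE; apply.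
  apply: (@le_trans _ _ (v ^+ Q)); last by rewrite lerDr.
  by rewrite -powR_mulrn // ler_powR // ltW.
have mN := m1.
have mQ : measurable_fun setT (fun w => nrm (ten (vec X w) (vec Y w)) ^+ Q) by exact: measurable_funX.
apply: (@le_trans _ _ (\int[P]_w ((D `^ p)%:E + (D `^ p / D ^+ Q)%:E * (nrm (ten (vec X w) (vec Y w)) ^+ Q)%:E))%E).
  apply: ge0_le_integral => //.
  - by move=> w _; rewrite lee_fin powR_ge0.
  - by apply/measurable_EFinP; apply: (measurableT_comp (measurable_powR p)).
  - apply: emeasurable_funD; first exact: measurable_cst.
    by apply: measurable_funeM; apply/measurable_EFinP.
  - move=> w _; rewrite -EFinM -EFinD lee_fin; apply: (le_trans (pw _ (nrm0 _))).
    by rewrite mulrDr mulr1 exprMn exprVn lerD2l [leRHS]mulrAC mulrA.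
have c0 : 0 <= D `^ p / D ^+ Q by rewrite divr_ge0 ?powR_ge0 // exprn_ge0 // ltW.
rewrite ge0_integralD //; first last.
- by apply: measurable_funeM; apply/measurable_EFinP.
- by move=> w _; rewrite mule_ge0 // lee_fin // exprn_ge0.
- by move=> w _; rewrite lee_fin powR_ge0.
rewrite integral_cst // ge0_integralZl //; first last.
- by move=> w _; rewrite lee_fin exprn_ge0.
- exact/measurable_EFinP.
rewrite [X in (_ * X + _)%E]probability_setT mule1.
apply: (@le_trans _ _ ((D `^ p)%:E + (D `^ p / D ^+ Q)%:E * (D ^+ Q)%:E)%E).
  by apply: leeD2l; apply: lee_wpmul2l; [rewrite lee_fin|exact: norm_moment_nat].
rewrite -EFinM -EFinD lee_fin divfK ?gt_eqF ?exprn_gt0 //.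
have -> : 4 * Cmain R * t = 2 * D by rewrite /D; lra.
rewrite powRM ?(ltW D0) //.
have : 2 <= 2 `^ p :> R by rewrite -[leLHS]powRr1 // ler_powR // ler1n.
by move=> h; have := powR_ge0 D p => h'; nra.
Qed.
End NormMoments.

(** * Norming functionals of L_q *)

Section Duality.
Context {R : realType} {d : measure_display} {T : measurableType d} (mu : {measure set T -> \bar R}).
Variable q : R.
Hypothesis q1 : 1 <= q.
Implicit Types (g z : T -> R) (f : (T -> R) -> R).

Let q0 : 0 < q. Proof. by apply: lt_le_trans q1. Qed.
Lemma inLq_Lfun g : inLq mu q g <-> g \in Lfun mu q%:E.
Proof.
split; last by case/andP; rewrite !inE /= => mg fg; split.
by move=> [mg fg]; apply/andP; split; rewrite inE.
Qed.

Lemma inLqD g g' : inLq mu q g -> inLq mu q g' -> inLq mu q (g \+ g').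
Proof.
move=> [mg fg] [mg' fg']; split; first exact: measurable_funD.
by apply: le_lt_trans (minkowski_EFin mu mg mg' q1) _; exact: lte_add_pinfty.
Qed.

Lemma inLqZ (c : R) g : inLq mu q g -> inLq mu q (fun t => c * g t).
Proof.
move=> /inLq_Lfun hg; apply/inLq_Lfun; have -> : (fun t => c * g t) = c \o* g.
  by apply/funext => t; rewrite /= mulrC.
exact: Lfun_scale.
Qed.

Lemma inLq0 : inLq mu q (fun=> 0).
Proof.
split; first exact: measurable_cst.
by rewrite /Lqnorm Lnorm0 // eqe gt_eqF.
Qed.

Lemma inLq_sum (I : Type) (r : seq I) (g : I -> T -> R) :
  (forall i, inLq mu q (g i)) -> inLq mu q (fun t => \sum_(i <- r) g i t).
Proof.
move=> h; elim: r => [|i r IH].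
  have -> : (fun t => \sum_(i <- [::]) g i t) = (fun=> 0) by apply/funext => t; rewrite big_nil.
  exact: inLq0.
have -> : (fun t => \sum_(j <- i :: r) g j t) = g i \+ (fun t => \sum_(j <- r) g j t).
  by apply/funext => t; rewrite big_cons.
exact: inLqD.
Qed.

Lemma dual_ball0 : dual_ball mu q (fun=> 0).
Proof.
split; first by move=> *; rewrite addr0.
by split=> [c g _|g _]; rewrite ?mulr0 // normr0 Lnorm_ge0.
Qed.

Lemma dual_sum f (I : Type) (r : seq I) (g : I -> T -> R) : dual_ball mu q f ->
  (forall i, inLq mu q (g i)) -> f (fun t => \sum_(i <- r) g i t) = \sum_(i <- r) f (g i).
Proof.
move=> [fD [fZ _]] h; elim: r => [|i r IH].
  rewrite big_nil; have -> : (fun t => \sum_(i <- [::]) g i t) = (fun t => 0 * (fun=> 0) t).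
    by apply/funext => t; rewrite big_nil mul0r.
  by rewrite fZ ?mul0r //; exact: inLq0.
rewrite big_cons -IH -fD //; last exact: inLq_sum.
by congr f; apply/funext => t; rewrite big_cons.
Qed.

Lemma Lqnorm_fin g : inLq mu q g -> Lqnorm mu q g = (fine (Lqnorm mu q g))%:E.
Proof. by move=> [_ h]; rewrite fineK // ge0_fin_numE // Lnorm_ge0. Qed.

Section Norming.
Variable z : T -> R.
Hypothesis hz : inLq mu q z.
Let N : R := fine (Lqnorm mu q z).
Hypothesis N0 : 0 < N.
Let mz : measurable_fun setT z := hz.1.

(** The extremal function of Hölder's inequality, [sign z] times [|z|^(q - 1)]. For [q = 1] the
    power is 1 also where [z] vanishes, so [|h| = 1] everywhere. *)
Let h (t : T) : R := if 0 <= z t then `|z t| `^ (q - 1) else - `|z t| `^ (q - 1).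

Let h_abs t : `|h t| = `|z t| `^ (q - 1).
Proof. by rewrite /h; case: ifP; rewrite ?normrN ger0_norm // powR_ge0. Qed.

Let zh t : z t * h t = `|z t| `^ q.
Proof.
rewrite -(mulr_powRB1 (normr_ge0 (z t)) q0) /h; case: (leP 0 (z t)) => z0; first by rewrite (ger0_norm z0).
by rewrite (ltr0_norm z0) mulrN mulNr.
Qed.

Let mh : measurable_fun setT h.
Proof.
have m : measurable_fun setT (fun t => `|z t| `^ (q - 1)).
  apply: (measurableT_comp (measurable_powR (q - 1))).
  exact: measurableT_comp mz.
apply: measurable_fun_ifT => //; last exact: measurable_funN.
exact: measurable_fun_ler.
Qed.

Let zE : Lqnorm mu q z = N%:E. Proof. exact: Lqnorm_fin. Qed.

Let N1h g : inLq mu q g ->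
  (\int[mu]_t `|(g t * h t)%:E| <= Lqnorm mu q g * (N `^ (q - 1))%:E)%E.
Proof.
move=> [mg fg]; have := q1; rewrite le_eqVlt => /orP[/eqP qe|q1'].
  rewrite -qe subrr powRr0 mule1 /Lqnorm Lnorm1; apply: ge0_le_integral => //.
  - by apply: measurableT_comp => //; apply/measurable_EFinP; exact: measurable_funM.
  - by apply: measurableT_comp => //; apply/measurable_EFinP.
  - by move=> t _ /=; rewrite lee_fin normrM h_abs -qe subrr powRr0 mulr1.
pose q' := q / (q - 1).
have qm : 0 < q - 1 by rewrite subr_gt0.
have q'0 : 0 < q' by rewrite divr_gt0.
have qq : q^-1 + q'^-1 = 1 by rewrite /q' invf_div; have := q0 => q00; field; rewrite gt_eqF.
have := hoelder mu mg mh q0 q'0 qq; rewrite Lnorm1 => H; apply: (le_trans H).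
rewrite (_ : Lnorm mu q'%:E _ = (N `^ (q - 1))%:E) //.
rewrite -poweR_EFin -zE /Lqnorm !unlock /= -poweRrM (_ : q^-1 * (q - 1) = q'^-1); last by rewrite /q' invf_div mulrC.
apply: (congr1 (fun u => poweR u q'^-1)); apply: eq_integral => t _ /=; rewrite h_abs -powRrM.
by congr (_ `^ _)%:E; rewrite /q' mulrC divfK // gt_eqF.
Qed.

Let int_gh g : inLq mu q g -> mu.-integrable setT (fun t => (g t * h t)%:E).
Proof.
move=> hg; apply/integrableP; split.
  by apply/measurable_EFinP; apply: measurable_funM => //; case: hg.
apply: le_lt_trans (N1h hg) _; rewrite (Lqnorm_fin hg) -EFinM; exact: ltry.
Qed.

Definition norming_functional g : R := fine (\int[mu]_t (g t * h t)%:E) / N `^ (q - 1).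

Let Nq0 : 0 < N `^ (q - 1). Proof. exact: powR_gt0. Qed.

Lemma norming_functional_dual : dual_ball mu q norming_functional.
Proof.
split; [|split].
- move=> g g' hg hg'; rewrite /norming_functional -mulrDl -fineD; try exact: integral_fune_fin_num (int_gh _).
  rewrite -integralD //; do ?exact: int_gh.
  by congr (fine _ / _); apply: eq_integral => t _; rewrite -EFinD mulrDl.
- move=> c g hg; rewrite /norming_functional mulrA; congr (_ / _).
  have -> : (\int[mu]_t (c * g t * h t)%:E = c%:E * \int[mu]_t (g t * h t)%:E)%E.
    rewrite -integralZl //; last exact: int_gh.
    by apply: eq_integral => t _; rewrite -EFinM mulrA.
  by rewrite fineM //; exact: integral_fune_fin_num (int_gh hg).
- move=> g hg; rewrite (Lqnorm_fin hg) lee_fin normrM normfV (gtr0_norm Nq0) ler_pdivrMr //.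
  rewrite -lee_fin EFinM -(Lqnorm_fin hg); apply: le_trans (N1h hg).
  have := le_abse_integral mu measurableT (measurable_int mu (int_gh hg)).
  by rewrite -{1}(fineK (integral_fune_fin_num measurableT (int_gh hg))).
Qed.

Lemma norming_functionalE : norming_functional z = N.
Proof.
rewrite /norming_functional; under eq_integral do rewrite zh.
have -> : (\int[mu]_t (`|z t| `^ q)%:E = (N `^ q)%:E)%E.
  by rewrite -poweR_EFin -zE /Lqnorm poweR_Lnorm // gt_eqF.
by rewrite /= -(mulr_powRB1 (ltW N0) q0) mulfK // gt_eqF.
Qed.
End Norming.

Variables (n : nat) (a : 'I_n -> 'I_n -> T -> R).
Hypothesis ha : forall i j, inLq mu q (a i j).

Definition mx_fun (c : 'I_n -> 'I_n -> R) (t : T) : R := \sum_i \sum_j a i j t * c i j.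
Definition mx_norm c : R := fine (Lqnorm mu q (mx_fun c)).
Definition dual_mx : set ('I_n -> 'I_n -> R) :=
  [set b | exists f, dual_ball mu q f /\ b = fun i j => f (a i j)].

Lemma inLq_mx c : inLq mu q (mx_fun c).
Proof.
apply: inLq_sum => i; apply: inLq_sum => j.
have -> : (fun t => a i j t * c i j) = (fun t => c i j * a i j t) by apply/funext => t; rewrite mulrC.
exact: inLqZ.
Qed.

Lemma mx_normE c : Lqnorm mu q (mx_fun c) = (mx_norm c)%:E.
Proof. by rewrite Lqnorm_fin //; exact: inLq_mx. Qed.

Lemma dual_mx_fun f c : dual_ball mu q f -> f (mx_fun c) = pairing (fun i j => f (a i j)) c.
Proof.
move=> hf; have hZ i j : inLq mu q (fun t => a i j t * c i j).
  have -> : (fun t => a i j t * c i j) = (fun t => c i j * a i j t) by apply/funext => t; rewrite mulrC.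
  exact: inLqZ.
rewrite /mx_fun dual_sum // => [|i]; last exact: inLq_sum.
apply: eq_bigr => i _; rewrite dual_sum //; apply: eq_bigr => j _.
have -> : (fun t => a i j t * c i j) = (fun t => c i j * a i j t) by apply/funext => t; rewrite mulrC.
by case: hf => _ [-> //]; rewrite mulrC.
Qed.

Lemma dual_norming : norming dual_mx mx_norm.
Proof.
split; [|split].
- by exists (fun=> 0); split=> //; exact: dual_ball0.
- move=> _ c [f [hf ->]]; rewrite -dual_mx_fun //; apply: le_trans (ler_norm _) _.
  by rewrite -lee_fin -mx_normE; case: hf => _ [_]; apply; exact: inLq_mx.
- move=> c; have hc := inLq_mx c; case: (ltP 0 (mx_norm c)) => c0.
    have hf := norming_functional_dual hc c0.
    exists (fun i j => norming_functional (mx_fun c) (a i j)); split.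
      by exists (norming_functional (mx_fun c)).
    by rewrite -dual_mx_fun // norming_functionalE.
  exists (fun _ _ => 0); split; first by exists (fun=> 0); split=> //; exact: dual_ball0.
  rewrite /pairing big1 => [|i _]; last by rewrite big1 // => j _; rewrite mul0r.
  by apply/eqP; rewrite eq_le c0 -lee_fin -mx_normE Lnorm_ge0.
Qed.
End Duality.

(** * Assembly of the six terms *)

Lemma lee_sum6 (R : realType) (x1 x2 x3 x4 x5 x6 : \bar R) :
  (0 <= x1 -> 0 <= x2 -> 0 <= x3 -> 0 <= x4 -> 0 <= x5 -> 0 <= x6 ->
  let s := x1 + x2 + x3 + x4 + x5 + x6 in
  [/\ x1 <= s, x2 <= s & x3 <= s] /\ [/\ x4 <= s, x5 <= s & x6 <= s])%E.
Proof.
move=> h1 h2 h3 h4 h5 h6 s.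
have a12 : (0 <= x1 + x2)%E by exact: adde_ge0.
have a3 : (0 <= x1 + x2 + x3)%E by exact: adde_ge0.
have a4 : (0 <= x1 + x2 + x3 + x4)%E by exact: adde_ge0.
have a5 : (0 <= x1 + x2 + x3 + x4 + x5)%E by exact: adde_ge0.
have b5 : (x1 + x2 + x3 + x4 + x5 <= s)%E by exact: leeDl.
have b4 : (x1 + x2 + x3 + x4 <= s)%E by apply: le_trans b5; exact: leeDl.
have b3 : (x1 + x2 + x3 <= s)%E by apply: le_trans b4; exact: leeDl.
have b2 : (x1 + x2 <= s)%E by apply: le_trans b3; exact: leeDl.
split; split.
- by apply: le_trans b2; exact: leeDl.
- by apply: le_trans b2; exact: leeDr.
- by apply: le_trans b3; exact: leeDr.
- by apply: le_trans b4; exact: leeDr.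
- by apply: le_trans b5; exact: leeDr.
- exact: leeDr.
Qed.

Lemma Bp0 (R : realType) (d : measure_display) (Om : measurableType d) (P : probability Om R)
  n (X : 'I_n -> Om -> R) p : 0 <= p -> Bp P X p (fun=> 0).
Proof.
move=> p0; rewrite /Bp /= big1 ?lee_fin // => i _.
by rewrite /Nhat normr0 ler01 expr0n.
Qed.

Theorem theorem2p3 (R : realType) (q : R) (hq : 1 <= q) :
  exists C : R, 0 < C /\
  forall (d : measure_display) (T : measurableType d)
    (mu : {measure set T -> \bar R})
    (d' : measure_display) (Om : measurableType d') (P : probability Om R)
    (n : nat) (X Y : 'I_n -> Om -> R) (a : 'I_n -> 'I_n -> T -> R),
  (0 < n)%N ->
  (forall i, measurable_fun setT (X i)) ->
  (forall j, measurable_fun setT (Y j)) ->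
  mutually_independent P
    (fun k : 'I_n + 'I_n => match k with inl i => X i | inr j => Y j end) ->
  (forall i, symmetric_rv P (X i)) -> (forall j, symmetric_rv P (Y j)) ->
  (forall i, logconcave_tails P (X i)) -> (forall j, logconcave_tails P (Y j)) ->
  (forall i, normalized_tail P (X i)) -> (forall j, normalized_tail P (Y j)) ->
  (forall i j, inLq mu q (a i j)) ->
  forall p : R, 1 <= p ->
  let S := fun (w : Om) (t : T) =>
    \sum_(i < n) \sum_(j < n) a i j t * X i w * Y j w in
  let Bf := dual_ball mu q in
  ((\int[P]_w (Lqnorm mu q (S w) `^ p)) `^ p^-1 <=
   C%:E *
   (\int[P]_w Lqnorm mu q (S w)
    + ereal_sup [set \int[P]_w Lqnorm mu q
         (fun t => (\sum_(i < n) \sum_(j < n) a i j t * x i * Y j w)%R) | x in Bp P X p]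
    + ereal_sup [set \int[P]_w Lqnorm mu q
         (fun t => (\sum_(i < n) \sum_(j < n) a i j t * X i w * y j)%R) | y in Bp P Y p]
    + ereal_sup [set normXp P X p
         (fun i => Num.sqrt (\sum_(j < n) f (a i j) ^+ 2)%R) | f in Bf]
    + ereal_sup [set normXYp P X Y p (fun i j => f (a i j)) | f in Bf]
    + p%:E * \big[maxe/-oo]_(i < n)
        ereal_sup [set (Num.sqrt (\sum_(j < n) f (a i j) ^+ 2)%R)%:E | f in Bf]))%E.
Proof.
have C0 : 0 < 4 * Cmain R by apply: mulr_gt0 => //; exact: Cmain_gt0.
exists (4 * Cmain R); split=> //.
move=> d T mu d' Om P n X Y a n0 mX mY ind sX sY lX lY nX nY ha p p1; cbv zeta.
pose S (w : Om) t := \sum_(i < n) \sum_(j < n) a i j t * X i w * Y j w; pose Bf := dual_ball mu q.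
have HX : admissible P X by [].
have HY : admissible P Y by [].
have HB := dual_norming hq ha.
have p0 : 0 <= p by apply: le_trans p1.
have nE (u v : 'I_n -> R) :
    Lqnorm mu q (fun t => \sum_(i < n) \sum_(j < n) a i j t * u i * v j) = (mx_norm mu q a (ten u v))%:E.
  rewrite -(mx_normE hq ha); congr (Lqnorm _ _ _); apply/funext => t.
  by apply: eq_bigr => i _; apply: eq_bigr => j _; rewrite mulrA.
have sumXY w : Lqnorm mu q (S w) = (mx_norm mu q a (ten (X^~ w) (Y^~ w)))%:E := nE _ _.
set T1 := (\int[P]_w Lqnorm mu q (S w))%E.
set T2 := ereal_sup [set _ | x in _].
set T3 := ereal_sup [set _ | y in Bp P Y p].
set T4 := ereal_sup [set normXp P X p _ | f in _].
set T5 := ereal_sup [set normXYp P X Y p _ | f in _].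
set T6 := (p%:E * _)%E.
have z0 : Bf (fun=> 0) := dual_ball0 mu q.
have sq0 (k : 'I_n -> R) : (forall j, k j = 0) -> Num.sqrt (\sum_(j < n) k j ^+ 2) = 0.
  by move=> k0; rewrite big1 ?sqrtr0 // => j _; rewrite k0 expr0n.
have T10 : (0 <= T1)%E by apply: integral_ge0 => w _; exact: Lnorm_ge0.
have T20 : (0 <= T2)%E.
  apply: (@le_trans _ _ (\int[P]_w Lqnorm mu q (fun t => (\sum_(i < n) \sum_(j < n) a i j t * (fun=> 0) i * Y j w)%R))%E).
    by apply: integral_ge0 => w _; exact: Lnorm_ge0.
  by apply: ereal_sup_ubound; exists (fun=> 0) => //; exact: Bp0.
have T30 : (0 <= T3)%E.
  apply: (@le_trans _ _ (\int[P]_w Lqnorm mu q (fun t => (\sum_(i < n) \sum_(j < n) a i j t * X i w * (fun=> 0) j)%R))%E).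
    by apply: integral_ge0 => w _; exact: Lnorm_ge0.
  by apply: ereal_sup_ubound; exists (fun=> 0) => //; exact: Bp0.
have T40 : (0 <= T4)%E.
  apply: (@le_trans _ _ (normXp P X p (fun i => Num.sqrt (\sum_(j < n) (fun=> 0 : R) (a i j) ^+ 2)))).
    apply: ereal_sup_ubound; exists (fun=> 0); first exact: Bp0.
    by rewrite big1 // => i _; rewrite mulr0.
  by apply: ereal_sup_ubound; exists (fun=> 0).
have T50 : (0 <= T5)%E.
  apply: (@le_trans _ _ (normXYp P X Y p (fun i j => (fun=> 0 : R) (a i j)))).
    apply: ereal_sup_ubound; exists (fun=> 0), (fun=> 0); split; first exact: Bp0.
    split; first exact: Bp0.
    by rewrite big1 // => i _; rewrite big1 // => j _; rewrite mulr0.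
  by apply: ereal_sup_ubound; exists (fun=> 0).
have T6i i f : Bf f -> (p%:E * (Num.sqrt (\sum_(j < n) f (a i j) ^+ 2))%:E <= T6)%E.
  move=> hf; apply: lee_wpmul2l; first by rewrite lee_fin.
  apply: le_trans (le_bigmax _ _ i); by apply: ereal_sup_ubound; exists f.
(* The maximum has default value [-oo]; an index to test exists because [n >= 1]. *)
have T60 : (0 <= T6)%E.
  by have := T6i (Ordinal n0) _ z0; rewrite sq0 // mule0.
have [[U1 U2 U3] [U4 U5 U6]] := lee_sum6 T10 T20 T30 T40 T50 T60.
move: U1 U2 U3 U4 U5 U6; set s := (_ + T6)%E => U1 U2 U3 U4 U5 U6.
have s0 : (0 <= s)%E by exact: le_trans U1.
have [sy|sfin] := eqVneq s +oo%E; first by rewrite sy gt0_muley ?leey // lte_fin.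
have sE : s = (fine s)%:E by rewrite fineK // ge0_fin_numE // ltey.
have fs0 : 0 <= fine s by rewrite fine_ge0.
rewrite sE -EFinM; apply/lee_addgt0Pr => e e0.
(* The excess keeps [t] positive even when all six terms vanish, and it becomes exactly [e] after
   multiplication by the constant. *)
pose t := fine s + e / (4 * Cmain R).
have e'0 : 0 < e / (4 * Cmain R) by rewrite divr_gt0.
have st (x : \bar R) : (x <= s)%E -> (x <= t%:E)%E.
  by move=> xs; apply: (le_trans xs); rewrite sE lee_fin lerDl ltW.
have t0 : 0 < t by rewrite /t ltr_wpDl.
have -> : ((4 * Cmain R * fine s)%:E + e%:E = (4 * Cmain R * t)%:E)%E.
  by rewrite -EFinD /t mulrDr [_ * (e / _)]mulrC divfK // gt_eqF.
have key : (\int[P]_w (mx_norm mu q a (ten (X^~ w) (Y^~ w)) `^ p)%:E <= ((4 * Cmain R * t) `^ p)%:E)%E.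
  apply: (norm_moment HX HY ind HB p1 t0).
  - apply: st; rewrite (_ : (\int[P]_w _)%E = T1) //.
    by apply: eq_integral => w _; rewrite sumXY.
  - move=> v bv; apply: st; apply: le_trans U2; apply: ereal_sup_ubound; exists v => //.
    by apply: eq_integral => w _; exact: nE.
  - move=> v bv; apply: st; apply: le_trans U3; apply: ereal_sup_ubound; exists v => //.
    by apply: eq_integral => w _; exact: nE.
  - move=> _ v [f [hf ->]] bv; rewrite -lee_fin; apply: st; apply: le_trans U4.
    apply: (@le_trans _ _ (normXp P X p (fun i => Num.sqrt (\sum_(j < n) f (a i j) ^+ 2)))).
      by apply: ereal_sup_ubound; exists v.
    by apply: ereal_sup_ubound; exists f.
  - move=> _ v u [f [hf ->]] bv bu; rewrite -lee_fin; apply: st; apply: le_trans U5.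
    apply: (@le_trans _ _ (normXYp P X Y p (fun i j => f (a i j)))).
      by apply: ereal_sup_ubound; exists v, u.
    by apply: ereal_sup_ubound; exists f.
  - move=> _ i [f [hf ->]]; rewrite -lee_fin EFinM; apply: st; apply: le_trans U6.
    exact: T6i.
under eq_integral do rewrite sumXY poweR_EFin.
have D0 : 0 <= 4 * Cmain R * t by rewrite mulr_ge0 ?ltW.
have -> : (4 * Cmain R * t)%:E = (((4 * Cmain R * t) `^ p)%:E `^ p^-1)%E.
  by rewrite poweR_EFin -powRrM mulfV ?powRr1 // gt_eqF // (lt_le_trans ltr01).
apply: gt0_ler_poweR; rewrite ?invr_ge0 // in_itv /= leey andbT.
  by apply: integral_ge0 => w _; rewrite lee_fin powR_ge0.
by rewrite lee_fin powR_ge0.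
Qed.
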